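(* Let $1\leqslant k<n$. The index of a $k$-dimensional free boundary minimal geodesic ball in an $n$-dimensional geodesic ball $\mathbb B^n(r)$ in $\mathbb S^n_+$ ($0<r<\frac{\pi}{2}$) or in $\mathbb H^n$ ($r>0$) equals $n-k$.
   Context: $\mathbb S^n_+$ is the upper hemisphere $\{x_0>0\}$ of the unit sphere in Euclidean $\mathbb R^{n+1}$; $\mathbb H^n$ is the upper sheet of $-x_0^2+\sum_{i=1}^nx_i^2=-1$ in $\mathbb R^{n+1}$ with the metric $-dx_0^2+\sum_{i=1}^ndx_i^2$. $\mathbb B^n(r)$ is the geodesic ball of radius $r$ centred at $(1,0,\ldots,0)$. A $k$-dimensional free boundary minimal geodesic ball $\mathbb B^k(r)$ in $\mathbb B^n(r)$ is the totally geodesic submanifold $\mathbb B^n(r)\cap\Pi$, where $\Pi\subset\mathbb R^{n+1}$ is a linear subspace of dimension $k+1$ containing $(1,0,\ldots,0)$. Index: for a $k$-dimensional free boundary minimal submanifold $\Sigma$ in $\mathbb B^n(r)$ (minimal, with $\partial\Sigma\subset\partial\mathbb B^n(r)$, meeting $\partial\mathbb B^n(r)$ orthogonally), the (Morse) index is the maximal dimension of a subspace of smooth sections of the normal bundle $N\Sigma$ on which the second variation of volume $S$ is negative definite, where $$S(X,X)=\int_\Sigma\Big(|\nabla^\perp X|^2-\kappa k|X|^2-\sum_{i,j=1}^k\langle B(e_i,e_j),X\rangle^2\Big)dA-c_r\int_{\partial\Sigma}|X|^2dL,$$ $\nabla^\perp$ is the normal connection, $|\nabla^\perp X|^2=\sum_{i=1}^k|\nabla^\perp_{e_i}X|^2$,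 $B$ is the second fundamental form of $\Sigma$, $e_1,\ldots,e_k$ is a local orthonormal frame of $T\Sigma$, and $\kappa=1$, $c_r=\cot r$ for $\mathbb S^n_+$, while $\kappa=-1$, $c_r=\coth r$ for $\mathbb H^n$. *)

(* Defs.v *)
From mathcomp Require Import all_boot all_order all_algebra.
From mathcomp Require Import all_classical all_reals all_analysis.

Set Implicit Arguments.
Unset Strict Implicit.
Unset Printing Implicit Defensive.

Import Order.TTheory GRing.Theory Num.Theory.
Import numFieldNormedType.Exports.

Local Open Scope classical_set_scope.
Local Open Scope ring_scope.

Inductive space_form := Spherical | Hyperbolic.

Section SpaceForm.
Context {R : realType} (g : space_form).

Definition kappa : R := if g is Spherical then 1 else -1.

Definition cosh (t : R) : R := (expR t + expR (- t)) / 2.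
Definition sinh (t : R) : R := (expR t - expR (- t)) / 2.

Definition gcos (t : R) : R := if g is Spherical then cos t else cosh t.
Definition gsin (t : R) : R := if g is Spherical then sin t else sinh t.
Definition gcot (t : R) : R := gcos t / gsin t.

Context {n : nat}.
Local Notation V := 'rV[R]_n.+1.

(* Euclidean (kappa = 1) or Lorentzian (kappa = -1) inner product *)
Definition form (x y : V) : R :=
  kappa * x 0 0 * y 0 0
  + \sum_(i < n) x 0 (lift ord0 i) * y 0 (lift ord0 i).
Definition sqnorm (x : V) : R := form x x.

Definition ambient : set V := [set x | sqnorm x = kappa /\ 0 < x 0 0].

Definition pole : V := delta_mx 0 0.

Definition C1_curve (c : R -> V) : Prop :=
  (forall t, derivable c t 1) /\ continuous (derive1 c).

Definition dist (p q : V) : R :=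
  inf [set L | exists c : R -> V,
    [/\ C1_curve c, c 0 = p, c 1 = q,
        (forall t, 0 <= t <= 1 -> ambient (c t)) &
        L = \int[lebesgue_measure]_(t in `[0, 1])
              Num.sqrt (sqnorm (derive1 c t))]].

Definition geodesic_ball (r : R) : set V :=
  [set x | ambient x /\ dist pole x <= r].

Definition smooth (X : V -> V) : Prop :=
  forall (s : seq V) (x : V),
    differentiable (foldr (fun v (Y : V -> V) => 'D_v Y) X s) x.

(* Velocities of one-sided curves in [S] issued from [p].  At a boundary point
   of a submanifold these only fill a half-space, hence the linear span in the
   next definition. *)
Definition tangent_cone (S : set V) (p : V) : set V :=
  [set v | exists c : R -> V,
    (\forall t \near 0^'+, S (c t)) /\
    (fun t => t^-1 *: (c t - p)) @ 0^'+ --> v].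

Definition tangent_space (S : set V) (p : V) : set V :=
  [set v | forall U : {vspace V},
    (forall w, tangent_cone S p w -> w \in U) -> v \in U].

Definition normal_space (S : set V) (p : V) : set V :=
  [set v | tangent_space ambient p v /\
           forall w, tangent_space S p w -> form v w = 0].

Definition proj (N : set V) (u : V) : V :=
  xget 0 [set w | N w /\ forall z, N z -> form (u - w) z = 0].

(* Since [normal_space] is contained in the tangent space of [ambient],
   projecting the flat derivative of the ambient vector space is the same as
   projecting the Levi-Civita derivative of [ambient]. *)
Definition normal_connection (S : set V) (p v : V) (X : V -> V) : V :=
  proj (normal_space S p) ('D_v X p).

Definition tangent_field (S : set V) (Y : V -> V) : Prop :=
  smooth Y /\ forall p, S p -> tangent_space S p (Y p).

(* B(v, w) at p is the normal part of the derivative along v of any tangent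
   field extending w. *)
Definition second_fundamental_form (S : set V) (p v w : V) : V :=
  xget 0 [set b | exists Y : V -> V,
    [/\ tangent_field S Y, Y p = w &
        b = proj (normal_space S p) ('D_v Y p)]].

(* Smooth sections of the normal bundle of the closed set [S] are given by
   smooth maps of the ambient vector space, of which only the restriction to
   [S] matters (see [negative_subspace]). *)
Definition normal_section (S : set V) (X : V -> V) : Prop :=
  smooth X /\ forall p, S p -> normal_space S p (X p).

Definition orthonormal_basis (k : nat) (T : set V) (E : 'M[R]_(k, n.+1)) :=
  (forall i j, form (row i E) (row j E) = (i == j)%:R) /\
  T = [set v | exists a : 'rV[R]_k, v = a *m E].

Definition frame (k : nat) (T : set V) : 'M[R]_(k, n.+1) :=
  xget 0 [set E | orthonormal_basis T E].

(* The library has no Lebesgue measure on R^m: iterated integrals are used,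
   which agree with it on continuous integrands. *)
Fixpoint box_integral (m : nat) : 'rV[R]_m -> 'rV[R]_m -> ('rV[R]_m -> R) -> R :=
  match m with
  | 0 => fun _ _ f => f 0
  | m'.+1 => fun (lo hi : 'rV[R]_(1 + m')) f =>
      \int[lebesgue_measure]_(t in `[lo 0 0, hi 0 0])
        box_integral (rsubmx lo) (rsubmx hi)
          (fun y => f (row_mx t%:M y : 'rV[R]_(1 + m')))
  end.

Definition partial (m : nat) (phi : 'rV[R]_m -> V) (i : 'I_m) (y : 'rV[R]_m) : V :=
  derive1 (fun t : R => phi (y + t *: delta_mx 0 i)) 0.

Definition area_density (m : nat) (phi : 'rV[R]_m -> V) (y : 'rV[R]_m) : R :=
  Num.sqrt (\det (\matrix_(i < m, j < m)
    form (partial phi i y) (partial phi j y))).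

Definition area_integral (m : nat) (lo hi : 'rV[R]_m) (phi : 'rV[R]_m -> V)
    (f : V -> R) : R :=
  box_integral lo hi (fun y => f (phi y) * area_density phi y).

(* [intS] and [intdS] are the integrals over the k-dimensional submanifold [S]
   and over its boundary, [c] is the constant of the boundary term. *)
Definition second_variation (k : nat) (S : set V) (intS intdS : (V -> R) -> R)
    (c : R) (X : V -> V) : R :=
  intS (fun p =>
    let e i := row i (frame k (tangent_space S p)) in
    \sum_(i < k) sqnorm (normal_connection S p (e i) X)
    - kappa * k%:R * sqnorm (X p)
    - \sum_(i < k) \sum_(j < k)
        form (second_fundamental_form S p (e i) (e j)) (X p) ^+ 2)
  - c * intdS (fun p => sqnorm (X p)).

(* [Q] is negative definite on some d-dimensional space of normal sections of
   [S], given by a basis X_1, .., X_d.  Linear independence is that of the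
   sections, i.e. of the restrictions to [S]. *)
Definition negative_subspace (S : set V) (Q : (V -> V) -> R) (d : nat) : Prop :=
  exists X : 'I_d -> V -> V,
    [/\ forall i, normal_section S (X i),
        forall a : 'rV[R]_d,
          (forall p, S p -> \sum_(i < d) a 0 i *: X i p = 0) -> a = 0 &
        forall a : 'rV[R]_d, a != 0 ->
          Q (fun p => \sum_(i < d) a 0 i *: X i p) < 0].

Definition morse_index_is (S : set V) (Q : (V -> V) -> R) (d : nat) : Prop :=
  negative_subspace S Q d /\
  forall d', negative_subspace S Q d' -> (d' <= d)%N.

Definition geodesic_subball (r : R) (Pi : {vspace V}) : set V :=
  [set x | geodesic_ball r x /\ x \in Pi].

(* j-th coordinate (0 <= j <= m) of the point of the unit sphere of R^(m+1)
   with spherical angles theta: the product of sin theta_i for i < j, times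
   cos theta_j if j < m. *)
Definition spherical_coord (m : nat) (theta : 'rV[R]_m) (j : nat) : R :=
  (\prod_(i < m | (i < j)%N) sin (theta 0 i))
  * \prod_(i < m | i == j :> nat) cos (theta 0 i).

(* Geodesic polar coordinates of a k-dimensional [S] around [pole]. *)
Definition polar (k : nat) (S : set V) (rho : R) (theta : 'rV[R]_k.-1) : V :=
  gcos rho *: pole
  + gsin rho *: \sum_(j < k)
      spherical_coord theta j *: row j (frame k (tangent_space S pole)).
Arguments polar k S rho theta : clear implicits.

(* All angles run through [0, pi], so the directions fill a half-sphere; hence
   the radius is signed, rho in [-r, r].  This covers the ball once up to a
   null set, and works for k = 1 too. *)
Definition ball_integral (k : nat) (r : R) (S : set V) (f : V -> R) : R :=
  area_integral
    (row_mx (- r)%:M (const_mx 0) : 'rV[R]_(1 + k.-1))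
    (row_mx r%:M (const_mx pi) : 'rV[R]_(1 + k.-1))
    (fun y => polar k S (y 0 0) (rsubmx y)) f.

(* two half-spheres, rho = r and rho = -r *)
Definition sphere_integral (k : nat) (r : R) (S : set V) (f : V -> R) : R :=
  area_integral (const_mx 0) (const_mx pi) (polar k S r) f
  + area_integral (const_mx 0) (const_mx pi) (polar k S (- r)) f.

Definition ball_second_variation (k : nat) (r : R) (S : set V) :
    (V -> V) -> R :=
  second_variation k S (ball_integral k r S) (sphere_integral k r S) (gcot r).

End SpaceForm.

(* Main.v *)
Require Import Defs.
From mathcomp Require Import all_boot all_order all_algebra.
From mathcomp Require Import all_classical all_reals all_analysis.
From mathcomp Require Import ring lra.

Set Implicit Arguments.
Unset Strict Implicit.
Unset Printing Implicit Defensive.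

Import Order.TTheory GRing.Theory Num.Theory.
Import numFieldNormedType.Exports.

Local Open Scope classical_set_scope.
Local Open Scope ring_scope.

(* Let N be the orthogonal complement of Pi, of dimension n - k.  The normal space
   of the geodesic ball S is N at every point and S is totally geodesic, so the
   second variation splits over the coordinates of a normal field X into the
   scalar forms
     q(u) = int_S (|grad u|^2 - kappa k u^2) - c_r int_{dS} u^2.
   On constant multiples of the height x_0 the form q is negative, hence the
   fields x_0 v with v in N give index at least n - k.  Conversely q(u) >= 0 when
   u has mean zero over dS: on the geodesic spheres of radius t write u as its
   mean plus a fluctuation; after the Poincare inequality on the sphere, the
   fluctuation part is handled by completing a square with the solution sin t
   (sinh t) of the radial equation and the mean part, which vanishes at t = r,
   with cos t (cosh t).  Taking the mean of X over dS maps normal fields to N, so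
   in any space of dimension > n - k some field X <> 0 has mean zero. *)

(** The constants fit with no slack. A geodesic sphere in S has dimension m = k - 1, and m is the
    first nonzero eigenvalue of the Laplacian of the unit m-sphere; with it the square for the
    fluctuation uses the logarithmic derivative [gc / gs], whose value at r is c_r, so the boundary
    term left by the square is exactly the one in q. The Poincare inequality comes from the same
    radial computation: the unit sphere is foliated by latitude spheres with radial functions cos
    and sin, so one family of lemmas with abstract c, s and curvature kap serves both the induction
    on the dimension and the two space forms. The obstacle there is degeneration: s vanishes at the
    centre and cos at the equator, so antiderivatives containing 1/s or 1/c are compared through
    one-sided limits only. The rest of the work comes from the definitions: distance is an infimum
    of lengths, tangent spaces are spans of one-sided velocities, frames and projections are chosen,
    and integrals are iterated over angles of half-spheres with a signed radius. Each of these is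
    computed on S, where it reduces to linear algebra in Pi. *)

(** * Continuity rules *)

Lemma cts_comp (X Y Z : topologicalType) (f : X -> Y) (g : Y -> Z) :
  continuous f -> continuous g -> continuous (fun x => g (f x)).
Proof. by move=> cf cg x; apply: (@continuous_comp _ _ _ f g); [exact: cf|exact: cg]. Qed.

Lemma cts_pair (X Y Z : topologicalType) (f : X -> Y) (g : X -> Z) :
  continuous f -> continuous g -> continuous (fun x => (f x, g x)).
Proof. by move=> cf cg x; exact: (cvg_pair (cf x) (cg x)). Qed.

Lemma cts_fst (X Y : topologicalType) : continuous (fun x : X * Y => x.1).
Proof. by move=> x; exact: cvg_fst. Qed.

Lemma cts_snd (X Y : topologicalType) : continuous (fun x : X * Y => x.2).
Proof. by move=> x; exact: cvg_snd. Qed.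

Lemma ctsC (X Y : topologicalType) (c : Y) : continuous (fun _ : X => c).
Proof. exact: cst_continuous. Qed.

Lemma ctsI (X : topologicalType) : continuous (fun x : X => x).
Proof. by move=> x; exact: cvg_id. Qed.

Lemma ctsD (R : realType) (X : topologicalType) (V : normedModType R) (f g : X -> V) :
  continuous f -> continuous g -> continuous (fun x => f x + g x).
Proof. by move=> cf cg x; apply: cvgD; [exact: cf|exact: cg]. Qed.

Lemma ctsN (R : realType) (X : topologicalType) (V : normedModType R) (f : X -> V) :
  continuous f -> continuous (fun x => - f x).
Proof. by move=> cf x; apply: cvgN; exact: cf. Qed.

Lemma ctsM (R : realType) (X : topologicalType) (f g : X -> R) :
  continuous f -> continuous g -> continuous (fun x => f x * g x).
Proof. by move=> cf cg x; apply: cvgM; [exact: cf|exact: cg]. Qed.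

Lemma ctsZ (R : realType) (X : topologicalType) (V : normedModType R) (f : X -> R) (g : X -> V) :
  continuous f -> continuous g -> continuous (fun x => f x *: g x).
Proof. by move=> cf cg x; apply: cvgZ; [exact: cf|exact: cg]. Qed.

Lemma ctsX (R : realType) (X : topologicalType) n (f : X -> R) : continuous f -> continuous (fun x => f x ^+ n).
Proof.
move=> cf; elim: n => [|n IH]; first exact: ctsC.
by under [G in continuous G]eq_fun => x do rewrite exprS; exact: ctsM.
Qed.

Lemma cts_sum (R : realType) (X : topologicalType) (V : normedModType R) (I : Type) (r : seq I) (F : I -> X -> V) :
  (forall i, continuous (F i)) -> continuous (fun x => \sum_(i <- r) F i x).
Proof.
move=> cF; elim: r => [|i r IH].
  by under [G in continuous G]eq_fun => x do rewrite big_nil; exact: ctsC.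
by under [G in continuous G]eq_fun => x do rewrite big_cons; exact: ctsD.
Qed.

Lemma cts_cos (R : realType) : continuous (@cos R).
Proof. exact: continuous_cos. Qed.

Lemma cts_sin (R : realType) : continuous (@sin R).
Proof. exact: continuous_sin. Qed.

Lemma cts_mx (R : realType) (X : topologicalType) m n (f : X -> 'M[R]_(m, n)) :
  (forall i j, continuous (fun x => f x i j)) -> continuous f.
Proof.
move=> cf x A [P nP PA].
have : \forall y \near x, forall i j, P i j (f y i j).
  by apply: filter_forall => i; apply: filter_forall => j; exact: cf.
by apply: filterS => y hy; exact: PA.
Qed.

Lemma cts_coord (R : realType) m n (i : 'I_m) (j : 'I_n) :
  continuous (fun x : 'M[R]_(m, n) => x i j).
Proof. exact: coord_continuous. Qed.

(** * Derivatives of functions of one real variable *)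

Section DeriveFun.
Context {R : realType}.
Implicit Types (f g : R -> R) (t a b : R).

Lemma der1_comp f g t a b : is_derive (g t) 1 f a -> is_derive t 1 g b ->
  is_derive t 1 (fun s => f (g s)) (a * b).
Proof. by move=> hf hg; have := is_derive1_comp hf hg; rewrite mulrC. Qed.

Lemma der1D f g t a b : is_derive t 1 f a -> is_derive t 1 g b ->
  is_derive t 1 (fun s => f s + g s) (a + b).
Proof. by move=> hf hg; exact: is_deriveD. Qed.

Lemma der1B f g t a b : is_derive t 1 f a -> is_derive t 1 g b ->
  is_derive t 1 (fun s => f s - g s) (a - b).
Proof. by move=> hf hg; exact: is_deriveB. Qed.

Lemma der1M f g t a b : is_derive t 1 f a -> is_derive t 1 g b ->
  is_derive t 1 (fun s => f s * g s) (a * g t + f t * b).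
Proof.
move=> hf hg; apply: (is_derive_eq (is_deriveM hf hg)).
by rewrite /GRing.scale /= addrC mulrC.
Qed.

Lemma der1C (V : normedModType R) (c : V) t : is_derive t 1 (fun _ : R => c) 0.
Proof. exact: is_derive_cst. Qed.

Lemma der1I t : is_derive t 1 (fun s : R => s) 1.
Proof. exact: is_derive_id. Qed.

Lemma der1Z c f t a : is_derive t 1 f a ->
  is_derive t 1 (fun s => c * f s) (c * a).
Proof.
by move=> hf; apply: (is_derive_eq (der1M (der1C c t) hf)); rewrite mul0r add0r.
Qed.

Lemma der1X n f t a : is_derive t 1 f a ->
  is_derive t 1 (fun s => f s ^+ n) (n%:R * f t ^+ n.-1 * a).
Proof.
move=> hf; elim: n => [|n IH].
  by apply: (is_derive_eq (der1C (1 : R) t)); rewrite !mul0r.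
have -> : (fun s => f s ^+ n.+1) = (fun s => f s * f s ^+ n).
  by apply/funext => s; rewrite exprS.
apply: (is_derive_eq (der1M hf IH)); case: n {IH} => [|n] /=.
  by rewrite !expr0; lra.
by rewrite [n.+2%:R]mulrSr exprS; ring.
Qed.

Lemma der1V f t a : is_derive t 1 f a -> f t != 0 ->
  is_derive t 1 (fun s => (f s)^-1) (- a / f t ^+ 2).
Proof.
move=> hf f0; have := is_deriveV f0 hf.
by move=> h; apply: (is_derive_eq h); rewrite /GRing.scale /=; field.
Qed.

Lemma deriv_cts f t a : is_derive t 1 f a -> {for t, continuous f}.
Proof. by case=> df _; apply: differentiable_continuous; apply/derivable1_diffP. Qed.

End DeriveFun.

(** * Integrals over segments and spheres *)

Definition seg_int (R : realType) (a b : R) (f : R -> R) : R :=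
  \int[lebesgue_measure]_(t in `[a, b]) f t.

Section SegInt.
Context {R : realType}.
Implicit Types (f g F Z : R -> R) (a b : R).

Lemma seg_integrable f a b : continuous f ->
  (@lebesgue_measure R).-integrable `[a, b] (EFin \o f).
Proof.
move=> cf; apply: continuous_compact_integrable; first exact: segment_compact.
exact: continuous_subspaceT.
Qed.

Lemma eq_seg_int f g a b : (forall t, a <= t <= b -> f t = g t) ->
  seg_int a b f = seg_int a b g.
Proof. by move=> fg; apply: eq_Rintegral => t; rewrite inE /= in_itv /=; exact: fg. Qed.

Lemma seg_intD f g a b : continuous f -> continuous g ->
  seg_int a b (fun t => f t + g t) = seg_int a b f + seg_int a b g.
Proof. by move=> cf cg; apply: RintegralD => //; exact: seg_integrable. Qed.

Lemma seg_intZ c f a b : continuous f ->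
  seg_int a b (fun t => c * f t) = c * seg_int a b f.
Proof. by move=> cf; apply: RintegralZl => //; exact: seg_integrable. Qed.

Lemma seg_int_ge0 f a b : (forall t, a <= t <= b -> 0 <= f t) ->
  0 <= seg_int a b f.
Proof. by move=> f0; apply: Rintegral_ge0 => t; rewrite /= in_itv /=; exact: f0. Qed.

Lemma le_seg_int f g a b : continuous f -> continuous g ->
  (forall t, a <= t <= b -> f t <= g t) -> seg_int a b f <= seg_int a b g.
Proof.
by move=> cf cg fg; apply: le_Rintegral => //; exact: seg_integrable.
Qed.

Lemma antiderivative f a : continuous f ->
  {F | forall t, a <= t -> is_derive t 1 F (f t)}.
Proof.
(* The base point [a - 1] lies strictly to the left, so that the derivative at [a] itself is
   two-sided. *)
move=> cf; exists (fun x => seg_int (a - 1) x f) => t at_.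
have [] := @continuous_FTC1_closed R f (a - 1) t (t + 1) _ _ _ (cf t).
- by rewrite ltrDl.
- exact: seg_integrable.
- by lra.
- by rewrite derive1E => dF <-; exact: (derivableP dF).
Qed.

Lemma seg_int_FTC f F a b : a <= b -> continuous f ->
  (forall t, a <= t -> is_derive t 1 F (f t)) -> seg_int a b f = F b - F a.
Proof.
rewrite le_eqVlt => /predU1P[<- _ _|ab cf dF].
  by rewrite /seg_int set_itv1 Rintegral_set1 subrr.
have cF t : a <= t -> F x @[x --> t] --> F t.
  move=> at_; apply: differentiable_continuous; apply/derivable1_diffP.
  by have := dF t at_; case.
rewrite /seg_int /Rintegral (@continuous_FTC2 _ f F) //.
- exact: continuous_subspaceT.
- split=> [x|//=|//=].
  + by rewrite in_itv /= => /andP[/ltW ax _]; have := dF x ax; case.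
  + by apply: cvg_at_right_filter; exact: cF.
  + by apply: cvg_at_left_filter; apply: cF; exact: ltW.
- move=> x; rewrite in_itv /= => /andP[/ltW ax _].
  by rewrite derive1E; exact: (@derive_val _ _ _ _ _ _ _ (dF x ax)).
Qed.

Lemma seg_int_cst c a b : a <= b -> seg_int a b (fun=> c) = c * (b - a).
Proof.
move=> ab; have dF t : a <= t -> is_derive t 1 (fun t => c * t) c.
  by move=> _; apply: is_derive_eq; rewrite /GRing.scale /= mulr1 ?mulr0 ?addr0.
by rewrite (seg_int_FTC ab (@cst_continuous _ _ c) dF) mulrBr.
Qed.

Lemma seg_int_split f a b c : a <= b -> b <= c -> continuous f ->
  seg_int a c f = seg_int a b f + seg_int b c f.
Proof.
move=> ab bc cf; have [F dF] := antiderivative a cf.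
have dFb t : b <= t -> is_derive t 1 F (f t).
  by move=> bt; apply: dF; exact: le_trans bt.
rewrite (seg_int_FTC ab cf dF) (seg_int_FTC bc cf dFb).
by rewrite (seg_int_FTC (le_trans ab bc) cf dF); lra.
Qed.

Lemma seg_int_reflect f a b c : a <= b -> continuous f ->
  seg_int a b (fun t => f (c - t)) = seg_int (c - b) (c - a) f.
Proof.
move=> ab cf.
have cg : continuous (fun t => f (c - t)).
  move=> t; apply: (@continuous_comp _ _ _ (fun t => c - t) f); last exact: cf.
  by apply: cvgB; [exact: cvg_cst|exact: cvg_id].
have [F dF] := antiderivative (c - b) cf.
have [G dG] := antiderivative a cg.
have cbca : c - b <= c - a by lra.
rewrite (seg_int_FTC cbca cf dF) (seg_int_FTC ab cg dG).
(* [H] has derivative zero on the segment, so it takes the same value at both ends: this is the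
   substitution rule. *)
pose H t := G t + F (c - t).
suff : H b = H a by rewrite /H; lra.
have dH t : a <= t <= b -> is_derive t 1 H 0.
  move=> /andP[at_ tb].
  have h1 := dG t at_.
  have h2 : is_derive (c - t) 1 F (f (c - t)) by apply: dF; lra.
  have h3 : is_derive t 1 (fun t => c - t) (-1).
    by apply: (is_derive_eq (der1B (der1C c t) (der1I t))); rewrite sub0r.
  have h4 := @der1_comp R F (fun t => c - t) t _ _ h2 h3.
  have h5 := der1D h1 h4.
  by apply: (is_derive_eq h5); rewrite /GRing.scale /=; lra.
move: ab; rewrite le_eqVlt => /predU1P[-> //|ab].
have [] := @MVT R H (fun=> 0) a b ab.
- by move=> x; rewrite in_itv /= => /andP[/ltW ? /ltW ?]; apply: dH; apply/andP.
- apply: derivable_within_continuous => x; rewrite in_itv /= => hx.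
  by have [] := dH x hx.
- by move=> x _; rewrite mul0r; lra.
Qed.

End SegInt.

Section SegIntCompare.
Context {R : realType}.

(** An antiderivative of [f] minus [Z] is nondecreasing on the open interval, and the inequality
    passes to the one-sided limits. Limits replace values because [Z] will contain quotients whose
    denominators vanish at an endpoint. *)
Lemma seg_int_ge (f Z z : R -> R) (a b za zb : R) : a < b -> continuous f ->
  (forall t, a < t < b -> is_derive t 1 Z (z t)) ->
  (forall t, a < t < b -> z t <= f t) ->
  Z t @[t --> a^'+] --> za -> Z t @[t --> b^'-] --> zb ->
  zb - za <= seg_int a b f.
Proof.
move=> ab cf dZ zf Za Zb.
have [F dF] := antiderivative a cf.
rewrite (seg_int_FTC (ltW ab) cf dF).
have cF t : a <= t -> F x @[x --> t] --> F t by move/dF/deriv_cts.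
have dH t : a < t < b -> is_derive t 1 (fun t => F t - Z t) (f t - z t).
  by move=> /[dup] /andP[/ltW /dF h1 _] /dZ h2; exact: der1B.
have mono s t : a < s -> s <= t -> t < b -> F s - Z s <= F t - Z t.
  move=> as_; rewrite le_eqVlt => /predU1P[-> //|st] tb.
  have [x||x hx E] := @MVT R (fun t => F t - Z t) (fun t => f t - z t) s t st.
  - by rewrite in_itv /= => /andP[sx xt]; apply: dH; apply/andP; split; lra.
  - apply: derivable_within_continuous => x; rewrite in_itv /= => /andP[sx xt].
    by have [|//] := dH x _; apply/andP; split; lra.
  - rewrite -subr_ge0 E mulr_ge0 ?subr_ge0 ?(ltW st) // zf //.
    by move: hx; rewrite in_itv /= => /andP[sx xt]; apply/andP; split; lra.
have HA : (fun t => F t - Z t) @ a^'+ --> F a - za.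
  by apply: cvgB => //; apply: cvg_at_right_filter; apply: cF.
have HB : (fun t => F t - Z t) @ b^'- --> F b - zb.
  by apply: cvgB => //; apply: cvg_at_left_filter; apply: cF; exact: ltW.
suff: F a - za <= F b - zb by lra.
have h1 s : a < s -> s < b -> F s - Z s <= F b - zb.
  move=> as_ sb; apply: (cvgr_to_ge HB); near=> t; apply: mono => //; near: t.
  exact: nbhs_left_ge.
apply: (cvgr_to_le HA); near=> s; apply: h1; near: s.
- exact: nbhs_right_gt.
- exact: nbhs_right_lt.
Unshelve. all: by end_near. Qed.

(** Compactness of the segment turns joint continuity into closeness of [g p] to [g p0] uniformly in
    the variable of integration. *)
Lemma seg_int_cts (P : topologicalType) (g : P -> R -> R) (a b : R) :
  a <= b -> continuous (fun x : P * R => g x.1 x.2) ->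
  continuous (fun p => seg_int a b (g p)).
Proof.
move=> ab cg p0.
have cgp p : continuous (g p).
  by apply: (@cts_comp _ _ _ (fun t => (p, t)) (fun x => g x.1 x.2)) => //;
    apply: cts_pair; [exact: ctsC|exact: ctsI].
apply/cvgrPdist_le => e e0.
(* The [+ 1] keeps the denominator positive when [a = b]. *)
have d0 : 0 < e / (b - a + 1) by rewrite divr_gt0 // ltr_wpDl // subr_ge0.
have : \forall p \near p0, forall t, `[a, b]%classic t ->
    `|g p0 t - g p t| <= e / (b - a + 1).
  have /compact_near_coveringP := @segment_compact R a b.
  move=> /(_ P (nbhs p0) (fun p t => `|g p0 t - g p t| <= e / (b - a + 1))).
  apply=> t _.
  have h1 := cg (p0, t).
  have h2 := cgp p0 t.
  have e2 : 0 < e / (b - a + 1) / 2 by rewrite divr_gt0.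
  move/cvgrPdist_le : h1 => /(_ _ e2) h1.
  move/cvgrPdist_le : h2 => /(_ _ e2) h2.
  case: h1 => -[/= A B] [nA nB] AB.
  exists ((B `&` [set x | `|g p0 t - g p0 x| <= e / (b - a + 1) / 2]), A).
    by split => //=; exact: filterI.
  move=> [x p] /= [[Bx h3] Ap]; have /= h4 := AB (p, x) (conj Ap Bx).
  rewrite (_ : g p0 x - g p x = (g p0 t - g p x) - (g p0 t - g p0 x)); last by ring.
  by rewrite (le_trans (ler_normB _ _)) // [leRHS]splitr lerD.
apply: filterS => p hp.
have cN : continuous (fun t => - g p t).
  by move=> t; apply: cvgN; exact: cgp.
have -> : seg_int a b (g p0) - seg_int a b (g p)
        = seg_int a b (fun t => g p0 t - g p t).
  rewrite -mulN1r -seg_intZ; last exact: cgp.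
  rewrite -seg_intD //; first by apply: eq_seg_int => t _; rewrite mulN1r.
  by move=> t; apply: cvgMr; exact: cgp.
have cgg : continuous (fun t => g p0 t - g p t).
  by move=> t; apply: cvgB; exact: cgp.
set d := e / (b - a + 1).
have de : d * (b - a) <= e.
  by rewrite /d mulrAC ler_pdivrMr ?ltr_wpDl ?subr_ge0 // ler_pM2l //; lra.
have hp' t : a <= t <= b -> - d <= g p0 t - g p t <= d.
  by move=> tab; rewrite -ler_norml; apply: hp; rewrite /= in_itv.
apply: (le_trans _ de); rewrite ler_norml -mulNr -!seg_int_cst //.
apply/andP; split; apply: le_seg_int => //; try exact: cst_continuous.
  by move=> t /hp' /andP[].
by move=> t /hp' /andP[].
Qed.

End SegIntCompare.

Definition dot (R : realType) (d : nat) (x y : 'rV[R]_d) : R :=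
  \sum_(i < d) x 0 i * y 0 i.

Section Dot.
Context {R : realType}.
Implicit Types d : nat.

Lemma dotC d (x y : 'rV[R]_d) : dot x y = dot y x.
Proof. by apply: eq_bigr => i _; rewrite mulrC. Qed.

Lemma dotDr d (x y z : 'rV[R]_d) : dot x (y + z) = dot x y + dot x z.
Proof. by rewrite -big_split; apply: eq_bigr => i _; rewrite mxE mulrDr. Qed.

Lemma dotZr d (a : R) (x y : 'rV[R]_d) : dot x (a *: y) = a * dot x y.
Proof. by rewrite mulr_sumr; apply: eq_bigr => i _; rewrite mxE mulrCA. Qed.

Lemma dotZl d (a : R) (x y : 'rV[R]_d) : dot (a *: x) y = a * dot x y.
Proof. by rewrite dotC dotZr dotC. Qed.

Lemma dot_row_mx d (a b : R) (x y : 'rV[R]_d) :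
  dot (row_mx a%:M x : 'rV_(1 + d)) (row_mx b%:M y : 'rV_(1 + d)) = a * b + dot x y.
Proof.
rewrite /dot big_split_ord /= big_ord1 !row_mxEl !mxE mulr1n.
by congr (_ + _); apply: eq_bigr => i _; rewrite !row_mxEr.
Qed.

Lemma dot_cts d (X : topologicalType) (f g : X -> 'rV[R]_d) :
  continuous f -> continuous g -> continuous (fun x => dot (f x) (g x)).
Proof.
move=> cf cg; apply: cts_sum => i; apply: ctsM.
  exact: (cts_comp cf (@cts_coord _ _ _ 0 i)).
exact: (cts_comp cg (@cts_coord _ _ _ 0 i)).
Qed.

Lemma row_mx_cts d (X : topologicalType) (f : X -> R) (g : X -> 'rV[R]_d) :
  continuous f -> continuous g ->
  continuous (fun x => row_mx (f x)%:M (g x) : 'rV[R]_(1 + d)).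
Proof.
move=> cf cg; apply: cts_mx => i j.
case: (splitP j) => k /= jk.
  have -> : j = lshift d k by exact/val_inj.
  under eq_fun do rewrite row_mxEl mxE; rewrite !ord1 eqxx /=.
  by under eq_fun do rewrite mulr1n.
have -> : j = rshift 1 k by exact/val_inj.
under eq_fun do rewrite row_mxEr.
exact: (cts_comp cg (@cts_coord _ _ _ i k)).
Qed.

End Dot.

(** The radial functions are left free: [cos], [sin] give latitudes on the unit sphere, [gcos],
    [gsin] give geodesic polar coordinates of the space form. *)
Definition polar_point (R : realType) (m : nat) (c s : R) (w : 'rV[R]_m) :
  'rV[R]_m.+1 := row_mx c%:M (s *: w) : 'rV[R]_(1 + m).

(* The base case is the counting measure on the sphere {1, -1}. *)
Fixpoint sphere_int (R : realType) (m : nat) : ('rV[R]_m.+1 -> R) -> R :=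
  match m with
  | 0 => fun f => f (const_mx 1) + f (const_mx (-1))
  | m'.+1 => fun f => seg_int 0 pi (fun t =>
      sin t ^+ m' * sphere_int (fun w : 'rV[R]_m'.+1 => f (polar_point (cos t) (sin t) w)))
  end.

Section SphereInt.
Context {R : realType}.
Implicit Types m : nat.

Lemma polar_point_cts m (X : topologicalType) (c s : X -> R) (w : X -> 'rV[R]_m) :
  continuous c -> continuous s -> continuous w ->
  continuous (fun x => polar_point (c x) (s x) (w x)).
Proof. by move=> cc cs cw; apply: row_mx_cts => //; exact: ctsZ. Qed.

Lemma polar_point0 m c s (w : 'rV[R]_m) : polar_point c s w 0 0 = c.
Proof. by rewrite mxE; case: splitP => // j _; rewrite mxE ord1 mulr1n. Qed.

Lemma dot_polar_point m c s (w : 'rV[R]_m) :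
  dot (polar_point c s w) (polar_point c s w) = c ^+ 2 + s ^+ 2 * dot w w.
Proof. by rewrite dot_row_mx dotZl dotZr mulrA !expr2. Qed.

Lemma eq_sphere_int m (f g : 'rV[R]_m.+1 -> R) :
  (forall w, dot w w = 1 -> f w = g w) -> sphere_int f = sphere_int g.
Proof.
elim: m f g => [|m IH] f g fg /=.
  by rewrite !fg //; rewrite /dot big_ord1 !mxE; ring.
apply: eq_seg_int => t _; congr (_ * _); apply: IH => w w1; apply: fg.
by rewrite dot_polar_point w1 mulr1 cos2Dsin2.
Qed.

(** The parameter space is arbitrary because the induction moves the latitude into it, passing from
    [P] to [P * R]. *)
Lemma sphere_int_cts m (P : topologicalType) (f : P -> 'rV[R]_m.+1 -> R) :
  continuous (fun x : P * 'rV[R]_m.+1 => f x.1 x.2) ->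
  continuous (fun p => sphere_int (f p)).
Proof.
elim: m P f => [|m IH] P f cf /=.
  by apply: ctsD; apply: (@cts_comp _ _ _ (fun p => (p, _)) (fun x => f x.1 x.2)) => //;
    (apply: cts_pair; [exact: ctsI|exact: ctsC]).
apply: seg_int_cts; first exact: pi_ge0.
apply: ctsM; first by apply: ctsX; exact: (cts_comp (@cts_snd _ _) (@cts_sin _)).
apply: (IH _ (fun (x : P * R) w => f x.1 (polar_point (cos x.2) (sin x.2) w))).
apply: (@cts_comp _ _ _
  (fun y : P * R * 'rV[R]_m.+1 => (y.1.1, polar_point (cos y.1.2) (sin y.1.2) y.2))
  (fun x => f x.1 x.2)) => //.
have c1 : continuous (fun y : P * R * 'rV[R]_m.+1 => y.1.1).
  exact: (cts_comp (@cts_fst _ _) (@cts_fst _ _)).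
have c2 : continuous (fun y : P * R * 'rV[R]_m.+1 => y.1.2).
  exact: (cts_comp (@cts_fst _ _) (@cts_snd _ _)).
apply: cts_pair => //; apply: polar_point_cts; last exact: cts_snd.
  exact: (cts_comp c2 (@cts_cos _)).
exact: (cts_comp c2 (@cts_sin _)).
Qed.

Lemma sphere_slice_cts m (f : 'rV[R]_m.+2 -> R) : continuous f ->
  continuous (fun t => sphere_int (fun w => f (polar_point (cos t) (sin t) w))).
Proof.
move=> cf; apply: (sphere_int_cts (f := fun t w => f (polar_point (cos t) (sin t) w))).
apply: (cts_comp _ cf); apply: polar_point_cts; last exact: cts_snd.
  exact: (cts_comp (@cts_fst _ _) (@cts_cos _)).
exact: (cts_comp (@cts_fst _ _) (@cts_sin _)).
Qed.

Lemma slice_cts m (f : 'rV[R]_m.+1 -> R) c s : continuous f ->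
  continuous (fun w => f (polar_point c s w)).
Proof. by move=> cf; apply: (cts_comp _ cf); apply: polar_point_cts; [exact: ctsC|exact: ctsC|exact: ctsI]. Qed.

Lemma sphere_weight_cts m (f : 'rV[R]_m.+2 -> R) : continuous f ->
  continuous (fun t => sin t ^+ m *
    sphere_int (fun w => f (polar_point (cos t) (sin t) w))).
Proof. by move=> cf; apply: ctsM; [exact: (ctsX (@cts_sin R))|exact: sphere_slice_cts]. Qed.

Lemma sphere_intD m (f g : 'rV[R]_m.+1 -> R) : continuous f -> continuous g ->
  sphere_int (fun w => f w + g w) = sphere_int f + sphere_int g.
Proof.
elim: m f g => [|m IH] f g cf cg /=; first by rewrite addrACA.
rewrite -seg_intD; [|exact: sphere_weight_cts..].
by apply: eq_seg_int => t _; rewrite IH; [exact: mulrDr|exact: slice_cts|exact: slice_cts].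
Qed.

Lemma sphere_intZ m a (f : 'rV[R]_m.+1 -> R) : continuous f ->
  sphere_int (fun w => a * f w) = a * sphere_int f.
Proof.
elim: m f => [|m IH] f cf /=; first by rewrite mulrDr.
rewrite -seg_intZ; last exact: sphere_weight_cts.
by apply: eq_seg_int => t _; rewrite IH; [exact: mulrCA|exact: slice_cts].
Qed.

Lemma sphere_int_ge0 m (f : 'rV[R]_m.+1 -> R) :
  (forall w, dot w w = 1 -> 0 <= f w) -> 0 <= sphere_int f.
Proof.
elim: m f => [|m IH] f f0 /=.
  by rewrite addr_ge0 // f0 // /dot big_ord1 !mxE; ring.
apply: seg_int_ge0 => t /andP[t0 tpi].
rewrite mulr_ge0 ?exprn_ge0 ?sin_ge0_pi ?in_itv /= ?t0 //.
apply: IH => w w1; apply: f0.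
by rewrite dot_polar_point w1 mulr1 cos2Dsin2.
Qed.

End SphereInt.

(** * Differentiation under the integral over the sphere *)

Section DerivUnder.
Context {R : realType}.

(** Caratheodory's form of differentiability: a continuous difference quotient gives the derivative
    as its value at 0. *)
Lemma deriv_quotient (F q : R -> R) (t : R) :
  (forall h, F (t + h) - F t = h * q h) -> {for 0, continuous q} ->
  is_derive t 1 F (q 0).
Proof.
move=> Fq cq.
have L : (fun h => h^-1 *: (F (h *: (1 : R) + t) - F t)) @ 0^' --> q 0.
  have {cq} := cvg_within_filter (fun y => y != 0) cq => /(_ _) cq.
  apply: cvg_trans cq; apply: near_eq_cvg; near=> h.
  have h0 : h != 0 by near: h; exact: nbhs_dnbhs_neq.
  by rewrite /GRing.scale /= mulr1 (addrC h) Fq mulKf.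
apply: DeriveDef; first by apply/cvg_ex; exists (q 0).
exact: cvg_lim L.
Unshelve. all: by end_near. Qed.

(** The increment of [f] is [h] times the average [phi h] of [f'] over the segment from [t0] to
    [t0 + h]. Integrated over the sphere, this average is a continuous difference quotient, so
    continuity of parameter integrals suffices. *)
Lemma sphere_int_deriv m (f f' : R -> 'rV[R]_m.+1 -> R) :
  (forall (t : R) w, is_derive t 1 (f^~ w) (f' t w)) ->
  continuous (fun x : R * 'rV[R]_m.+1 => f' x.1 x.2) ->
  (forall t, continuous (f t)) ->
  forall t : R, is_derive t 1 (fun t => sphere_int (f t)) (sphere_int (f' t)).
Proof.
move=> df cf' cf t0.
pose phi h w := seg_int 0 1 (fun s => f' (t0 + s * h) w).
have cphi : continuous (fun x : R * 'rV[R]_m.+1 => phi x.1 x.2).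
  apply: (seg_int_cts (g := fun (x : R * 'rV[R]_m.+1) s => f' (t0 + s * x.1) x.2) ler01).
  apply: (@cts_comp _ _ _ (fun y : R * 'rV[R]_m.+1 * R => (t0 + y.2 * y.1.1, y.1.2)) _ _ cf').
  apply: cts_pair; last exact: (cts_comp (@cts_fst _ _) (@cts_snd _ _)).
  apply: ctsD; first exact: ctsC.
  by apply: ctsM; [exact: cts_snd|exact: (cts_comp (@cts_fst _ _) (@cts_fst _ _))].
have cphi1 h : continuous (phi h).
  by apply: (@cts_comp _ _ _ (fun w => (h, w)) _ _ cphi); apply: cts_pair; [exact: ctsC|exact: ctsI].
have c1 w : continuous (f'^~ w).
  by apply: (@cts_comp _ _ _ (fun t => (t, w)) _ _ cf'); apply: cts_pair; [exact: ctsI|exact: ctsC].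
have caff h : continuous (fun s : R => t0 + s * h).
  by apply: ctsD; [exact: ctsC|apply: ctsM; [exact: ctsI|exact: ctsC]].
have c2 h w : continuous (fun s : R => f' (t0 + s * h) w).
  exact: cts_comp (caff h) (c1 w).
have E (h : R) w : f (t0 + h) w = f t0 w + h * phi h w.
  rewrite /phi -seg_intZ; last exact: c2.
  have dg (s : R) : 0 <= s -> is_derive s 1 (fun s => f (t0 + s * h) w) (h * f' (t0 + s * h) w).
    move=> _; rewrite mulrC; apply: (@der1_comp _ (f^~ w) (fun s => t0 + s * h)) => //.
    by apply: (is_derive_eq (der1D (der1C t0 s) (der1M (der1I s) (der1C h s)))); ring.
  rewrite (seg_int_FTC ler01 _ dg); last by apply: ctsM; [exact: ctsC|exact: c2].
  by rewrite mul1r mul0r addr0; ring.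
have -> : sphere_int (f' t0) = sphere_int (phi 0).
  apply: eq_sphere_int => w _; rewrite /phi.
  under eq_fun do rewrite mulr0 addr0.
  by rewrite seg_int_cst // subr0 mulr1.
apply: (deriv_quotient (q := fun h => sphere_int (phi h))) => [h|].
  rewrite (funext (E h)).
  rewrite sphere_intD // ?sphere_intZ //.
    by ring.
  by apply: ctsM => //; exact: ctsC.
exact: sphere_int_cts.
Qed.

End DerivUnder.

(** * Curves of vectors and gradients along curves *)

Section MatrixCurves.
Context {R : realType}.

Lemma deriv_mx m n (f : R -> 'M[R]_(m, n)) (t : R) (v : 'M[R]_(m, n)) :
  (forall i j, is_derive t 1 (fun s => f s i j) (v i j)) -> is_derive t 1 f v.
Proof.
move=> df; have der : derivable f t 1.
  by apply/derivable_mxP => i j; have [] := df i j.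
apply: (is_derive_eq (derivableP der)); rewrite derive_mx //.
by apply/matrixP => i j; rewrite mxE; apply: derive_val.
Qed.

Lemma deriv_coord m n (f : R -> 'M[R]_(m, n)) (t : R) (v : 'M[R]_(m, n)) i j :
  is_derive t 1 f v -> is_derive t 1 (fun s => f s i j) (v i j).
Proof.
move=> [df <-]; rewrite derive_mx // mxE; apply: derivableP.
by move/derivable_mxP : df; exact.
Qed.

Lemma deriv_row_mx d (a : R -> R) (c : R -> 'rV[R]_d) (t : R) a' c' :
  is_derive t 1 a a' -> is_derive t 1 c c' ->
  is_derive t 1 (fun s => row_mx (a s)%:M (c s) : 'rV[R]_(1 + d))
    (row_mx a'%:M c' : 'rV[R]_(1 + d)).
Proof.
move=> da dc; apply: deriv_mx => i j; case: (splitP j) => k /= jk.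
  have -> : j = lshift d k by exact/val_inj.
  under eq_fun do rewrite row_mxEl mxE; rewrite row_mxEl mxE !ord1 eqxx /= mulr1n.
  by under eq_fun do rewrite mulr1n.
have -> : j = rshift 1 k by exact/val_inj.
under eq_fun do rewrite row_mxEr; rewrite row_mxEr.
exact: deriv_coord.
Qed.

Lemma deriv_scale_vec d (a : R -> R) (c : R -> 'rV[R]_d) (t : R) a' c' :
  is_derive t 1 a a' -> is_derive t 1 c c' ->
  is_derive t 1 (fun s => a s *: c s) (a' *: c t + a t *: c').
Proof.
move=> da dc; apply: deriv_mx => i j; under eq_fun do rewrite mxE; rewrite !mxE.
by apply: der1M => //; exact: deriv_coord.
Qed.

Lemma deriv_polar_point d (a b : R -> R) (c : R -> 'rV[R]_d) (t : R) a' b' c' :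
  is_derive t 1 a a' -> is_derive t 1 b b' -> is_derive t 1 c c' ->
  is_derive t 1 (fun s => polar_point (a s) (b s) (c s))
    (row_mx a'%:M (b' *: c t + b t *: c') : 'rV[R]_(1 + d)).
Proof. by move=> da db dc; apply: deriv_row_mx => //; exact: deriv_scale_vec. Qed.

Lemma dot_rsubmx d (x : 'rV[R]_(1 + d)) (a : R) (y : 'rV[R]_d) :
  dot x (row_mx a%:M y) = x 0 0 * a + dot (rsubmx x) y.
Proof.
rewrite -{1}(hsubmxK x) [lsubmx x]mx11_scalar dot_row_mx !mxE.
by congr (x _ _ * _ + _); apply/val_inj.
Qed.

(* Along curves [u] has gradient [G]; a form of continuous differentiability
   that is stable under restriction to the slices [polar_point c s w]. *)
Definition has_grad d (u : 'rV[R]_d -> R) (G : 'rV[R]_d -> 'rV[R]_d) :=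
  [/\ continuous u, continuous G &
      forall (c : R -> 'rV[R]_d) (t : R) v, is_derive t 1 c v ->
        is_derive t 1 (fun s => u (c s)) (dot (G (c t)) v)].

Definition rgrad d (x : 'rV[R]_d.+1) : 'rV[R]_d := rsubmx (x : 'rV[R]_(1 + d)).

Lemma row_mx_rgrad d (x : 'rV[R]_d.+1) :
  x = row_mx (x 0 0)%:M (rgrad x) :> 'rV[R]_(1 + d).
Proof.
apply/rowP => j; case: (split_ordP j) => i ->; rewrite ?row_mxEl ?row_mxEr !mxE //.
by rewrite !ord1 mulr1n; congr (x _ _); exact/val_inj.
Qed.

Lemma rgrad_cts d : continuous (@rgrad d).
Proof.
apply: cts_mx => i j; under eq_fun do rewrite mxE.
exact: cts_coord.
Qed.

Lemma slice_grad d (u : 'rV[R]_d.+1 -> R) G (c s : R) : has_grad u G ->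
  has_grad (fun w => u (polar_point c s w)) (fun w => s *: rgrad (G (polar_point c s w))).
Proof.
case=> cu cG dG.
have cp : continuous (fun w : 'rV[R]_d => polar_point c s w).
  by apply: polar_point_cts; [exact: ctsC|exact: ctsC|exact: ctsI].
split=> [||g t v dg]; first exact: (cts_comp cp cu).
  apply: ctsZ; first exact: ctsC.
  exact: (cts_comp (cts_comp cp cG) (@rgrad_cts d)).
have := dG _ _ _ (deriv_polar_point (der1C c t) (der1C s t) dg).
move=> h; apply: (is_derive_eq h).
by rewrite dot_rsubmx mulr0 add0r scale0r add0r dotZr dotZl.
Qed.

End MatrixCurves.

(** * Means over the unit sphere *)

Section SphereMean.
Context {R : realType} {m : nat}.
Implicit Types f g : 'rV[R]_m.+1 -> R.

Definition sphere_area (R : realType) m : R :=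
  sphere_int (fun _ : 'rV[R]_m.+1 => 1).

Lemma sphere_int_cst (a : R) :
  sphere_int (fun _ : 'rV[R]_m.+1 => a) = a * sphere_area R m.
Proof.
rewrite -sphere_intZ; last exact: ctsC.
by apply: eq_sphere_int => w _; rewrite mulr1.
Qed.

Definition sphere_mean f : R := sphere_int f / sphere_area R m.

End SphereMean.

(** On the first half of the interval the factor [cos t <= 1] makes the integrand smaller and exact:
    it is the derivative of [sin t ^+ m.+1] divided by [m.+1]. *)
Lemma sin_pow_int_gt0 (R : realType) m : 0 < seg_int 0 pi (fun t : R => sin t ^+ m).
Proof.
have cs : continuous (fun t : R => sin t ^+ m) by apply: ctsX; exact: cts_sin.
have p2 : 0 < pi / 2 :> R by rewrite divr_gt0 // pi_gt0.
have p2pi : pi / 2 <= pi :> R by rewrite ler_pdivrMr // ler_pMr ?pi_gt0 // ler1n.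
have h0 (t : R) : 0 <= t <= pi -> 0 <= sin t ^+ m.
  by move=> t0p; rewrite exprn_ge0 // sin_ge0_pi.
rewrite (seg_int_split (ltW p2) p2pi cs) ltr_pwDl //; last first.
  apply: seg_int_ge0 => t /andP[t0 tp]; apply: h0; rewrite tp andbT.
  exact: le_trans (ltW p2) t0.
have csc : continuous (fun t : R => sin t ^+ m * cos t).
  by apply: ctsM => //; exact: cts_cos.
apply: (@lt_le_trans _ _ (seg_int 0 (pi / 2) (fun t : R => sin t ^+ m * cos t))).
  have dZ (t : R) : 0 <= t -> is_derive t 1 (fun t => m.+1%:R^-1 * sin t ^+ m.+1) (sin t ^+ m * cos t).
    move=> _; apply: (is_derive_eq (der1Z _ (der1X m.+1 (is_derive_sin t)))).
    by rewrite /= mulrA mulrA mulVf ?mul1r // pnatr_eq0.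
  rewrite (seg_int_FTC (ltW p2) csc dZ) sin_pihalf sin0 expr1n expr0n /= mulr0 subr0.
  by rewrite mulr1 invr_gt0 ltr0Sn.
apply: le_seg_int => // t /andP[t0 tp]; rewrite ler_piMr ?cos_le1 // h0 // t0.
exact: le_trans p2pi.
Qed.

Section SphereMeanFacts.
Context {R : realType} {m : nat}.
Implicit Types f g : 'rV[R]_m.+1 -> R.

Lemma sphere_area_gt0 : 0 < sphere_area R m.
Proof.
elim: m => [|n IH]; rewrite /sphere_area /=; first by rewrite addr_gt0.
under eq_fun do rewrite -/(sphere_area R n) mulrC.
rewrite seg_intZ; first by rewrite mulr_gt0 // sin_pow_int_gt0.
by apply: ctsX; exact: cts_sin.
Qed.

(** The cross term vanishes since the fluctuation has mean zero. Hence the mean is the best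
    constant, and an inequality obtained with any [k] also holds with the mean. *)
Lemma sphere_int_sqrB f (k : R) : continuous f ->
  sphere_int (fun w => (f w - k) ^+ 2) =
  sphere_int (fun w => (f w - sphere_mean f) ^+ 2)
  + sphere_area R m * (sphere_mean f - k) ^+ 2.
Proof.
move=> cf.
have E l : sphere_int (fun w => (f w - l) ^+ 2) = sphere_int (fun w => f w ^+ 2)
    - 2 * l * sphere_int f + l ^+ 2 * sphere_area R m.
  rewrite -sphere_int_cst -mulNr -sphere_intZ // -!sphere_intD.
  - by apply: eq_sphere_int => w _; ring.
  - by apply: ctsD; [exact: ctsX|apply: ctsM => //; exact: ctsC].
  - exact: ctsC.
  - exact: ctsX.
  - by apply: ctsM => //; exact: ctsC.
rewrite !E /sphere_mean; field.
exact: lt0r_neq0 sphere_area_gt0.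
Qed.

Lemma sphere_int_sqr f : continuous f ->
  sphere_int (fun w => f w ^+ 2) =
  sphere_int (fun w => (f w - sphere_mean f) ^+ 2)
  + sphere_area R m * sphere_mean f ^+ 2.
Proof.
move=> cf; have := sphere_int_sqrB 0 cf; rewrite subr0 => <-.
by apply: eq_sphere_int => w _; rewrite subr0.
Qed.

End SphereMeanFacts.

(** * Poincare inequality and scalar forms *)

(** The factor [m] is the first nonzero eigenvalue of the Laplacian on the unit m-sphere, and the
    right-hand integrand is the squared tangential gradient. The constant is existential because the
    induction produces a mean over the equator rather than over the whole sphere. *)
Definition poincare (R : realType) (m : nat) : Prop :=
  forall (u : 'rV[R]_m.+1 -> R) G, has_grad u G ->
  exists k, m%:R * sphere_int (fun w => (u w - k) ^+ 2) <=
    sphere_int (fun w => dot (G w) (G w) - dot w (G w) ^+ 2).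

Section Quotient.
Context {R : realType}.

Lemma cvg_diff_quotient (h : R -> R) (t0 l : R) : is_derive t0 1 h l -> h t0 = 0 ->
  h t / (t - t0) @[t --> t0^'] --> l.
Proof.
move=> [/cvg_ex[l' hl'] <-] h0.
have -> : 'D_1 h t0 = l' by exact: cvg_lim hl'.
apply/cvgrPdist_le => e e0; move/cvgrPdist_le : hl' => /(_ e e0) [r /= r0 H].
exists r => //= t rt tt0.
have := H (t - t0); rewrite /= sub0r normrN distrC => /(_ rt).
rewrite subr_eq0 => /(_ tt0); rewrite h0 subr0 /GRing.scale /= mulr1 subrK.
by rewrite mulrC.
Qed.

(** L'Hospital at a common zero: after division by [t - t0] the numerator tends to 0 and the
    denominator to [d]. *)
Lemma cvg_quotient (f g : R -> R) (t0 d : R) :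
  is_derive t0 1 f 0 -> f t0 = 0 -> is_derive t0 1 g d -> g t0 = 0 -> d != 0 ->
  f t / g t @[t --> t0^'] --> 0.
Proof.
move=> df f0 dg g0 d0.
have := cvgM (cvg_diff_quotient df f0) (cvgV d0 (cvg_diff_quotient dg g0)) => /(_ _ _).
rewrite mul0r => L; apply: cvg_trans L; apply: near_eq_cvg; near=> t.
have t0t : t - t0 != 0 by rewrite subr_eq0; near: t; exact: nbhs_dnbhs_neq.
by rewrite /= invfM invrK mulrACA mulVf // mulr1.
Unshelve. all: by end_near. Qed.

End Quotient.

(** * Mean and fluctuation over geodesic spheres *)

Section PolarFamily.
Context {R : realType} {m : nat} (kap : R) (c s : R -> R).
Hypothesis dc : forall t : R, is_derive t 1 c (- (kap * s t)).
Hypothesis ds : forall t : R, is_derive t 1 s (c t).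
Hypothesis csE : forall t, c t ^+ 2 + kap * s t ^+ 2 = 1.
Context (u : 'rV[R]_m.+2 -> R) (G : 'rV[R]_m.+2 -> 'rV[R]_m.+2).
Hypothesis uG : has_grad u G.

(* In polar coordinates [c t], [s t] around the pole, [pol_rad] is the radial
   derivative of [u] and [pol_tan] the squared norm of its gradient along the
   geodesic sphere of radius [t]. *)
Definition pol_val (t : R) (w : 'rV[R]_m.+1) : R := u (polar_point (c t) (s t) w).
Definition pol_rad (t : R) (w : 'rV[R]_m.+1) : R :=
  dot (G (polar_point (c t) (s t) w)) (polar_point (- (kap * s t)) (c t) w).
Definition pol_tan (t : R) (w : 'rV[R]_m.+1) : R :=
  let g := rgrad (G (polar_point (c t) (s t) w)) in dot g g - dot w g ^+ 2.
Definition mean_val t := sphere_mean (pol_val t).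
Definition mean_rad t := sphere_mean (pol_rad t).
Definition fluct t := sphere_int (fun w => (pol_val t w - mean_val t) ^+ 2).
Definition fluct' t :=
  sphere_int (fun w => 2 * (pol_val t w - mean_val t) * (pol_rad t w - mean_rad t)).
Definition fluct_rad t := sphere_int (fun w => (pol_rad t w - mean_rad t) ^+ 2).
Definition fluct_tan t := sphere_int (pol_tan t).

Let cc : continuous c. Proof. by move=> t; exact: deriv_cts (dc t). Qed.
Let cs : continuous s. Proof. by move=> t; exact: deriv_cts (ds t). Qed.

Let cp (X : topologicalType) (f : X -> R) (w : X -> 'rV[R]_m.+1) :
  continuous f -> continuous w ->
  continuous (fun x => polar_point (c (f x)) (s (f x)) (w x)).
Proof.
move=> cf cw; apply: polar_point_cts => //; [exact: cts_comp cf cc|exact: cts_comp cf cs].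
Qed.

Let c_val (X : topologicalType) (f : X -> R) (w : X -> 'rV[R]_m.+1) :
  continuous f -> continuous w -> continuous (fun x => pol_val (f x) (w x)).
Proof. by move=> cf cw; case: uG => cu _ _; exact: cts_comp (cp cf cw) cu. Qed.

Let c_rad (X : topologicalType) (f : X -> R) (w : X -> 'rV[R]_m.+1) :
  continuous f -> continuous w -> continuous (fun x => pol_rad (f x) (w x)).
Proof.
move=> cf cw; case: uG => _ cG _; apply: dot_cts; first exact: cts_comp (cp cf cw) cG.
apply: polar_point_cts => //; last exact: cts_comp cf cc.
by apply: ctsN; apply: ctsM; [exact: ctsC|exact: cts_comp cf cs].
Qed.

Let c_tan (X : topologicalType) (f : X -> R) (w : X -> 'rV[R]_m.+1) :
  continuous f -> continuous w -> continuous (fun x => pol_tan (f x) (w x)).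
Proof.
move=> cf cw; case: uG => _ cG _.
have cg := cts_comp (cts_comp (cp cf cw) cG) (@rgrad_cts R _).
apply: ctsD; first exact: dot_cts.
by apply: ctsN; apply: ctsX; exact: dot_cts.
Qed.

Let c_val_w t : continuous (pol_val t).
Proof. by apply: c_val; [exact: ctsC|exact: ctsI]. Qed.
Let c_rad_w t : continuous (pol_rad t).
Proof. by apply: c_rad; [exact: ctsC|exact: ctsI]. Qed.

Lemma mean_val_cts : continuous mean_val.
Proof.
apply: ctsM; last exact: ctsC; apply: sphere_int_cts.
by apply: c_val; [exact: cts_fst|exact: cts_snd].
Qed.

Lemma mean_rad_cts : continuous mean_rad.
Proof.
apply: ctsM; last exact: ctsC; apply: sphere_int_cts.
by apply: c_rad; [exact: cts_fst|exact: cts_snd].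
Qed.

Let c_dval : continuous (fun x : R * 'rV[R]_m.+1 => pol_val x.1 x.2 - mean_val x.1).
Proof.
apply: ctsD; first by apply: c_val; [exact: cts_fst|exact: cts_snd].
by apply: ctsN; exact: cts_comp (@cts_fst _ _) mean_val_cts.
Qed.

Let c_drad : continuous (fun x : R * 'rV[R]_m.+1 => pol_rad x.1 x.2 - mean_rad x.1).
Proof.
apply: ctsD; first by apply: c_rad; [exact: cts_fst|exact: cts_snd].
by apply: ctsN; exact: cts_comp (@cts_fst _ _) mean_rad_cts.
Qed.

Lemma fluct_cts : continuous fluct.
Proof.
by apply: (sphere_int_cts (f := fun t w => (pol_val t w - mean_val t) ^+ 2)); exact: ctsX.
Qed.

Lemma fluct_rad_cts : continuous fluct_rad.
Proof.
by apply: (sphere_int_cts (f := fun t w => (pol_rad t w - mean_rad t) ^+ 2)); exact: ctsX.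
Qed.

Lemma fluct_tan_cts : continuous fluct_tan.
Proof. by apply: sphere_int_cts; apply: c_tan; [exact: cts_fst|exact: cts_snd]. Qed.

Lemma pol_val_deriv (t : R) w : is_derive t 1 (pol_val^~ w) (pol_rad t w).
Proof.
case: uG => _ _ /(_ _ _ _ (deriv_polar_point (dc t) (ds t) (der1C w t))) h.
by apply: (is_derive_eq h); rewrite /pol_rad scaler0 addr0.
Qed.

Lemma mean_val_deriv (t : R) : is_derive t 1 mean_val (mean_rad t).
Proof.
have h : is_derive t 1 (fun t => sphere_int (pol_val t)) (sphere_int (pol_rad t)).
  apply: sphere_int_deriv => //; first exact: pol_val_deriv.
  by apply: c_rad; [exact: cts_fst|exact: cts_snd].
apply: (is_derive_eq (der1M h (der1C (sphere_area R m)^-1 t))).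
by rewrite mulr0 addr0.
Qed.

Lemma fluct_deriv (t : R) : is_derive t 1 fluct (fluct' t).
Proof.
apply: (sphere_int_deriv (f := fun t w => (pol_val t w - mean_val t) ^+ 2)
  (f' := fun t w => 2 * (pol_val t w - mean_val t) * (pol_rad t w - mean_rad t))).
- move=> {}t w.
  apply: (is_derive_eq (der1X 2 (der1B (pol_val_deriv t w) (mean_val_deriv t)))).
  by rewrite /= expr1.
- by apply: ctsM => //; apply: ctsM => //; exact: ctsC.
- by move=> {}t; apply: ctsX; apply: ctsD => //; exact: ctsC.
Qed.

(** This is the integral of [(y - l * x) ^+ 2], with [x] the fluctuation and [y] its radial
    derivative; [l] is free so that it can be set to the logarithmic derivative of [s]. *)
Lemma fluct_rad_ge l t : 0 <= fluct_rad t - l * fluct' t + l ^+ 2 * fluct t.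
Proof.
have cv : continuous (fun w => pol_val t w - mean_val t).
  by apply: ctsD => //; exact: ctsC.
have cr : continuous (fun w => pol_rad t w - mean_rad t).
  by apply: ctsD => //; exact: ctsC.
have c1 : continuous (fun w => 2 * (pol_val t w - mean_val t) * (pol_rad t w - mean_rad t)).
  by apply: ctsM => //; apply: ctsM => //; exact: ctsC.
rewrite -mulNr -!sphere_intZ //; last exact: ctsX.
rewrite -!sphere_intD.
- apply: sphere_int_ge0 => w _.
  set x := pol_val t w - _; set y := pol_rad t w - _.
  by rewrite (_ : _ + _ = (y - l * x) ^+ 2) ?sqr_ge0 //; ring.
- by apply: ctsD; [exact: ctsX|apply: ctsM => //; exact: ctsC].
- by apply: ctsM; [exact: ctsC|exact: ctsX].
- exact: ctsX.
- by apply: ctsM => //; exact: ctsC.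
Qed.

(** The Poincare inequality for the slice at [t], whose gradient on the unit sphere carries the
    factor [s t]. Replacing the constant it provides by the mean only lowers the left side. *)
Lemma fluct_tan_ge t : poincare R m -> m%:R * fluct t <= s t ^+ 2 * fluct_tan t.
Proof.
move=> /(_ _ _ (slice_grad (c t) (s t) uG)) [k].
rewrite (sphere_int_sqrB k (@c_val_w t)) => h.
have -> : s t ^+ 2 * fluct_tan t = sphere_int (fun w : 'rV[R]_m.+1 =>
    dot (s t *: rgrad (G (polar_point (c t) (s t) w))) (s t *: rgrad (G (polar_point (c t) (s t) w)))
    - dot w (s t *: rgrad (G (polar_point (c t) (s t) w))) ^+ 2).
  rewrite -sphere_intZ; last by apply: c_tan; [exact: ctsC|exact: ctsI].
  by apply: eq_sphere_int => w _; rewrite !dotZr !dotZl /pol_tan; ring.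
apply: le_trans h; rewrite ler_wpM2l // lerDl mulr_ge0 ?sqr_ge0 //.
exact: ltW (@sphere_area_gt0 R m).
Qed.

(** Where [s] vanishes the slice collapses to a point, so the fluctuation vanishes there together
    with its derivative, while [s] has a simple zero. This kills the boundary term even for [m = 0],
    when no power of [s] helps. *)
Lemma fluct_quotient t : s t = 0 -> c t != 0 -> fluct x / s x @[x --> t^'] --> 0.
Proof.
move=> st ct.
have vE w : pol_val t w = pol_val t 0 by rewrite /pol_val st /polar_point !scale0r.
have vm w : pol_val t w - mean_val t = 0.
  rewrite /mean_val /sphere_mean (_ : pol_val t = (fun=> pol_val t 0)); last exact/funext.
  by rewrite sphere_int_cst mulfK ?subrr // lt0r_neq0 // sphere_area_gt0.
apply: (@cvg_quotient _ fluct s t (c t)) => //.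
- apply: (is_derive_eq (fluct_deriv t)); rewrite -[RHS](mul0r (sphere_area R m)) -sphere_int_cst.
  by apply: eq_sphere_int => w _; rewrite vm mulr0 mul0r.
- rewrite -[RHS](mul0r (sphere_area R m)) -sphere_int_cst.
  by apply: eq_sphere_int => w _; rewrite vm expr0n.
Qed.

(* [fluct_rad_ge] with [l = c / s], together with the Poincare inequality, bounds
   the integrand below by the derivative of [fluct * l * s ^+ m]. *)
Lemma radial_fluct_ge (x y zx zy : R) : poincare R m -> x < y ->
  (forall t, x < t < y -> 0 < s t) ->
  fluct t / s t * (c t * s t ^+ m) @[t --> x^'+] --> zx ->
  fluct t / s t * (c t * s t ^+ m) @[t --> y^'-] --> zy ->
  zy - zx <= seg_int x y (fun t => s t ^+ m *
    (fluct_rad t + fluct_tan t - kap * m.+1%:R * fluct t)).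
Proof.
move=> Pm xy s0 Zx Zy.
pose z t := (fluct' t * (s t)^-1 + fluct t * (- c t / s t ^+ 2)) * (c t * s t ^+ m)
  + fluct t / s t * (- (kap * s t) * s t ^+ m + c t * (m%:R * s t ^+ m.-1 * c t)).
apply: (seg_int_ge xy _ _ _ Zx Zy (z := z)).
- apply: ctsM; first exact: ctsX.
  apply: ctsD; first by apply: ctsD; [exact: fluct_rad_cts|exact: fluct_tan_cts].
  by apply: ctsN; apply: ctsM; [exact: ctsC|exact: fluct_cts].
- move=> t /s0 st; apply: der1M.
    by apply: der1M; [exact: fluct_deriv|apply: der1V => //; exact: lt0r_neq0].
  by apply: der1M => //; exact: der1X.
- move=> t /s0 st; have sn0 := lt0r_neq0 st.
  have q0 : 0 <= s t ^+ m by rewrite exprn_ge0 // ltW.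
  (* For [m = 0] both sides are zero, which takes care of the truncated predecessor. *)
  have mE : m%:R * s t ^+ m.-1 = m%:R * s t ^+ m / s t.
    by case: (m) => [|n] /=; [rewrite !mul0r|rewrite exprS; field].
  have h1 := fluct_rad_ge (c t / s t) t.
  have h2 := fluct_tan_ge t Pm.
  have h3 : 0 <= (s t ^+ 2 * fluct_tan t - m%:R * fluct t) / s t ^+ 2.
    by rewrite divr_ge0 ?sqr_ge0 // subr_ge0.
  rewrite -subr_ge0.
  suff -> : s t ^+ m * (fluct_rad t + fluct_tan t - kap * m.+1%:R * fluct t) - z t =
    s t ^+ m * ((fluct_rad t - c t / s t * fluct' t + (c t / s t) ^+ 2 * fluct t)
      + (s t ^+ 2 * fluct_tan t - m%:R * fluct t) / s t ^+ 2).
    by rewrite mulr_ge0 // addr_ge0.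
  rewrite /z mE.
  (* Writing 1 as [c t ^+ 2 + kap * s t ^+ 2] turns [m / s ^+ 2] into [m * (kap + l ^+ 2)] with
     [l = c / s]; this supplies [m] of the [m.+1] curvature terms, and the derivative of [c]
     supplies the last one. *)
  have -> : (s t ^+ 2 * fluct_tan t - m%:R * fluct t) / s t ^+ 2 =
     fluct_tan t - m%:R * fluct t * (kap + (c t / s t) ^+ 2).
    by rewrite -[in LHS](mulr1 (m%:R * fluct t)) -(csE t); field.
  by rewrite -natr1; field.
Qed.

(* The integrand is the derivative of [- kap * (mean - k) ^+ 2 / c * s ^+ m.+1]
   plus [s ^+ m] times the square [(mean' + kap * (mean - k) * s / c) ^+ 2]. *)
Lemma radial_mean_ge (x y zx zy k : R) : x < y ->
  (forall t, x < t < y -> 0 <= s t) -> (forall t, x < t < y -> c t != 0) ->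
  - kap * ((mean_val t - k) ^+ 2 / c t * s t ^+ m.+1) @[t --> x^'+] --> zx ->
  - kap * ((mean_val t - k) ^+ 2 / c t * s t ^+ m.+1) @[t --> y^'-] --> zy ->
  zy - zx <= seg_int x y (fun t => s t ^+ m *
    (mean_rad t ^+ 2 - kap * m.+1%:R * (mean_val t - k) ^+ 2)).
Proof.
move=> xy s0 c0 Zx Zy.
have da (t : R) : is_derive t 1 (fun t => (mean_val t - k) ^+ 2) (2 * (mean_val t - k) * mean_rad t).
  apply: (is_derive_eq (der1X 2 (der1B (mean_val_deriv t) (der1C k t)))).
  by rewrite /= expr1 subr0.
pose z t := - kap * ((2 * (mean_val t - k) * mean_rad t * (c t)^-1
    + (mean_val t - k) ^+ 2 * (- - (kap * s t) / c t ^+ 2)) * s t ^+ m.+1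
  + (mean_val t - k) ^+ 2 / c t * (m.+1%:R * s t ^+ m * c t)).
apply: (seg_int_ge xy _ _ _ Zx Zy (z := z)).
- apply: ctsM; first exact: ctsX.
  apply: ctsD; first by apply: ctsX; exact: mean_rad_cts.
  apply: ctsN; apply: ctsM; first exact: ctsC.
  by apply: ctsX; apply: ctsD; [exact: mean_val_cts|exact: ctsC].
- move=> t /c0 ct; apply: der1Z; apply: der1M; last exact: (der1X m.+1 (ds t)).
  by apply: der1M; exact: der1V.
- move=> t tt; have ct := c0 t tt.
  have q0 : 0 <= s t ^+ m by rewrite exprn_ge0 // s0.
  rewrite -subr_ge0.
  suff -> : s t ^+ m * (mean_rad t ^+ 2 - kap * m.+1%:R * (mean_val t - k) ^+ 2) - z t =
      s t ^+ m * (mean_rad t + kap * (mean_val t - k) * s t / c t) ^+ 2.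
    by rewrite mulr_ge0 // sqr_ge0.
  by rewrite /z [s t ^+ m.+1]exprS; field.
Qed.

Lemma pol_energy_cts (X : topologicalType) (f : X -> R) (w : X -> 'rV[R]_m.+1) :
  continuous f -> continuous w ->
  continuous (fun x => pol_rad (f x) (w x) ^+ 2 + pol_tan (f x) (w x)).
Proof. by move=> cf cw; apply: ctsD; [apply: ctsX; exact: c_rad|exact: c_tan]. Qed.

Lemma radial_energy t : sphere_int (fun w => pol_rad t w ^+ 2 + pol_tan t w) =
  fluct_rad t + fluct_tan t + sphere_area R m * mean_rad t ^+ 2.
Proof.
rewrite sphere_intD.
- by rewrite sphere_int_sqr // /fluct_tan addrAC.
- exact: ctsX.
- by apply: c_tan; [exact: ctsC|exact: ctsI].
Qed.

Lemma radial_mass t k : sphere_int (fun w => (pol_val t w - k) ^+ 2) =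
  fluct t + sphere_area R m * (mean_val t - k) ^+ 2.
Proof. exact: sphere_int_sqrB. Qed.

End PolarFamily.

(** * The Poincare inequality on the unit sphere *)

Section SpherePoincare.
Context {R : realType}.

Lemma cvg_right_mul0 (f g : R -> R) (t : R) :
  f x @[x --> t^'] --> 0 -> continuous g -> f x * g x @[x --> t^'+] --> 0.
Proof.
move=> f0 cg; rewrite -[X in _ --> X](mul0r (g t)).
by apply: cvgM; [exact: cvg_dnbhs_at_right|apply: cvg_at_right_filter; exact: cg].
Qed.

Lemma cvg_left_mul0 (f g : R -> R) (t : R) :
  f x @[x --> t^'] --> 0 -> continuous g -> f x * g x @[x --> t^'-] --> 0.
Proof.
move=> f0 cg; rewrite -[X in _ --> X](mul0r (g t)).
by apply: cvgM; [exact: cvg_dnbhs_at_left|apply: cvg_at_left_filter; exact: cg].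
Qed.

Lemma dcos (t : R) : is_derive t 1 cos (- (1 * sin t)).
Proof. by rewrite mul1r; exact: is_derive_cos. Qed.

Lemma dsin (t : R) : is_derive t 1 sin (cos t).
Proof. exact: is_derive_sin. Qed.

Lemma cos2sin2 (t : R) : cos t ^+ 2 + 1 * sin t ^+ 2 = 1.
Proof. by rewrite mul1r cos2Dsin2. Qed.

Lemma cos_neq0 (t : R) : 0 <= t -> t <= pi -> t != pi / 2 -> cos t != 0.
Proof.
move=> t0 tp; apply: contra => /eqP ct; have p0 := @pi_gt0 R.
apply/eqP; apply: cos_inj; rewrite ?in_itv /= ?t0 ?ct ?cos_pihalf //.
by apply/andP; split; lra.
Qed.

(** For a unit [w], the point and its derivative in the latitude differ from the pole and [w] by a
    rotation of their plane. Removing the component along the point therefore leaves the latitude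
    component and the part tangent to the slice. *)
Lemma tangential_split m (c s : R) (g : 'rV[R]_m.+1) (w : 'rV[R]_m) : c ^+ 2 + s ^+ 2 = 1 ->
  dot g g - dot (polar_point c s w) g ^+ 2 =
  dot g (polar_point (- s) c w) ^+ 2 + (dot (rgrad g) (rgrad g) - dot w (rgrad g) ^+ 2).
Proof.
move=> cs1.
rewrite {1 2 3 4}(row_mx_rgrad g) !dot_row_mx dotZl dotZr (dotC (rgrad g) w).
set x := g 0 0; set p := dot w _; set q := dot (rgrad g) _.
apply/eqP; rewrite -subr_eq0.
rewrite (_ : _ - _ = (x ^+ 2 + p ^+ 2) * (1 - (c ^+ 2 + s ^+ 2))); last by ring.
by rewrite cs1 subrr mulr0.
Qed.

(* Induction through the slices at latitude [t].  The subtracted constant is the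
   mean over the equator, where [cos] vanishes, so that [(a - k) ^+ 2 / cos] stays
   bounded in [radial_mean_ge]. *)
Lemma sphere_poincare m : poincare R m.
Proof.
elim: m => [|m Pm] u G uG.
  (* On the two-point sphere the factor [m] is 0 and the tangential gradient vanishes. *)
  exists 0; rewrite mul0r; apply: sphere_int_ge0 => w.
  rewrite /dot !big_ord1 => w1.
  by rewrite exprMn expr2 expr2 w1 mul1r subrr.
pose a := mean_val cos sin u; pose k := a (pi / 2).
exists k.
have [cu cG _] := uG.
have p0 : 0 < pi :> R by exact: pi_gt0.
have p2 : 0 < pi / 2 :> R by rewrite divr_gt0.
have p2pi : pi / 2 < pi :> R by lra.
have sa := @sphere_area_gt0 R m.
have -> : sphere_int (fun w => dot (G w) (G w) - dot w (G w) ^+ 2) =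
    seg_int 0 pi (fun t => sin t ^+ m * (fluct_rad 1 cos sin G t + fluct_tan cos sin G t +
      sphere_area R m * mean_rad 1 cos sin G t ^+ 2)).
  apply: eq_seg_int => t _; congr (_ * _).
  rewrite -(radial_energy dcos dsin uG) //; apply: eq_sphere_int => w _.
  by rewrite (tangential_split _ _ (cos2Dsin2 t)) /pol_rad mul1r.
have -> : sphere_int (fun w => (u w - k) ^+ 2) =
    seg_int 0 pi (fun t => sin t ^+ m * (fluct cos sin u t + sphere_area R m * (a t - k) ^+ 2)).
  by apply: eq_seg_int => t _; rewrite -(radial_mass dcos dsin uG).
have csin := @cts_sin R; have ccos := @cts_cos R.
have cw := fluct_cts dcos dsin uG; have cd := fluct_rad_cts dcos dsin uG.
have ce := fluct_tan_cts dcos dsin uG; have ca := mean_val_cts dcos dsin uG.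
have ca' := mean_rad_cts dcos dsin uG.
have cak : continuous (fun t => a t - k) by apply: ctsD => //; exact: ctsC.
(* The fluctuation is treated on the whole interval: [sin] vanishes only at the two poles, and both
   boundary terms tend to 0. *)
have h1 : 0 <= seg_int 0 pi (fun t => sin t ^+ m * (fluct_rad 1 cos sin G t
    + fluct_tan cos sin G t - 1 * m.+1%:R * fluct cos sin u t)).
  have cg : continuous (fun t : R => cos t * sin t ^+ m) by apply: ctsM => //; exact: ctsX.
  have := radial_fluct_ge dcos dsin cos2sin2 uG Pm p0 (zx := 0) (zy := 0).
  rewrite subr0; apply.
  - by move=> t; exact: sin_gt0_pi.
  - apply: cvg_right_mul0 => //; apply: (fluct_quotient dcos dsin uG); first exact: sin0.
    by rewrite cos0 oner_eq0.
  - apply: cvg_left_mul0 => //; apply: (fluct_quotient dcos dsin uG); first exact: sinpi.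
    by rewrite cospi oppr_eq0 oner_eq0.
have cm : continuous (fun t => sin t ^+ m *
    (mean_rad 1 cos sin G t ^+ 2 - 1 * m.+1%:R * (a t - k) ^+ 2)).
  apply: ctsM; first exact: ctsX.
  by apply: ctsD; [exact: ctsX|apply: ctsN; apply: ctsM; [exact: ctsC|exact: ctsX]].
have h2 : 0 <= seg_int 0 pi (fun t => sin t ^+ m *
    (mean_rad 1 cos sin G t ^+ 2 - 1 * m.+1%:R * (a t - k) ^+ 2)).
  (* A double zero over a simple zero, by the choice of [k]. *)
  have qk : (a t - k) ^+ 2 / cos t @[t --> (pi / 2)^'] --> 0.
    apply: (@cvg_quotient _ (fun t => (a t - k) ^+ 2) cos (pi / 2) (- (1 * sin (pi / 2)))) => //.
    - apply: (is_derive_eq (der1X 2 (der1B (mean_val_deriv dcos dsin uG (pi / 2)) (der1C k _)))).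
      by rewrite -/a /= subrr; ring.
    - by rewrite subrr expr0n.
    - exact: dcos.
    - exact: cos_pihalf.
    - by rewrite sin_pihalf mul1r oppr_eq0 oner_eq0.
  have cs1 : continuous (fun t : R => -1 * sin t ^+ m.+1).
    by apply: ctsM; [exact: ctsC|exact: ctsX].
  rewrite (seg_int_split (ltW p2) (ltW p2pi) cm) addr_ge0 //.
  - have := radial_mean_ge dcos dsin uG p2 (k := k) (zx := 0) (zy := 0).
    rewrite subr0; apply.
    + by move=> t /andP[t0 tp]; rewrite sin_ge0_pi // ltW //=; lra.
    + by move=> t /andP[t0 tp]; apply: cos_neq0; [lra|lra|rewrite lt_eqF].
    + have := cvg_at_right_filter (_ : {for 0, continuous (fun t => -1 * ((a t - k) ^+ 2 / cos t * sin t ^+ m.+1))}).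
      rewrite sin0 expr0n /= !mulr0; apply.
      apply: cvgM; first exact: cvg_cst; apply: cvgM; last exact: (ctsX csin).
      apply: cvgM; first exact: (ctsX cak).
      by apply: cvgV; [rewrite cos0 oner_eq0|exact: ccos].
    + by under eq_fun do rewrite mulrCA; apply: cvg_left_mul0.
  - have := radial_mean_ge dcos dsin uG p2pi (k := k) (zx := 0) (zy := 0).
    rewrite subr0; apply.
    + by move=> t /andP[t0 tp]; rewrite sin_ge0_pi // ltW ?(lt_trans p2) //= ltW.
    + by move=> t /andP[t0 tp]; apply: cos_neq0; [lra|lra|rewrite gt_eqF].
    + by under eq_fun do rewrite mulrCA; apply: cvg_right_mul0.
    + have := cvg_at_left_filter (_ : {for pi, continuous (fun t => -1 * ((a t - k) ^+ 2 / cos t * sin t ^+ m.+1))}).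
      rewrite sinpi expr0n /= !mulr0; apply.
      apply: cvgM; first exact: cvg_cst; apply: cvgM; last exact: (ctsX csin).
      apply: cvgM; first exact: (ctsX cak).
      by apply: cvgV; [rewrite cospi oppr_eq0 oner_eq0|exact: ccos].
have csm : continuous (fun t : R => sin t ^+ m) by exact: ctsX.
set f1 := (fun t => _) in h1; set f2 := (fun t => _) in h2 cm.
set f3 := (fun t => _ * (fluct _ _ _ _ + _)).
have c1 : continuous f1.
  apply: ctsM => //; apply: ctsD; first exact: ctsD.
  by apply: ctsN; apply: ctsM => //; exact: ctsC.
have c3 : continuous f3.
  by apply: ctsM => //; apply: ctsD => //; apply: ctsM; [exact: ctsC|exact: ctsX].
(* The energy is [m.+1] times the mass [f3] plus the two excesses [f1] and [f2], whose integrals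
   have just been shown nonnegative. *)
have -> : seg_int 0 pi (fun t => sin t ^+ m * (fluct_rad 1 cos sin G t
    + fluct_tan cos sin G t + sphere_area R m * mean_rad 1 cos sin G t ^+ 2)) =
    seg_int 0 pi (fun t => f1 t + (m.+1%:R * f3 t + sphere_area R m * f2 t)).
  by apply: eq_seg_int => t _; rewrite /f1 /f2 /f3; ring.
have c4 : continuous (fun t => m.+1%:R * f3 t) by apply: ctsM => //; exact: ctsC.
have c5 : continuous (fun t => sphere_area R m * f2 t) by apply: ctsM => //; exact: ctsC.
rewrite seg_intD //; last exact: ctsD.
rewrite seg_intD // !seg_intZ // addrCA lerDl addr_ge0 // mulr_ge0 //.
exact: ltW.
Qed.

End SpherePoincare.

(** * The scalar form on geodesic balls *)

Section BallForm.
Context {R : realType} (g : space_form).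
Local Notation kap := (kappa g : R).
Local Notation gc := (@gcos R g).
Local Notation gs := (@gsin R g).

Lemma kappa_sqr : kap ^+ 2 = 1.
Proof. by rewrite /kappa; case: g; rewrite ?sqrrN expr1n. Qed.

Lemma dexpN (t : R) : is_derive t 1 (fun t => expR (- t)) (- expR (- t)).
Proof.
have h : is_derive t 1 (fun t : R => - t) (-1) by exact: is_deriveN.
have := @der1_comp _ expR (fun t => - t) t _ _ (is_derive_expR (- t)) h.
by move=> h'; apply: (is_derive_eq h'); rewrite mulrN1.
Qed.

Lemma dgcos (t : R) : is_derive t 1 gc (- (kap * gs t)).
Proof.
rewrite /gcos /gsin /kappa; case: g; first exact: dcos.
apply: (is_derive_eq (der1M (der1D (is_derive_expR t) (dexpN t)) (der1C (2^-1 : R) t))).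
by rewrite /sinh; ring.
Qed.

Lemma dgsin (t : R) : is_derive t 1 gs (gc t).
Proof.
rewrite /gcos /gsin; case: g; first exact: dsin.
apply: (is_derive_eq (der1M (der1B (is_derive_expR t) (dexpN t)) (der1C (2^-1 : R) t))).
by rewrite /cosh; ring.
Qed.

Lemma gcos2gsin2 t : gc t ^+ 2 + kap * gs t ^+ 2 = 1.
Proof.
rewrite /gcos /gsin /kappa; case: g; first exact: cos2sin2.
rewrite /cosh /sinh; have e1 := expRxMexpNx_1 t.
rewrite (_ : _ + _ = expR t * expR (- t)) //; by field.
Qed.

Lemma gcos0 : gc 0 = 1.
Proof. by rewrite /gcos /cosh; case: g; rewrite ?cos0 // oppr0 expR0; field. Qed.

Lemma gsin0 : gs 0 = 0.
Proof. by rewrite /gsin /sinh; case: g; rewrite ?sin0 // oppr0 subrr mul0r. Qed.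

Lemma gcosN t : gc (- t) = gc t.
Proof. by rewrite /gcos /cosh; case: g; rewrite ?cosN // opprK addrC. Qed.

Lemma gsinN t : gs (- t) = - gs t.
Proof. by rewrite /gsin /sinh; case: g; rewrite ?sinN // opprK; field. Qed.

Definition admissible (r : R) := 0 < r /\ (g = Spherical -> r < pi / 2).

Lemma gcos_gt0 r t : admissible r -> - r <= t -> t <= r -> 0 < gc t.
Proof.
rewrite /admissible /gcos; case: g => -[r0 rp] tr1 tr2.
  by apply: cos_gt0_pihalf; have := rp erefl => ?; apply/andP; split; lra.
by rewrite /cosh divr_gt0 // addr_gt0 // expR_gt0.
Qed.

Lemma gsin_gt0 r t : admissible r -> 0 < t -> t <= r -> 0 < gs t.
Proof.
rewrite /admissible /gsin; case: g => -[r0 rp] tr1 tr2.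
  apply: sin_gt0_pi; have := rp erefl; have := @pi_gt0 R => ? ?.
  by apply/andP; split; lra.
by rewrite /sinh divr_gt0 // subr_gt0 ltr_expR; lra.
Qed.

Context {m : nat}.
Implicit Types (u : 'rV[R]_m.+2 -> R) (G : 'rV[R]_m.+2 -> 'rV[R]_m.+2).

(* The second variation on one coordinate [u] of a normal field. *)
Definition ball_form (r : R) u G : R :=
  seg_int 0 r (fun t => gs t ^+ m * sphere_int (fun w =>
    pol_rad kap gc gs G t w ^+ 2 + pol_tan gc gs G t w
    - kap * m.+1%:R * pol_val gc gs u t w ^+ 2))
  - gcot g r * (gs r ^+ m * sphere_int (fun w => pol_val gc gs u r w ^+ 2)).

(** Mean and fluctuation are orthogonal on each geodesic sphere, and so are their radial
    derivatives, so no cross terms appear. *)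
Lemma ball_formE r u G : has_grad u G -> 0 <= r ->
  ball_form r u G =
  seg_int 0 r (fun t => gs t ^+ m * (fluct_rad kap gc gs G t + fluct_tan gc gs G t
    - kap * m.+1%:R * fluct gc gs u t))
  - gcot g r * (gs r ^+ m * fluct gc gs u r)
  + sphere_area R m * (seg_int 0 r (fun t => gs t ^+ m *
    (mean_rad kap gc gs G t ^+ 2 - kap * m.+1%:R * mean_val gc gs u t ^+ 2))
  - gcot g r * (gs r ^+ m * mean_val gc gs u r ^+ 2)).
Proof.
move=> uG r0.
have cw := fluct_cts dgcos dgsin uG; have cd := fluct_rad_cts dgcos dgsin uG.
have ce := fluct_tan_cts dgcos dgsin uG; have ca := mean_val_cts dgcos dgsin uG.
have ca' := mean_rad_cts dgcos dgsin uG.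
have cs : continuous gs by move=> t; exact: deriv_cts (dgsin t).
have csm : continuous (fun t => gs t ^+ m) by exact: ctsX.
have massE t : sphere_int (fun w => pol_val gc gs u t w ^+ 2) =
    fluct gc gs u t + sphere_area R m * mean_val gc gs u t ^+ 2.
  have := radial_mass dgcos dgsin uG t 0; rewrite subr0 => <-.
  by apply: eq_sphere_int => w _; rewrite subr0.
set f2 := (fun t => gs t ^+ m * (mean_rad _ _ _ _ _ ^+ 2 - _)).
set f1 := (fun t => gs t ^+ m * (fluct_rad _ _ _ _ _ + _ - _)).
have c1 : continuous f1.
  apply: ctsM => //; apply: ctsD; first exact: ctsD.
  by apply: ctsN; apply: ctsM => //; exact: ctsC.
have c2 : continuous f2.
  apply: ctsM => //; apply: ctsD; first exact: ctsX.
  by apply: ctsN; apply: ctsM; [exact: ctsC|exact: ctsX].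
rewrite /ball_form massE.
rewrite (_ : seg_int 0 r _ = seg_int 0 r (fun t => f1 t + sphere_area R m * f2 t)).
  rewrite seg_intD ?seg_intZ //; first by ring.
  by apply: ctsM => //; exact: ctsC.
apply: eq_seg_int => t _; rewrite /f1 /f2.
have cval : continuous (pol_val gc gs u t).
  by have [cu _ _] := uG; exact: slice_cts.
rewrite (_ : sphere_int _ = sphere_int (fun w => pol_rad kap gc gs G t w ^+ 2 + pol_tan gc gs G t w)
    - kap * m.+1%:R * sphere_int (fun w => pol_val gc gs u t w ^+ 2)).
  by rewrite (radial_energy dgcos dgsin uG) massE; ring.
rewrite -mulNr -sphere_intZ; last exact: ctsX.
rewrite -sphere_intD; first by apply: eq_sphere_int => w _; rewrite mulNr.
  by apply: (pol_energy_cts dgcos dgsin uG); [exact: ctsC|exact: ctsI].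
by apply: ctsM; [exact: ctsC|exact: ctsX].
Qed.

Lemma ball_form_ge0 r u G : admissible r -> has_grad u G ->
  sphere_int (pol_val gc gs u r) = 0 -> 0 <= ball_form r u G.
Proof.
move=> rA uG u0; have r0 : 0 < r by case: rA.
have a0 : mean_val gc gs u r = 0 by rewrite /mean_val /sphere_mean u0 mul0r.
rewrite ball_formE ?(ltW r0) // addr_ge0 //.
  have cg : continuous (fun t => gc t * gs t ^+ m).
    apply: ctsM; first by move=> t; exact: deriv_cts (dgcos t).
    by apply: ctsX => t; exact: deriv_cts (dgsin t).
  rewrite subr_ge0.
  have := radial_fluct_ge dgcos dgsin gcos2gsin2 uG (@sphere_poincare R m) r0
    (zx := 0) (zy := fluct gc gs u r / gs r * (gc r * gs r ^+ m)).
  (* The boundary term of the form coincides with the value at [r] of the antiderivative in the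
     completed square; this is where the value of c_r enters. *)
  have -> : gcot g r * (gs r ^+ m * fluct gc gs u r) =
      fluct gc gs u r / gs r * (gc r * gs r ^+ m) by rewrite /gcot; ring.
  rewrite subr0; apply.
    - by move=> t /andP[t0 tr]; rewrite (gsin_gt0 rA) // ltW.
    - apply: cvg_right_mul0 => //; apply: (fluct_quotient dgcos dgsin uG); first exact: gsin0.
      by rewrite gcos0 oner_eq0.
    - apply: cvg_at_left_filter; apply: cvgM; last exact: cg.
      apply: cvgM; first exact: (fluct_cts dgcos dgsin uG).
      apply: cvgV; first by rewrite lt0r_neq0 // (gsin_gt0 rA).
      exact: deriv_cts (dgsin r).
rewrite mulr_ge0 ?(ltW (@sphere_area_gt0 R m)) // a0 expr0n /= mulr0 mulr0 subr0.
(* Since [gc] stays positive up to [r], the mean part meets no singular point here, unlike on the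
   whole sphere, and both limits are values. *)
have Z t : 0 <= t <= r -> {for t, continuous (fun t => - kap * ((mean_val gc gs u t - 0) ^+ 2 / gc t * gs t ^+ m.+1))}.
  move=> /andP[t0 tr].
  have c1 : continuous (fun t => (mean_val gc gs u t - 0) ^+ 2).
    by apply: ctsX; apply: ctsD; [exact: (mean_val_cts dgcos dgsin uG)|exact: ctsC].
  have c2 : continuous (fun t => gs t ^+ m.+1).
    by apply: ctsX => x; exact: deriv_cts (dgsin x).
  have c3 : gc t != 0 by rewrite lt0r_neq0 // (gcos_gt0 rA) //; lra.
  exact: (cvgM (cvg_cst _) (cvgM (cvgM (c1 t) (cvgV c3 (deriv_cts (dgcos t)))) (c2 t))).
have := radial_mean_ge dgcos dgsin uG r0 (k := 0) (zx := 0) (zy := 0).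
rewrite subr0 (_ : seg_int 0 r _ = seg_int 0 r (fun t => gs t ^+ m *
    (mean_rad kap gc gs G t ^+ 2 - kap * m.+1%:R * mean_val gc gs u t ^+ 2))).
  apply.
  - by move=> t /andP[t0 tr]; rewrite ltW // (gsin_gt0 rA) // ltW.
  - by move=> t /andP[t0 tr]; rewrite lt0r_neq0 // (gcos_gt0 rA) //; lra.
  - have Z0 : (0 : R) <= 0 <= r by apply/andP; split; [exact: lexx|exact: ltW].
    have := cvg_at_right_filter (Z _ Z0).
    by rewrite gsin0 expr0n /= !mulr0.
  - have Zr : 0 <= r <= r by apply/andP; split; [exact: ltW|exact: lexx].
    have := cvg_at_left_filter (Z _ Zr).
    by rewrite a0 subrr expr0n /= !mul0r mulr0.
by apply: eq_seg_int => t _; rewrite subr0.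
Qed.

(** The bulk integrand is an exact derivative, that of [- kap * (gc t * gs t ^+ m.+1)] up to a
    factor. Its value at [r] and the boundary term combine through [gc ^+ 2 + kap * gs ^+ 2 = 1]. *)
Lemma ball_form_height (r k : R) : admissible r ->
  ball_form r (fun x : 'rV[R]_m.+2 => k * x 0 0) (fun=> k *: delta_mx 0 0) =
  - (k ^+ 2 * sphere_area R m * (gc r * gs r ^+ m / gs r)).
Proof.
move=> rA; have r0 : 0 < r by case: rA.
have sr : gs r != 0 by rewrite lt0r_neq0 // (gsin_gt0 rA).
have vE t w : pol_val gc gs (fun x : 'rV[R]_m.+2 => k * x 0 0) t w = k * gc t.
  by rewrite /pol_val polar_point0.
have e0E : delta_mx 0 0 = row_mx 1%:M 0 :> 'rV[R]_(1 + m.+1).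
  apply/rowP => j; case: (split_ordP j) => i ->; rewrite ?row_mxEl ?row_mxEr !mxE //=.
  by rewrite !ord1.
have rE t (w : 'rV[R]_m.+1) : pol_rad kap gc gs (fun=> k *: delta_mx 0 0) t w = - (k * kap * gs t).
  rewrite /pol_rad dotZl e0E dot_row_mx mul1r.
  by rewrite -[X in dot X _](scale0r 0) dotZl mul0r addr0; ring.
have tE t (w : 'rV[R]_m.+1) : pol_tan gc gs (fun=> k *: delta_mx 0 0) t w = 0.
  rewrite /pol_tan; set q := rgrad _.
  have -> : q = 0 *: q.
    by rewrite scale0r; apply/rowP => j; rewrite /q !mxE /= mulr0.
  by rewrite !dotZr !mul0r expr0n subr0.
have cs : continuous gs by move=> t; exact: deriv_cts (dgsin t).
have cc : continuous gc by move=> t; exact: deriv_cts (dgcos t).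
pose F t := k ^+ 2 * sphere_area R m * (- kap * (gc t * gs t ^+ m.+1)).
rewrite /ball_form (@eq_sphere_int _ _ _ (fun=> k ^+ 2 * gc r ^+ 2)); last first.
  by move=> w _; rewrite vE exprMn.
rewrite sphere_int_cst.
rewrite (@eq_seg_int _ _ (fun t => k ^+ 2 * sphere_area R m * (gs t ^+ m *
    (gs t ^+ 2 - kap * m.+1%:R * gc t ^+ 2)))); last first.
  move=> t _; rewrite (@eq_sphere_int _ _ _ (fun=> k ^+ 2 * (gs t ^+ 2 - kap * m.+1%:R * gc t ^+ 2))).
    by rewrite sphere_int_cst; ring.
  by move=> w _; rewrite vE rE tE; ring: kappa_sqr.
have dF (t : R) : 0 <= t -> is_derive t 1 F (k ^+ 2 * sphere_area R m * (gs t ^+ m *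
    (gs t ^+ 2 - kap * m.+1%:R * gc t ^+ 2))).
  move=> _; apply: der1Z.
  apply: (is_derive_eq (der1Z (- kap) (der1M (dgcos t) (der1X m.+1 (dgsin t))))).
  by rewrite /= [gs t ^+ m.+1]exprS; ring: kappa_sqr.
rewrite (seg_int_FTC (ltW r0) _ dF); last first.
  apply: ctsM; first exact: ctsC.
  apply: ctsM; first exact: ctsX.
  apply: ctsD; first exact: ctsX.
  by apply: ctsN; apply: ctsM; [exact: ctsC|exact: ctsX].
have h := gcos2gsin2 r.
rewrite /F gsin0 expr0n /= !mulr0 subr0 /gcot [gs r ^+ m.+1]exprS.
have -> : gc r * gs r ^+ m / gs r = gc r * gs r ^+ m / gs r * (gc r ^+ 2 + kap * gs r ^+ 2).
  by rewrite h mulr1.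
by field.
Qed.

End BallForm.

(** * Polar coordinates of the geodesic ball *)

Local Notation form := Defs.form.

(** * The bilinear form of the ambient space *)

Section Form.
Context {R : realType} (g : space_form) {n : nat}.
Implicit Types x y z : 'rV[R]_n.+1.

Lemma formE x y : form g x y = kappa g * x 0 0 * y 0 0 + dot (rgrad x) (rgrad y).
Proof.
congr (_ + _); apply: eq_bigr => i _; rewrite /rgrad !mxE.
by congr (x _ _ * y _ _); apply/val_inj; rewrite /= /bump.
Qed.

Lemma formC x y : form g x y = form g y x.
Proof. by rewrite !formE dotC; ring. Qed.

Lemma formDr x y z : form g x (y + z) = form g x y + form g x z.
Proof. by rewrite !formE /rgrad linearD dotDr mxE; ring. Qed.

Lemma formZr a x y : form g x (a *: y) = a * form g x y.
Proof. by rewrite !formE /rgrad linearZ dotZr mxE; ring. Qed.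

Lemma formDl x y z : form g (y + z) x = form g y x + form g z x.
Proof. by rewrite formC formDr !(formC x). Qed.

Lemma formZl a x y : form g (a *: y) x = a * form g y x.
Proof. by rewrite formC formZr formC. Qed.

Lemma form0r x : form g x 0 = 0.
Proof. by rewrite -(scale0r 0) formZr mul0r. Qed.

Lemma form0l x : form g 0 x = 0.
Proof. by rewrite formC form0r. Qed.

Lemma formNr x y : form g x (- y) = - form g x y.
Proof. by rewrite -scaleN1r formZr mulN1r. Qed.

Lemma formBr x y z : form g x (y - z) = form g x y - form g x z.
Proof. by rewrite formDr formNr. Qed.

Lemma formBl x y z : form g (y - z) x = form g y x - form g z x.
Proof. by rewrite formC formBr !(formC x). Qed.

Lemma formDD x y z t :
  form g (x + y) (z + t) = form g x z + form g x t + (form g y z + form g y t).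
Proof. by rewrite formDl !formDr. Qed.

Lemma form_sumr (I : Type) (r : seq I) (P : pred I) (F : I -> 'rV[R]_n.+1) x :
  form g x (\sum_(i <- r | P i) F i) = \sum_(i <- r | P i) form g x (F i).
Proof.
elim/big_rec2: _ => [|i a b _ <-]; first exact: form0r.
exact: formDr.
Qed.

Lemma form_pole x : form g pole x = kappa g * x 0 0.
Proof.
rewrite formE (_ : rgrad pole = 0 *: rgrad x) ?dotZl ?mxE ?eqxx /=; first by ring.
by rewrite scale0r; apply/rowP => i; rewrite !mxE.
Qed.

Lemma pole00 : (pole : 'rV[R]_n.+1) 0 0 = 1.
Proof. by rewrite /pole mxE !eqxx. Qed.

Lemma form_comb k (E : 'M[R]_(k, n.+1)) x (b : 'rV[R]_k) :
  form g x (b *m E) = \sum_j b 0 j * form g x (row j E).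
Proof. by rewrite mulmx_sum_row form_sumr; apply: eq_bigr => j _; rewrite formZr. Qed.

Lemma form_frame k (E : 'M[R]_(k, n.+1)) (a b : 'rV[R]_k) :
  (forall i j, form g (row i E) (row j E) = (i == j)%:R) ->
  form g (a *m E) (b *m E) = dot a b.
Proof.
move=> oE; rewrite form_comb; apply: eq_bigr => j _.
rewrite formC form_comb mulrC; congr (_ * _).
rewrite (bigD1 j) //= big1 ?addr0; first by rewrite oE eqxx mulr1.
by move=> i ij; rewrite oE eq_sym (negbTE ij) mulr0.
Qed.

End Form.

(** * Spherical coordinates and their Gram determinant *)

Section SphericalCoord.
Context {R : realType}.

Lemma polar_pointN m c s (w : 'rV[R]_m) :
  - polar_point c s w = polar_point (- c) s (- w).
Proof.
apply: (etrans (@opp_row_mx _ 1 1 m _ _)).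
by rewrite /polar_point scalerN raddfN.
Qed.

Definition sph m (th : 'rV[R]_m) : 'rV[R]_m.+1 := \row_j spherical_coord th j.

Lemma sph0 (th : 'rV[R]_0) : sph th = const_mx 1.
Proof. by apply/rowP => j; rewrite !mxE /spherical_coord !big_ord0 mulr1. Qed.

(** Splitting off the first angle exhibits spherical coordinates as iterated polar points, the
    recursion on which [sphere_int] is built. *)
Lemma sphS m (th : 'rV[R]_(1 + m)) :
  sph (th : 'rV[R]_m.+1) = polar_point (cos (th 0 0)) (sin (th 0 0)) (sph (rsubmx th)).
Proof.
have thE (i : 'I_m) : th 0 (lift ord0 i) = (rsubmx th) 0 i.
  by rewrite mxE; congr (th _ _); apply/val_inj.
apply/rowP => j; rewrite mxE /polar_point mxE; case: splitP => i ji.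
  rewrite mxE ord1 eqxx mulr1n ji ord1 /spherical_coord /=.
  rewrite big1 ?mul1r; last by move=> l; rewrite ltn0.
  by rewrite (bigD1 ord0) //= big1 ?mulr1 // => l /andP[/eqP lj /eqP []]; apply/val_inj.
rewrite !mxE ji /spherical_coord add1n.
have -> : \prod_(l < m.+1 | (l < i.+1)%N) sin (th 0 l) =
    sin (th 0 0) * \prod_(l < m | (l < i)%N) sin (rsubmx th 0 l).
  rewrite big_mkcond big_ord_recl [in RHS]big_mkcond /=; congr (sin (th 0 _) * _).
  by apply: eq_bigr => l _; rewrite thE /bump /= add1n ltnS.
have -> : \prod_(l < m.+1 | l == i.+1 :> nat) cos (th 0 l) =
    \prod_(l < m | l == i :> nat) cos (rsubmx th 0 l).
  rewrite big_mkcond big_ord_recl [in RHS]big_mkcond /= mul1r.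
  by apply: eq_bigr => l _; rewrite thE /bump /= add1n eqSS.
by rewrite mulrA.
Qed.

(** Row i is the partial derivative of [sph] in the i-th angle: the first angle turns the polar
    point, and all later ones act through the slice, scaled by [sin]. *)
Fixpoint sph_jac m : 'rV[R]_m -> 'M[R]_(m, m.+1) :=
  match m with
  | 0 => fun=> 0
  | m'.+1 => fun th : 'rV[R]_(1 + m') =>
      col_mx (polar_point (- sin (th 0 0)) (cos (th 0 0)) (sph (rsubmx th)))
             (row_mx 0 (sin (th 0 0) *: sph_jac (rsubmx th)) : 'M[R]_(m', 1 + m'.+1))
  end.

(** The square root of the Gram determinant of [sph_jac]. The absolute value makes this true for all
    angles, not only those in [0, pi]. *)
Fixpoint sph_weight m : 'rV[R]_m -> R :=
  match m with
  | 0 => fun=> 1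
  | m'.+1 => fun th : 'rV[R]_(1 + m') => `|sin (th 0 0)| ^+ m' * sph_weight (rsubmx th)
  end.

Lemma dot_sph m (th : 'rV[R]_m) : dot (sph th) (sph th) = 1.
Proof.
elim: m th => [|m IH] th; first by rewrite sph0 /dot big_ord1 !mxE mulr1.
by rewrite sphS dot_polar_point IH mulr1 cos2Dsin2.
Qed.

Lemma sph_jac_mul m (v : 'rV[R]_(1 + m)) (th : 'rV[R]_(1 + m)) :
  (v : 'rV[R]_m.+1) *m sph_jac (th : 'rV[R]_m.+1) =
  (row_mx (- (sin (th 0 0) * v 0 0))%:M ((cos (th 0 0) * v 0 0) *: sph (rsubmx th)
     + sin (th 0 0) *: (rsubmx v *m sph_jac (rsubmx th))) : 'rV[R]_(1 + m.+1)).
Proof.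
have vE : v = row_mx (v 0 0)%:M (rsubmx v) by exact: row_mx_rgrad.
rewrite {1}vE.
apply: (etrans (@mul_row_col _ 1 1 m (1 + m.+1) (v 0 0)%:M (rsubmx v)
  (row_mx (- sin (th 0 0))%:M (cos (th 0 0) *: sph (rsubmx th)))
  (row_mx 0 (sin (th 0 0) *: sph_jac (rsubmx th))))).
rewrite mul_scalar_mx mul_mx_row mulmx0 -scalemxAr scale_row_mx add_row_mx.
rewrite addr0 scale_scalar_mx scalerA.
by congr (row_mx _%:M (_ *: _ + _)); ring.
Qed.

Lemma dot_sph_jac m (th v : 'rV[R]_m) : dot (v *m sph_jac th) (sph th) = 0.
Proof.
elim: m th v => [|m IH] th v; first by rewrite mulmx0 -(scale0r 0) dotZl mul0r.
rewrite sph_jac_mul sphS /polar_point dot_row_mx dotZr [dot (_ + _) _]dotC dotDr.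
by rewrite !dotZr dot_sph [dot (sph _) (_ *m _)]dotC IH; ring.
Qed.

(** The round metric in latitude form, [dt^2 + sin(t)^2] times the metric of the slice; the cross
    terms vanish because [sph] is orthogonal to its derivatives. *)
Lemma sph_gram_mul m (v w : 'rV[R]_(1 + m)) (th : 'rV[R]_(1 + m)) :
  dot ((v : 'rV[R]_m.+1) *m sph_jac (th : 'rV[R]_m.+1)) ((w : 'rV[R]_m.+1) *m sph_jac (th : 'rV[R]_m.+1)) =
  v 0 0 * w 0 0 + sin (th 0 0) ^+ 2 *
    dot (rsubmx v *m sph_jac (rsubmx th)) (rsubmx w *m sph_jac (rsubmx th)).
Proof.
rewrite !sph_jac_mul dot_row_mx [dot (_ + _) _]dotC !dotDr !(dotC (_ + _)) !dotDr.
rewrite !dotZl !dotZr dot_sph !dot_sph_jac [dot (sph _) (_ *m _)]dotC dot_sph_jac.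
rewrite (_ : v 0 0 * w 0 0 = (cos (th 0 0) ^+ 2 + sin (th 0 0) ^+ 2) * (v 0 0 * w 0 0)).
  by ring.
by rewrite cos2Dsin2 mul1r.
Qed.

Definition sph_gram m (th : 'rV[R]_m) : 'M[R]_m :=
  \matrix_(i, j) dot (row i (sph_jac th)) (row j (sph_jac th)).

(** A warped product metric has a block Gram matrix. It is used with [q] the square of [sin] for the
    sphere and of [gsin] for the ball. *)
Lemma gram_block m d (q : R) (J : 'M[R]_(m, d)) :
  (\matrix_(i, j) ((delta_mx 0 i : 'rV[R]_(1 + m)) 0 0 * (delta_mx 0 j : 'rV[R]_(1 + m)) 0 0
    + q * dot (rsubmx (delta_mx 0 i : 'rV[R]_(1 + m)) *m J)
              (rsubmx (delta_mx 0 j : 'rV[R]_(1 + m)) *m J)) : 'M[R]_(1 + m)) =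
  block_mx 1%:M 0 0 (q *: \matrix_(i, j) dot (row i J) (row j J)).
Proof.
have e1 (l : 'I_m) : rsubmx (delta_mx 0 (rshift 1 l) : 'rV[R]_(1 + m)) = delta_mx 0 l.
  by apply/rowP => l'; rewrite !mxE eq_rshift.
have e0 (l : 'I_1) : rsubmx (delta_mx 0 (lshift m l) : 'rV[R]_(1 + m)) = 0.
  by apply/rowP => l'; rewrite !mxE eq_rlshift andbF.
have d0 (x : 'rV[R]_d) : dot 0 x = 0 by rewrite -(scale0r 0) dotZl mul0r.
have f1 (l : 'I_m) : (delta_mx 0 (rshift 1 l) : 'rV[R]_(1 + m)) 0 0 = 0 by rewrite !mxE.
have f0 (l : 'I_1) : (delta_mx 0 (lshift m l) : 'rV[R]_(1 + m)) 0 0 = 1.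
  by rewrite !mxE ord1.
apply/matrixP => i j; rewrite mxE.
case: (split_ordP i) => i' ->; case: (split_ordP j) => j' ->;
  rewrite ?block_mxEul ?block_mxEur ?block_mxEdl ?block_mxEdr ?f0 ?f1 ?e0 ?e1 ?mul0mx.
- by rewrite d0 !mxE !ord1 /=; ring.
- by rewrite d0 !mxE; ring.
- by rewrite dotC d0 !mxE; ring.
- by rewrite !mxE !rowE; ring.
Qed.

Lemma sph_gramS m (th : 'rV[R]_(1 + m)) :
  sph_gram (th : 'rV[R]_m.+1) =
  block_mx 1%:M 0 0 (sin (th 0 0) ^+ 2 *: sph_gram (rsubmx th)) :> 'M[R]_(1 + m).
Proof.
rewrite -gram_block; apply/matrixP => i j; rewrite [LHS]mxE [RHS]mxE !rowE.
exact: (sph_gram_mul (delta_mx 0 i) (delta_mx 0 j) th).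
Qed.

Lemma sqrt_det_scale m (q : R) (A : 'M[R]_m) (w : R) : 0 <= w -> \det A = w ^+ 2 ->
  Num.sqrt (\det (q ^+ 2 *: A)) = `|q| ^+ m * w.
Proof.
move=> w0 dA; rewrite detZ dA -exprM mulnC exprM -exprMn sqrtr_sqr.
by rewrite normrM normrX (ger0_norm w0).
Qed.

Lemma det_sph_gram m (th : 'rV[R]_m) : \det (sph_gram th) = sph_weight th ^+ 2.
Proof.
elim: m th => [|m IH] th; first by rewrite det_mx00 expr1n.
rewrite (sph_gramS th); apply: (etrans (@det_ublock _ 1 m _ _ _)).
rewrite det1 mul1r detZ IH /=; set s := sin _.
have ns : `|s| * `|s| = s * s by rewrite -normrM ger0_norm // -expr2 sqr_ge0.
by rewrite [RHS]exprMn (expr2 (`|s| ^+ m)) -exprMn ns expr2.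
Qed.

Lemma sph_weight_ge0 m (th : 'rV[R]_m) : 0 <= sph_weight th.
Proof. by elim: m th => [|m IH] th //=; rewrite mulr_ge0 ?exprn_ge0. Qed.

Lemma sph_deriv m (th : R -> 'rV[R]_m) (t : R) v : is_derive t 1 th v ->
  is_derive t 1 (fun s => sph (th s)) (v *m sph_jac (th t)).
Proof.
elim: m th v => [|m IH] th v dth.
  have -> : (fun s => sph (th s)) = (fun=> const_mx 1) by apply/funext => s; exact: sph0.
  by apply: (is_derive_eq (der1C (const_mx 1 : 'rV[R]_1) t)); rewrite mulmx0.
have d0 : is_derive t 1 (fun s => th s 0 0) (v 0 0) by exact: deriv_coord.
have d1 : is_derive t 1 (fun s => rsubmx (th s : 'rV_(1 + m))) (rsubmx (v : 'rV_(1 + m))).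
  apply: deriv_mx => i j; rewrite mxE; under eq_fun do rewrite mxE; exact: deriv_coord.
have -> : (fun s => sph (th s)) = (fun s => polar_point (cos (th s 0 0)) (sin (th s 0 0))
    (sph (rsubmx (th s : 'rV_(1 + m))))) by apply/funext => s; exact: sphS.
apply: (is_derive_eq (deriv_polar_point (der1_comp (is_derive_cos _) d0)
  (der1_comp (is_derive_sin _) d0) (IH _ _ d1))).
by rewrite (sph_jac_mul v (th t)) mulNr.
Qed.

End SphericalCoord.

(** * Iterated integrals and half-spheres *)

Section BoxIntegral.
Context {R : realType}.

Lemma box_integral_cts (P : topologicalType) m (lo hi : 'rV[R]_m) (f : P -> 'rV[R]_m -> R) :
  (forall i, lo 0 i <= hi 0 i) -> continuous (fun x : P * 'rV[R]_m => f x.1 x.2) ->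
  continuous (fun p => box_integral lo hi (f p)).
Proof.
elim: m P lo hi f => [|m IH] P lo hi f lohi cf /=.
  apply: (cts_comp (f := fun p : P => (p, 0 : 'rV[R]_0)) _ cf).
  by apply: cts_pair; [exact: ctsI|exact: ctsC].
apply: seg_int_cts; first exact: lohi.
apply: (IH _ _ _ (fun (x : P * R) y => f x.1 (row_mx x.2%:M y : 'rV[R]_(1 + m)))).
  by move=> i; rewrite !mxE; exact: lohi.
apply: (cts_comp (f := fun x : P * R * 'rV[R]_m => (x.1.1, row_mx x.1.2%:M x.2 : 'rV[R]_(1 + m))) _ cf).
apply: cts_pair; first exact: (cts_comp (@cts_fst _ _) (@cts_fst _ _)).
by apply: row_mx_cts; [exact: (cts_comp (@cts_fst _ _) (@cts_snd _ _))|exact: cts_snd].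
Qed.

Lemma eq_box_integral m (lo hi : 'rV[R]_m) (f h : 'rV[R]_m -> R) :
  (forall y : 'rV[R]_m, (forall i, lo 0 i <= y 0 i <= hi 0 i) -> f y = h y) ->
  box_integral lo hi f = box_integral lo hi h.
Proof.
elim: m lo hi f h => [|m IH] lo hi f h fh /=; first by apply: fh => -[].
apply: eq_seg_int => t lot; apply: IH => y loy; apply: fh => i.
case: (split_ordP (i : 'I_(1 + m))) => j -> /=.
  by rewrite (row_mxEl t%:M y 0 j) mxE ord1 mulr1n; rewrite (_ : lshift m 0 = 0) //; exact/val_inj.
by rewrite (row_mxEr t%:M y 0 j); have := loy j; rewrite !mxE.
Qed.

Lemma box_integralS m (a b : R) (lo hi : 'rV[R]_m) (f : 'rV[R]_(1 + m) -> R) :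
  @box_integral R m.+1 (row_mx a%:M lo : 'rV[R]_(1 + m)) (row_mx b%:M hi : 'rV[R]_(1 + m)) f =
  seg_int a b (fun t => box_integral lo hi (fun y => f (row_mx t%:M y))).
Proof.
have l0 (c : R) (v : 'rV[R]_m) : (row_mx c%:M v : 'rV[R]_(1 + m)) 0 0 = c.
  by rewrite mxE; case: splitP => // j _; rewrite mxE ord1 mulr1n.
by rewrite /= !l0 !row_mxKr.
Qed.

Lemma box_integralZ m (lo hi : 'rV[R]_m) a (f : 'rV[R]_m -> R) :
  (forall i, lo 0 i <= hi 0 i) -> continuous f ->
  box_integral lo hi (fun y => a * f y) = a * box_integral lo hi f.
Proof.
elim: m lo hi f => [//|m IH] lo hi f lohi cf.
have lohi' i : (rsubmx (lo : 'rV_(1 + m))) 0 i <= (rsubmx (hi : 'rV_(1 + m))) 0 i.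
  by rewrite !mxE; exact: lohi.
apply: etrans (seg_intZ _ _ _ _); last first.
  apply: box_integral_cts => //.
  by apply: (cts_comp _ cf); apply: row_mx_cts; [exact: cts_fst|exact: cts_snd].
apply: eq_seg_int => t _; apply: IH => //.
by apply: (cts_comp _ cf); apply: row_mx_cts; [exact: ctsC|exact: ctsI].
Qed.

Lemma sph_cts m : continuous (@sph R m).
Proof.
elim: m => [|m IH].
  by rewrite (_ : @sph R 0 = fun=> const_mx 1); [exact: ctsC|apply/funext => s; exact: sph0].
rewrite (_ : @sph R m.+1 = fun th => polar_point (cos (th 0 0)) (sin (th 0 0)) (sph (rgrad th))); last first.
  by apply/funext => th; exact: sphS.
apply: polar_point_cts.
- exact: (cts_comp (@cts_coord _ _ _ 0 0) (@cts_cos R)).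
- exact: (cts_comp (@cts_coord _ _ _ 0 0) (@cts_sin R)).
- exact: (cts_comp (@rgrad_cts R m) IH).
Qed.

Lemma sph_weight_cts m : continuous (@sph_weight R m).
Proof.
elim: m => [|m IH]; first exact: ctsC.
apply: ctsM; last exact: (cts_comp (@rgrad_cts R m) IH).
apply: ctsX; apply: (cts_comp _ (@norm_continuous R R)).
exact: (cts_comp (@cts_coord _ _ _ 0 0) (@cts_sin R)).
Qed.

(** With all angles in [0, pi] the last coordinate, the product of the sines, is nonnegative, so
    only half of the sphere is covered; for [m = 0] it is the single point 1. *)
Definition hemisphere_int m (u : 'rV[R]_m.+1 -> R) : R :=
  box_integral (const_mx 0) (const_mx pi) (fun th : 'rV[R]_m => u (sph th) * sph_weight th).

Let pi_box m (i : 'I_m) : (const_mx 0 : 'rV[R]_m) 0 i <= (const_mx pi : 'rV[R]_m) 0 i.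
Proof. by rewrite !mxE pi_ge0. Qed.

Lemma hemisphere_int_cts (P : topologicalType) m (f : P -> 'rV[R]_m.+1 -> R) :
  continuous (fun x : P * 'rV[R]_m.+1 => f x.1 x.2) ->
  continuous (fun p => hemisphere_int (f p)).
Proof.
move=> cf.
apply: (box_integral_cts (f := fun p th => f p (sph th) * sph_weight th)) => //.
apply: ctsM; last exact: (cts_comp (@cts_snd _ _) (@sph_weight_cts m)).
apply: (cts_comp (f := fun x : P * 'rV[R]_m => (x.1, sph x.2)) _ cf).
by apply: cts_pair; [exact: cts_fst|exact: (cts_comp (@cts_snd _ _) (@sph_cts m))].
Qed.

Lemma hemisphere_intS m (u : 'rV[R]_m.+2 -> R) : continuous u ->
  hemisphere_int u = seg_int 0 pi (fun t =>
    sin t ^+ m * hemisphere_int (fun w => u (polar_point (cos t) (sin t) w))).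
Proof.
move=> cu; rewrite /hemisphere_int /=.
have rc (a : R) : rsubmx (const_mx a : 'rV_(1 + m)) = const_mx a by apply/rowP => i; rewrite !mxE.
rewrite !mxE !rc; apply: eq_seg_int => t /andP[t0 tp].
rewrite -box_integralZ //; last first.
  apply: ctsM; last exact: sph_weight_cts.
  apply: (cts_comp _ cu); apply: polar_point_cts; [exact: ctsC|exact: ctsC|].
  exact: sph_cts.
apply: eq_box_integral => th _.
rewrite (sphS (row_mx t%:M th)) row_mxKr.
have -> : row_mx t%:M th 0 0 = t by rewrite mxE; case: splitP => // j _; rewrite mxE ord1 mulr1n.
by rewrite [`|_|]ger0_norm ?sin_ge0_pi ?t0 //; ring.
Qed.

(** By induction through the latitudes: the antipodal map sends latitude [t] to [pi - t] and [w] to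
    [- w], so after reflecting the latitude the two halves pair up slice by slice. *)
Lemma hemisphere_sphere_int m (u : 'rV[R]_m.+1 -> R) : continuous u ->
  hemisphere_int u + hemisphere_int (fun w => u (- w)) = sphere_int u.
Proof.
elim: m u => [|m IH] u cu.
  by rewrite /hemisphere_int /= sph0 !mulr1; congr (_ + u _); apply/rowP => i; rewrite !mxE.
have cuN : continuous (fun w : 'rV[R]_m.+2 => u (- w)).
  by apply: (cts_comp _ cu); exact: ctsN (@ctsI _).
rewrite !hemisphere_intS //=.
pose h t := sin t ^+ m * hemisphere_int (fun w => u (polar_point (cos t) (sin t) (- w))).
have ch : continuous h.
  apply: ctsM; first exact: ctsX (@cts_sin R).
  apply: (hemisphere_int_cts (f := fun t w => u (polar_point (cos t) (sin t) (- w)))).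
  apply: (cts_comp _ cu); apply: polar_point_cts.
  - exact: cts_comp (@cts_fst _ _) (@cts_cos R).
  - exact: cts_comp (@cts_fst _ _) (@cts_sin R).
  - by apply: ctsN; exact: cts_snd.
rewrite (_ : seg_int 0 pi (fun t => _ * hemisphere_int (fun w => u (- _))) = seg_int 0 pi h); last first.
  rewrite -[RHS](_ : seg_int (pi - pi) (pi - 0) h = _); last by rewrite subrr subr0.
  rewrite -seg_int_reflect ?pi_ge0 //; apply: eq_seg_int => t _.
  have -> : pi - t = - t + pi by rewrite addrC.
  rewrite /h cosDpi sinDpi cosN sinN opprK; congr (_ * hemisphere_int _).
  by apply/funext => w; rewrite polar_pointN.
rewrite -seg_intD //.
  apply: eq_seg_int => t _; rewrite -mulrDr; congr (_ * _).
  by rewrite -IH //; exact: slice_cts.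
apply: ctsM; first exact: ctsX (@cts_sin R).
apply: (hemisphere_int_cts (f := fun t w => u (polar_point (cos t) (sin t) w))).
apply: (cts_comp _ cu); apply: polar_point_cts.
- exact: cts_comp (@cts_fst _ _) (@cts_cos R).
- exact: cts_comp (@cts_fst _ _) (@cts_sin R).
- exact: cts_snd.
Qed.

End BoxIntegral.

(** * Area densities of polar coordinates *)

Section PolarMap.
Context {R : realType} (g : space_form) {n m : nat} (E : 'M[R]_(m.+1, n.+1)).
Hypothesis oE : forall i j, form g (row i E) (row j E) = (i == j)%:R.
Hypothesis pE : forall i, form g pole (row i E) = 0.

Definition polar_map (a b : R) (w : 'rV[R]_m.+1) : 'rV[R]_n.+1 :=
  a *: pole + b *: (w *m E).

Lemma form_polar_map a b a' b' w w' :
  form g (polar_map a b w) (polar_map a' b' w') = kappa g * a * a' + b * b' * dot w w'.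
Proof.
have p0 v : form g pole (v *m E) = 0.
  by rewrite form_comb big1 // => j _; rewrite pE mulr0.
rewrite /polar_map !formDl !formDr !formZl !formZr form_frame // p0 (formC _ _ pole) p0.
by rewrite form_pole pole00; ring.
Qed.

Lemma polar_mapNN a b w : polar_map a (- b) w = polar_map a b (- w).
Proof. by rewrite /polar_map mulNmx scalerN scaleNr. Qed.

Lemma polar_map_deriv (rho : R -> R) (w : R -> 'rV[R]_m.+1) (t : R) rho' w' :
  is_derive t 1 rho rho' -> is_derive t 1 w w' ->
  is_derive t 1 (fun s => polar_map (gcos g (rho s)) (gsin g (rho s)) (w s))
    (polar_map (- (kappa g * gsin g (rho t)) * rho') (gcos g (rho t) * rho') (w t)
     + gsin g (rho t) *: (w' *m E)).
Proof.
move=> dr dw.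
have dwE : is_derive t 1 (fun s => w s *m E) (w' *m E).
  apply: deriv_mx => i j; rewrite mxE.
  under eq_fun do rewrite mxE.
  have -> : (fun s => \sum_l w s i l * E l j) = (\sum_l (fun s => w s i l * E l j)).
    by apply/funext => s; rewrite fct_sumE.
  apply: is_derive_sum => l; apply: (is_derive_eq (der1M (deriv_coord i l dw) (der1C (E l j) t))).
  by rewrite mulr0 addr0.
have h1 := deriv_scale_vec (der1_comp (dgcos g (rho t)) dr) (der1C (pole : 'rV[R]_n.+1) t).
have h2 := deriv_scale_vec (der1_comp (dgsin g (rho t)) dr) dwE.
have h3 := is_deriveD h1 h2.
by apply: (is_derive_eq h3); rewrite scaler0 addr0 /polar_map -addrA.
Qed.

Lemma line_deriv d (y v : 'rV[R]_d) : is_derive (0 : R) 1 (fun t : R => y + t *: v) v.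
Proof.
apply: deriv_mx => i j; under eq_fun do rewrite !mxE.
apply: (is_derive_eq (der1D (der1C (y i j) 0) (der1M (der1I 0) (der1C (v i j) 0)))).
by rewrite mulr0 addr0 add0r mul1r.
Qed.

Lemma sphere_density (rho : R) (th : 'rV[R]_m) :
  area_density g (fun th => polar_map (gcos g rho) (gsin g rho) (sph th)) th =
  `|gsin g rho| ^+ m * sph_weight th.
Proof.
rewrite -(sqrt_det_scale (gsin g rho) (sph_weight_ge0 th) (det_sph_gram th)).
congr (Num.sqrt (\det _)); apply/matrixP => i j; rewrite !mxE.
have pd l : partial (fun th => polar_map (gcos g rho) (gsin g rho) (sph th)) l th =
    polar_map 0 (gsin g rho) (row l (sph_jac th)).
  rewrite /partial derive1E.
  have dl := line_deriv th (delta_mx 0 l).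
  rewrite (@derive_val _ _ _ _ _ _ _ (polar_map_deriv (der1C rho 0) (sph_deriv dl))).
  by rewrite /polar_map !mulr0 !scale0r !add0r addr0 rowE.
by rewrite !pd form_polar_map mulr0 add0r expr2.
Qed.

Lemma ball_density (y : 'rV[R]_(1 + m)) :
  area_density g (fun y : 'rV[R]_(1 + m) => polar_map (gcos g (y 0 0)) (gsin g (y 0 0)) (sph (rsubmx y))) y =
  `|gsin g (y 0 0)| ^+ m * sph_weight (rsubmx y).
Proof.
rewrite -(sqrt_det_scale (gsin g (y 0 0)) (sph_weight_ge0 _) (det_sph_gram (rsubmx y))).
(* The determinant is padded with a unit block for the radial direction, to match the metric of the
   ball. *)
rewrite -[\det (_ *: _)]mul1r -(det1 _ 1) -(det_ublock _ 0) -gram_block.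
congr (Num.sqrt (\det _)); apply/matrixP => i j; rewrite [LHS]mxE [RHS]mxE.
have pd l : partial (fun y : 'rV[R]_(1 + m) => polar_map (gcos g (y 0 0)) (gsin g (y 0 0)) (sph (rsubmx y))) l y =
    polar_map (- (kappa g * gsin g (y 0 0)) * (delta_mx 0 l : 'rV[R]_(1 + m)) 0 0)
       (gcos g (y 0 0) * (delta_mx 0 l : 'rV[R]_(1 + m)) 0 0) (sph (rsubmx y))
    + polar_map 0 (gsin g (y 0 0)) (rsubmx (delta_mx 0 l : 'rV[R]_(1 + m)) *m sph_jac (rsubmx y)).
  rewrite /partial derive1E.
  have dl := line_deriv y (delta_mx 0 l).
  have dl1 : is_derive (0 : R) 1 (fun t : R => rsubmx (y + t *: delta_mx 0 l)) (rsubmx (delta_mx 0 l : 'rV[R]_(1 + m))).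
    apply: deriv_mx => a b; rewrite mxE; under eq_fun do rewrite mxE.
    exact: deriv_coord.
  rewrite (@derive_val _ _ _ _ _ _ _ (polar_map_deriv (deriv_coord 0 0 dl) (sph_deriv dl1))).
  by rewrite scale0r addr0 /polar_map scale0r add0r.
rewrite !pd formDD !form_polar_map dot_sph !dot_sph_jac.
rewrite (dotC (sph _)) dot_sph_jac.
have h := gcos2gsin2 g (y 0 0); have k2 := @kappa_sqr R g.
set a := (delta_mx 0 i : 'rV__) 0 0; set b := (delta_mx 0 j : 'rV__) 0 0.
(* The radial derivative has unit length because [gcos ^+ 2 + kappa * gsin ^+ 2 = 1] and
   [kappa ^+ 2 = 1]. *)
have -> : a * b = a * b * (gcos g (y 0 0) ^+ 2 + kappa g * gsin g (y 0 0) ^+ 2) by rewrite h mulr1.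
ring: k2.
Qed.

End PolarMap.

(** * Integrals over the geodesic ball and its boundary *)

Section PolarIntegrals.
Context {R : realType} (g : space_form) {n m : nat} (S : set 'rV[R]_n.+1).
Local Notation E := (frame g m.+1 (tangent_space S pole)).
Hypothesis oE : forall i j, form g (row i E) (row j E) = (i == j)%:R.
Hypothesis pE : forall i, form g pole (row i E) = 0.

Lemma polar_sph (rho : R) (th : 'rV[R]_m) :
  @polar R g n m.+1 S rho th = polar_map E (gcos g rho) (gsin g rho) (sph th).
Proof.
rewrite /polar /polar_map mulmx_sum_row; congr (_ + _ *: _).
by apply: eq_bigr => j _; rewrite mxE.
Qed.

(** The pairs [(t, w)] and [(- t, - w)] name the same point, so negative radii over one half-sphere
    become positive radii over the opposite half. The integrand is compared with [Phi] only on the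
    ball, where its chosen frames and projections are known. *)
Lemma ball_integralE (r : R) (f : 'rV[R]_n.+1 -> R) (Phi : R -> 'rV[R]_m.+1 -> R) :
  admissible g r -> continuous (fun x : R * 'rV[R]_m.+1 => Phi x.1 x.2) ->
  (forall t w, Phi (- t) (- w) = Phi t w) ->
  (forall t w, - r <= t <= r -> dot w w = 1 ->
     f (polar_map E (gcos g t) (gsin g t) w) = Phi t w) ->
  ball_integral g m.+1 r S f = seg_int 0 r (fun t => gsin g t ^+ m * sphere_int (Phi t)).
Proof.
move=> rA cP PN fP; have r0 : 0 < r by case: rA.
have cPt t : continuous (Phi t).
  by apply: (cts_comp (f := fun w => (t, w)) _ cP); apply: cts_pair; [exact: ctsC|exact: ctsI].
pose h t := `|gsin g t| ^+ m * hemisphere_int (Phi t).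
have ch : continuous h.
  apply: ctsM; last exact: hemisphere_int_cts.
  apply: ctsX; apply: (cts_comp _ (@norm_continuous R R)) => t; exact: deriv_cts (dgsin g t).
transitivity (seg_int (- r) r h).
  rewrite /ball_integral /area_integral.
  have -> : (fun y : 'rV[R]_(1 + m) => @polar R g n m.+1 S (y 0 0) (rsubmx y)) =
      (fun y : 'rV[R]_(1 + m) => polar_map E (gcos g (y 0 0)) (gsin g (y 0 0)) (sph (rsubmx y))).
    by apply/funext => y; exact: polar_sph.
  apply: (etrans (@box_integralS R m _ _ _ _ _)).
  apply: eq_seg_int => t tr; rewrite /h -box_integralZ; last 2 first.
  - by move=> i; rewrite !mxE pi_ge0.
  - apply: ctsM; last exact: sph_weight_cts.
    by apply: (cts_comp _ (cPt t)); exact: sph_cts.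
  apply: eq_box_integral => th _.
  have l0 : (row_mx t%:M th : 'rV[R]_(1 + m)) 0 0 = t.
    by rewrite mxE; case: splitP => // j _; rewrite mxE ord1 mulr1n.
  rewrite ball_density // polar_sph l0 row_mxKr fP ?dot_sph //; ring.
have mr : - r <= 0 by rewrite oppr_le0 ltW.
rewrite (seg_int_split mr (ltW r0) ch).
have := seg_int_reflect 0 (ltW r0) ch; rewrite sub0r subr0 => <-.
have chN : continuous (fun t => h (0 - t)).
  by apply: (cts_comp _ ch); apply: ctsD; [exact: ctsC|exact: ctsN (@ctsI _)].
rewrite -seg_intD //; apply: eq_seg_int => t /andP[t0 tr].
have s0 : 0 <= gsin g t.
  move: t0; rewrite le_eqVlt => /predU1P[<-|t0]; first by rewrite gsin0.
  by rewrite ltW // (gsin_gt0 rA).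
rewrite /h sub0r gsinN normrN (ger0_norm s0) -mulrDr addrC; congr (_ * _).
rewrite -hemisphere_sphere_int //; congr (_ + hemisphere_int _).
by apply/funext => w; rewrite -[LHS]PN opprK.
Qed.

Lemma sphere_integralE (r : R) (f : 'rV[R]_n.+1 -> R) (Phi : 'rV[R]_m.+1 -> R) :
  admissible g r -> continuous Phi ->
  (forall w, dot w w = 1 -> f (polar_map E (gcos g r) (gsin g r) w) = Phi w) ->
  sphere_integral g m.+1 r S f = gsin g r ^+ m * sphere_int Phi.
Proof.
move=> rA cP fP; have r0 : 0 < r by case: rA.
have s0 : 0 < gsin g r by exact: gsin_gt0 rA _ _.
have H (a : R) (Psi : 'rV[R]_m.+1 -> R) : continuous Psi ->
    (forall w, dot w w = 1 -> f (polar_map E (gcos g a) (gsin g a) w) = Psi w) ->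
    area_integral g (const_mx 0) (const_mx pi) (@polar R g n m.+1 S a) f =
    `|gsin g a| ^+ m * hemisphere_int Psi.
  move=> cPsi fPsi; rewrite /area_integral -box_integralZ; last 2 first.
  - by move=> i; rewrite !mxE pi_ge0.
  - apply: ctsM; last exact: sph_weight_cts.
    by apply: (cts_comp _ cPsi); exact: sph_cts.
  apply: eq_box_integral => th _.
  rewrite (_ : @polar R g n m.+1 S a = fun th => polar_map E (gcos g a) (gsin g a) (sph th)); last first.
    by apply/funext => y; exact: polar_sph.
  by rewrite sphere_density // fPsi ?dot_sph //; ring.
have cN : continuous (fun w : 'rV[R]_m.+1 => Phi (- w)).
  by apply: (cts_comp _ cP); exact: ctsN (@ctsI _).
rewrite /sphere_integral (H r Phi) // (H (- r) (fun w => Phi (- w))) //.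
  by rewrite gsinN normrN (ger0_norm (ltW s0)) -mulrDr hemisphere_sphere_int.
move=> w w1; rewrite gcosN gsinN polar_mapNN fP //.
by rewrite -scaleN1r dotZl dotZr w1; ring.
Qed.

End PolarIntegrals.

(** * Distance to the pole *)

Section Garcsin.
Context {R : realType} (g : space_form).
Local Notation kap := (kappa g : R).

(** The inverse of [gsin]; the logarithm is the area hyperbolic sine. Applied to the component of a
    point in a unit direction orthogonal to the pole, it bounds the distance to the pole from
    below. *)
Definition garcsin (s : R) : R :=
  if g is Spherical then asin s else ln (s + Num.sqrt (1 + s ^+ 2)).

Lemma sqr_lt1 (s : R) : s ^+ 2 < 1 -> -1 < s < 1.
Proof. by move=> s1; apply/andP; split; nra. Qed.

Let hyp_gt0 (s : R) : 0 < s + Num.sqrt (1 + s ^+ 2).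
Proof.
have h0 : 0 <= 1 + s ^+ 2 by rewrite addr_ge0 // sqr_ge0.
have h1 := sqr_sqrtr h0; have h2 := sqrtr_ge0 (1 + s ^+ 2).
by nra.
Qed.

Lemma gsin_garcsin s : 0 < 1 - kap * s ^+ 2 -> gsin g (garcsin s) = s.
Proof.
rewrite /kappa /gsin /garcsin; case: g => h.
  by rewrite asinK // in_itv /=; have /andP[] : -1 < s < 1 by [apply: sqr_lt1; lra]; lra.
have h0 : 0 <= 1 + s ^+ 2 by rewrite addr_ge0 // sqr_ge0.
have h1 := sqr_sqrtr h0; have p := hyp_gt0 s.
rewrite /sinh expRN lnK //; set q := Num.sqrt _ in h1 p *.
have -> : (s + q)^-1 = q - s.
  apply: (mulfI (lt0r_neq0 p)); rewrite mulfV ?lt0r_neq0 //.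
  by rewrite (_ : (s + q) * (q - s) = q ^+ 2 - s ^+ 2); [rewrite h1|]; ring.
by field.
Qed.

Lemma garcsin_ge0 s : 0 < 1 - kap * s ^+ 2 -> 0 <= s -> 0 <= garcsin s.
Proof.
move=> h s0.
have := gsin_garcsin h; rewrite /gsin /garcsin; move: h; rewrite /kappa; case: g => h.
  have s1 : -1 < s < 1 by apply: sqr_lt1; lra.
  have [|/andP[a b] _] := @asin_def R s; first by lra.
  move=> sE; rewrite leNgt; apply/negP => an.
  have : 0 < sin (- asin s).
    apply: sin_gt0_pi; apply/andP; split; first by lra.
    by have := @pi_gt0 R; lra.
  by rewrite sinN sE; lra.
move=> _; rewrite ln_ge0 //.
have h0 : 0 <= 1 + s ^+ 2 by rewrite addr_ge0 // sqr_ge0.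
have h1 := sqr_sqrtr h0; have h2 := sqrtr_ge0 (1 + s ^+ 2).
by nra.
Qed.

Lemma garcsin_lt s : 0 < 1 - kap * s ^+ 2 -> g = Spherical -> garcsin s < pi / 2.
Proof.
rewrite /kappa /garcsin; case: g => // h _.
apply: asin_ltpi2; have /andP[] : -1 < s < 1 by apply: sqr_lt1; lra.
by lra.
Qed.

Lemma gcos_garcsin s : 0 < 1 - kap * s ^+ 2 -> gcos g (garcsin s) = Num.sqrt (1 - kap * s ^+ 2).
Proof.
move=> h; have sE := gsin_garcsin h.
have c2 := gcos2gsin2 g (garcsin s).
have c0 : 0 <= gcos g (garcsin s).
  move: h {sE c2}; rewrite /kappa /gcos /garcsin; case: g => h.
    have s1 : -1 < s < 1 by apply: sqr_lt1; lra.
    by rewrite cos_asin ?sqrtr_ge0 //; lra.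
  by rewrite /cosh divr_ge0 // addr_ge0 // expR_ge0.
rewrite sE in c2; have -> : 1 - kap * s ^+ 2 = gcos g (garcsin s) ^+ 2 by lra.
by rewrite sqrtr_sqr ger0_norm.
Qed.

Lemma garcsin_deriv s : 0 < 1 - kap * s ^+ 2 ->
  is_derive s 1 garcsin (Num.sqrt (1 - kap * s ^+ 2))^-1.
Proof.
rewrite /kappa /garcsin; case: g => h.
  by rewrite mul1r; apply: is_derive1_asin; apply: sqr_lt1; lra.
have E : 1 - -1 * s ^+ 2 = 1 + s ^+ 2 by ring.
rewrite E in h *.
have p := hyp_gt0 s; have q0 : 0 < Num.sqrt (1 + s ^+ 2) by rewrite sqrtr_gt0.
have d1 := der1X 2 (der1I s).
have d2 := @der1_comp _ Num.sqrt (fun s => 1 + s ^+ 2) s _ _ (is_derive1_sqrt h) (der1D (der1C (1 : R) s) d1).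
have d3 := @der1_comp _ (@ln R) (fun s => s + Num.sqrt (1 + s ^+ 2)) s _ _ (is_derive1_ln p) (der1D (der1I s) d2).
apply: (is_derive_eq d3); rewrite /= expr1.
by field; rewrite !lt0r_neq0.
Qed.

(** The factor [kap] unites the decreasing [cos] and the increasing [cosh]: in both geometries the
    derivative of [kap * gcos] is [- gsin]. *)
Lemma kgcos_decr a b : admissible g b -> 0 <= a -> a < b -> kap * gcos g b < kap * gcos g a.
Proof.
move=> bA a0 ab.
have dk (t : R) : is_derive t 1 (fun t => kap * gcos g t) (- gsin g t).
  apply: (is_derive_eq (der1Z kap (dgcos g t))).
  by rewrite mulrN mulrA -expr2 kappa_sqr mul1r.
have [|x] := @MVT R (fun t => kap * gcos g t) (fun t => - gsin g t) a b ab.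
- by apply: derivable_within_continuous => x _; have [] := dk x.
- rewrite in_itv /= => /andP[ax xb] E.
  have : 0 < gsin g x by apply: (gsin_gt0 bA); lra.
  by move=> sx; rewrite -subr_lt0 E mulNr oppr_lt0 mulr_gt0 // subr_gt0.
Qed.

Lemma kgcos_le a b : admissible g b -> 0 <= a -> (g = Spherical -> a < pi / 2) ->
  (kap * gcos g b <= kap * gcos g a) = (a <= b).
Proof.
move=> bA a0 ap; apply/idP/idP => h.
  rewrite leNgt; apply/negP => ba.
  have : kap * gcos g a < kap * gcos g b.
    by apply: kgcos_decr => //; [split => //; case: bA => b0 _; lra|case: bA => /ltW].
  by lra.
move: h; rewrite le_eqVlt => /predU1P[-> //|ab].
by rewrite ltW // kgcos_decr.
Qed.

End Garcsin.

(** * Vectors tangent to the space form and lengths of curves *)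

Section AmbientGeometry.
Context {R : realType} (g : space_form) {n : nat}.
Local Notation V := 'rV[R]_n.+1.
Local Notation kap := (kappa g : R).
Implicit Types p v w x : V.

Lemma discriminant_le (a b c : R) : 0 <= c ->
  (forall l, 0 <= a - 2 * l * b + l ^+ 2 * c) -> b ^+ 2 <= a * c.
Proof.
move=> c0 H; move: c0; rewrite le_eqVlt => /predU1P[c0|c0].
  have [->|b0] := eqVneq b 0; first by rewrite expr0n -c0 mulr0.
  (* With [c = 0] the expression is affine in [l]; this [l] would give it the value -1. *)
  have := H ((a + 1) / (2 * b)); rewrite -c0 mulr0 addr0.
  rewrite (_ : 2 * _ * b = a + 1); first by lra.
  by field.
have := H (b / c); rewrite (_ : a - _ + _ = (a * c - b ^+ 2) / c).
  by rewrite pmulr_lge0 ?invr_gt0 // subr_ge0.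
by field; rewrite lt0r_neq0.
Qed.

Lemma dot_ge0 d (x : 'rV[R]_d) : 0 <= dot x x.
Proof. by apply: sumr_ge0 => i _; rewrite -expr2 sqr_ge0. Qed.

Lemma dot_eq0 d (x : 'rV[R]_d) : dot x x = 0 -> x = 0.
Proof.
move=> /eqP; rewrite psumr_eq0; last by move=> i _; rewrite -expr2 sqr_ge0.
move=> /allP H; apply/rowP => i; rewrite mxE.
by have := H i (mem_index_enum i); rewrite /= mulf_eq0 orbb => /eqP.
Qed.

Lemma dot_CS d (x y : 'rV[R]_d) : dot x y ^+ 2 <= dot x x * dot y y.
Proof.
apply: discriminant_le => [|l]; first exact: dot_ge0.
have := dot_ge0 (x - l *: y).
have -> : dot (x - l *: y) (x - l *: y) = dot x x - 2 * l * dot x y + l ^+ 2 * dot y y.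
  rewrite -scaleNr dotDr !(dotC (_ + _)) !dotDr !dotZr !dotZl (dotC y x); ring.
by [].
Qed.

Lemma kapP : kap = 1 \/ kap = -1.
Proof. by rewrite /kappa; case: g; [left|right]. Qed.

(** In the hyperbolic case vectors orthogonal to a timelike vector are spacelike: orthogonality
    gives the Euclidean product of the horizontal parts as [p 0 0 * v 0 0], and Cauchy-Schwarz
    together with [|y|^2 = p 0 0 ^+ 2 - 1] does the rest. *)
Lemma ambient_perp_ge0 p v : ambient g p -> form g p v = 0 -> 0 <= form g v v.
Proof.
case; rewrite /sqnorm !formE => pk p0.
have h1 := dot_ge0 (rgrad v); have h2 := dot_ge0 (rgrad p).
have h3 := dot_CS (rgrad p) (rgrad v).
case: kapP => kE; rewrite kE in pk *; first by move=> _; nra.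
set y2 := dot (rgrad p) (rgrad p) in pk h2 h3 *.
set v2 := dot (rgrad v) (rgrad v) in h1 h3 *.
set b := dot _ _ in h3 *; move=> E.
have bE : b = p 0 0 * v 0 0 by lra.
have yE : y2 = p 0 0 ^+ 2 - 1 by lra.
rewrite bE yE in h3.
have p2 : 0 < p 0 0 ^+ 2 by rewrite exprn_gt0.
have : 0 <= (p 0 0 ^+ 2) * (v2 - v 0 0 ^+ 2) by nra.
by rewrite pmulr_rge0 //; lra.
Qed.

Lemma ambient_perp_CS p v w : ambient g p -> form g p v = 0 -> form g p w = 0 ->
  form g v w ^+ 2 <= form g v v * form g w w.
Proof.
move=> pA pv pw; apply: discriminant_le => [|l]; first exact: ambient_perp_ge0 pw.
have := @ambient_perp_ge0 p (v - l *: w) pA.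
rewrite formBr formZr pv pw mulr0 subr0 => /(_ erefl).
by rewrite formBr !formBl !formZr !formZl (formC g w v); lra.
Qed.

Lemma form_deriv (c : R -> V) (t : R) c' (d : R -> V) d' :
  is_derive t 1 c c' -> is_derive t 1 d d' ->
  is_derive t 1 (fun s => form g (c s) (d s)) (form g c' (d t) + form g (c t) d').
Proof.
move=> dc dd.
have dr (e : R -> V) e' : is_derive t 1 e e' -> is_derive t 1 (fun s => rgrad (e s)) (rgrad e').
  move=> de; apply: deriv_mx => i j; rewrite mxE; under eq_fun do rewrite mxE.
  exact: deriv_coord.
have ddot : is_derive t 1 (fun s => dot (rgrad (c s)) (rgrad (d s)))
    (dot (rgrad c') (rgrad (d t)) + dot (rgrad (c t)) (rgrad d')).
  rewrite /dot -big_split.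
  have -> : (fun s => \sum_i rgrad (c s) 0 i * rgrad (d s) 0 i) =
      (\sum_i (fun s => rgrad (c s) 0 i * rgrad (d s) 0 i)).
    by apply/funext => s; rewrite fct_sumE.
  apply: is_derive_sum => i.
  exact: der1M (deriv_coord 0 i (dr _ _ dc)) (deriv_coord 0 i (dr _ _ dd)).
rewrite (_ : (fun s => form g (c s) (d s)) =
  (fun s => kap * c s 0 0 * d s 0 0 + dot (rgrad (c s)) (rgrad (d s)))); last first.
  by apply/funext => s; rewrite formE.
apply: (is_derive_eq (der1D (der1M (der1Z kap (deriv_coord 0 0 dc)) (deriv_coord 0 0 dd)) ddot)).
by rewrite !formE; ring.
Qed.

Lemma form_cts (X : topologicalType) (c d : X -> V) : continuous c -> continuous d ->
  continuous (fun s => form g (c s) (d s)).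
Proof.
move=> cc cd; under [F in continuous F]eq_fun do rewrite formE.
apply: ctsD; last first.
  by apply: dot_cts; [exact: (cts_comp cc (@rgrad_cts R n))|exact: (cts_comp cd (@rgrad_cts R n))].
apply: ctsM; last exact: (cts_comp cd (@cts_coord _ _ _ 0 0)).
by apply: ctsM; [exact: ctsC|exact: (cts_comp cc (@cts_coord _ _ _ 0 0))].
Qed.

Lemma ambient_velocity (c : R -> V) (t : R) c' : is_derive t 1 c c' ->
  (\forall s \near t, ambient g (c s)) -> form g (c t) c' = 0.
Proof.
move=> dc cA.
have h1 := form_deriv dc dc.
have h2 : is_derive t 1 (fun s => form g (c s) (c s)) 0.
  apply: (near_eq_is_derive _ (der1C kap t)); last by near=> s; have [] : ambient g (c s) by near: s.
have := @derive_val _ _ _ _ _ _ _ h1; rewrite (@derive_val _ _ _ _ _ _ _ h2) (formC g c').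
by lra.
Unshelve. all: by end_near. Qed.

(** Keeps the argument of [garcsin] where it is differentiable; on the sphere this is the strict
    inequality [0 < p 0 0] defining the open hemisphere. *)
Lemma perp_domain p w : ambient g p -> form g pole w = 0 -> form g w w = 1 ->
  0 < 1 - kap * form g p w ^+ 2.
Proof.
move=> [pk p0]; rewrite form_pole => /eqP; rewrite mulf_eq0 => /orP[/eqP k0|/eqP w0].
  by case: kapP => kE; move: k0; rewrite kE; lra.
move: pk; rewrite /sqnorm !formE w0 !mulr0 !add0r => pk w1.
case: kapP => kE; rewrite kE in pk *; last by have := sqr_ge0 (dot (rgrad p) (rgrad w)); lra.
have := dot_CS (rgrad p) (rgrad w); rewrite w1 mulr1.
have : 0 < p 0 0 ^+ 2 by rewrite exprn_gt0.
by lra.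
Qed.

(* [garcsin (form (c t) w)] grows at most at unit speed: Cauchy-Schwarz with the
   component of [w] tangent to [ambient] at [c t]. *)
Lemma length_ge (c : R -> V) w (q : V) : C1_curve c -> c 0 = pole -> c 1 = q ->
  (forall t, 0 <= t <= 1 -> ambient g (c t)) ->
  form g pole w = 0 -> form g w w = 1 ->
  garcsin g (form g q w) <= seg_int 0 1 (fun t => Num.sqrt (sqnorm g (derive1 c t))).
Proof.
move=> [dc cc'] c0 c1 cA pw w1.
have dcE (t : R) : is_derive t 1 c (derive1 c t) by rewrite derive1E; exact: derivableP.
have dW (t : R) : is_derive t 1 (fun s => form g (c s) w) (form g (derive1 c t) w).
  by apply: (is_derive_eq (form_deriv (dcE t) (der1C w t))); rewrite form0r addr0.
have dom t : 0 <= t <= 1 -> 0 < 1 - kap * form g (c t) w ^+ 2.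
  by move=> /cA cAt; exact: perp_domain.
pose z t := (Num.sqrt (1 - kap * form g (c t) w ^+ 2))^-1 * form g (derive1 c t) w.
have dZ (t : R) : 0 <= t <= 1 -> is_derive t 1 (fun s => garcsin g (form g (c s) w)) (z t).
  move=> t01; exact: (@der1_comp _ (garcsin g) (fun s => form g (c s) w) t _ _ (garcsin_deriv (dom t t01)) (dW t)).
have csp : continuous (fun t => Num.sqrt (sqnorm g (derive1 c t))).
  by apply: (cts_comp _ (@sqrt_continuous R)); exact: form_cts.
have zz : garcsin g (form g (c 0) w) = 0.
  have h : 0 < 1 - kap * (0 : R) ^+ 2 by rewrite expr0n mulr0 subr0.
  rewrite c0 pw; apply/eqP; rewrite eq_le garcsin_ge0 // andbT.
  rewrite /garcsin; case: g; last by rewrite expr0n addr0 sqrtr1 add0r ln1.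
  by rewrite -{1}sin0 sinK // in_itv /=; have := @pi_gt0 R; lra.
rewrite -[leLHS]subr0 -{1}zz -c1.
apply: (seg_int_ge (Z := fun t => garcsin g (form g (c t) w)) (z := z)) => //.
- by move=> t /andP[t0 t1]; apply: dZ; rewrite !ltW.
- move=> t /andP[t0 t1]; have t01 : 0 <= t <= 1 by rewrite !ltW.
  have d0 := dom t t01.
  have vp : form g (c t) (derive1 c t) = 0.
    apply: ambient_velocity => //.
    have tI : t \in `]0, 1[ by rewrite in_itv /= t0.
    have := near_in_itvoo tI; apply: filterS => s; rewrite in_itv /= => /andP[s0 s1].
    by apply: cA; rewrite !ltW.
  have cAt := cA t t01; have [ck _] := cAt; have k2 := @kappa_sqr R g.
  set W := form g (c t) w in d0 *; set v := derive1 c t in vp *.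
  (* [N] is the component of [w] tangent at [c t]; its squared norm [1 - kap * W ^+ 2] is the
     quantity under the root in the derivative of [garcsin]. *)
  pose N := w - (kap * W) *: c t.
  have pN : form g (c t) N = 0.
    by rewrite formBr formZr -/W -/(sqnorm g (c t)) ck; ring: k2.
  have vN : form g v N = form g v w.
    by rewrite formBr formZr (formC g v (c t)) vp mulr0 subr0.
  have NN : form g N N = 1 - kap * W ^+ 2.
    rewrite {1}/N formBl formZl pN mulr0 subr0 formBr formZr w1 (formC g w) -/W.
    by ring.
  have := ambient_perp_CS cAt vp pN; rewrite vN NN => CS.
  have vv : 0 <= form g v v by exact: ambient_perp_ge0 vp.
  rewrite /z -/W -/v mulrC ler_pdivrMr ?sqrtr_gt0 // -sqrtrM //.
  by apply: (le_trans (ler_norm _)); rewrite -sqrtr_sqr ler_wsqrtr.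
- have h : (0 : R) <= (0 : R) <= (1 : R) by rewrite lexx ler01.
  by apply: cvg_at_right_filter; exact: deriv_cts (dZ 0 h).
- have h : (0 : R) <= (1 : R) <= (1 : R) by rewrite lexx ler01.
  by apply: cvg_at_left_filter; exact: deriv_cts (dZ 1 h).
Qed.

End AmbientGeometry.

(** * Distance from the pole along geodesics *)

Section DistancePole.
Context {R : realType} (g : space_form) {n : nat}.
Local Notation V := 'rV[R]_n.+1.
Local Notation kap := (kappa g : R).
Local Notation gc := (@gcos R g).
Local Notation gs := (@gsin R g).
Implicit Types p v w x : V.

Lemma rgradD x v : rgrad (x + v) = rgrad x + rgrad v.
Proof. by rewrite /rgrad linearD. Qed.

Lemma rgradZ a x : rgrad (a *: x) = a *: rgrad x.
Proof. by rewrite /rgrad linearZ. Qed.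

Lemma rgrad_pole : rgrad (pole : V) = 0.
Proof. by apply/rowP => i; rewrite !mxE. Qed.

(** The direction [w] follows the horizontal part of [x], which makes the lower bound of [length_ge]
    equal to [rho]. The second alternative is the pole, which has no direction. *)
Lemma ambient_polar x : ambient g x -> exists rho w,
  [/\ 0 <= rho, (g = Spherical -> rho < pi / 2), x = gc rho *: pole + gs rho *: w,
      form g pole w = 0 &
      (form g w w = 1 /\ garcsin g (form g x w) = rho) \/ (rho = 0 /\ w = 0)].
Proof.
move=> xA; have [xk x0] := xA; move: xk; rewrite /sqnorm formE => xk.
have k2 := @kappa_sqr R g.
set y := rgrad x in xk; pose s := Num.sqrt (dot y y).
have s2 : s ^+ 2 = dot y y by rewrite sqr_sqrtr // dot_ge0.
have xE : 1 - kap * s ^+ 2 = x 0 0 ^+ 2.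
  have -> : s ^+ 2 = kap - kap * x 0 0 * x 0 0 by rewrite s2 -[X in X - _]xk; ring.
  by ring: k2.
have dom : 0 < 1 - kap * s ^+ 2 by rewrite xE exprn_gt0.
have s0 : 0 <= s := sqrtr_ge0 _.
(* At the pole [s = 0], hence [s^-1 = 0] and [w = 0]. *)
pose w : V := polar_point 0 s^-1 y.
have w0 : w 0 0 = 0 by exact: polar_point0.
have wr : rgrad w = s^-1 *: y by exact: row_mxKr.
have ww : form g w w = s^-1 * s^-1 * dot y y.
  by rewrite formE w0 wr dotZl dotZr; ring.
have xpw : x = gc (garcsin g s) *: pole + gs (garcsin g s) *: w.
  rewrite gcos_garcsin // gsin_garcsin // xE sqrtr_sqr gtr0_norm //.
  rewrite [LHS]row_mx_rgrad [RHS]row_mx_rgrad.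
  rewrite [X in row_mx X%:M _ = _](_ : _ = (x 0 0 *: (pole : V) + s *: w) 0 0); last first.
    by rewrite mxE [in RHS]mxE [X in _ = _ + X]mxE w0 pole00; ring.
  congr (row_mx _ _); rewrite rgradD !rgradZ wr rgrad_pole.
  rewrite scaler0 add0r scalerA -/y.
  have [s00|sn0] := eqVneq s 0; last by rewrite divff // scale1r.
  by rewrite s00 mul0r scale0r; apply: dot_eq0; rewrite -s2 s00 expr0n.
exists (garcsin g s), w; split => //.
- exact: garcsin_ge0.
- exact: garcsin_lt.
- by rewrite form_pole w0 mulr0.
- have [s00|sn0] := eqVneq s 0.
    right; split; last first.
      rewrite /w /polar_point s00 invr0 scale0r.
      by apply/rowP => i; rewrite !mxE; case: splitP => j _; rewrite !mxE ?mul0rn.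
    apply/eqP; rewrite eq_le garcsin_ge0 // andbT s00.
    rewrite /garcsin; case: g; last by rewrite expr0n addr0 sqrtr1 add0r ln1.
    by rewrite -{1}sin0 sinK // in_itv /=; have := @pi_gt0 R; lra.
  have w1 : form g w w = 1 by rewrite ww -s2; field.
  left; split => //; congr garcsin.
  rewrite xpw formDl !formZl form_pole w0 w1 gsin_garcsin //; ring.
Qed.

(** The geodesic run at constant speed [rho] attains the lower bound of [length_ge]. *)
Lemma geodesic_length rho w : 0 <= rho -> (g = Spherical -> rho < pi / 2) ->
  form g pole w = 0 -> form g w w = 1 \/ (rho = 0 /\ w = 0) ->
  exists c : R -> V, [/\ C1_curve c, c 0 = pole, c 1 = gc rho *: pole + gs rho *: w,
    (forall t, 0 <= t <= 1 -> ambient g (c t)) &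
    rho = seg_int 0 1 (fun t => Num.sqrt (sqnorm g (derive1 c t)))].
Proof.
move=> rho0 rhop pw wc; have k2 := @kappa_sqr R g.
have gsw t : gs (t * rho) * gs (t * rho) * form g w w = gs (t * rho) ^+ 2.
  by case: wc => [->|[-> ->]]; rewrite ?mulr0 ?gsin0; ring.
pose c (t : R) := gc (t * rho) *: pole + gs (t * rho) *: w : V.
pose c' (t : R) := rho *: (- (kap * gs (t * rho)) *: pole + gc (t * rho) *: w) : V.
have dc (t : R) : is_derive t 1 c (c' t).
  have dr : is_derive t 1 (fun t => t * rho) rho.
    by apply: (is_derive_eq (der1M (der1I t) (der1C rho t))); ring.
  have h1 := deriv_scale_vec (@der1_comp _ gc (fun t => t * rho) t _ _ (dgcos g (t * rho)) dr) (der1C (pole : V) t).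
  have h2 := deriv_scale_vec (@der1_comp _ gs (fun t => t * rho) t _ _ (dgsin g (t * rho)) dr) (der1C w t).
  apply: (is_derive_eq (is_deriveD h1 h2)).
  by rewrite !scaler0 !addr0 /c' scalerDr !scalerA ![_ * rho]mulrC.
have c'E : derive1 c = c'.
  by apply/funext => t; rewrite derive1E; exact: (@derive_val _ _ _ _ _ _ _ (dc t)).
have ctr : continuous (fun t : R => t * rho) by apply: ctsM; [exact: ctsI|exact: ctsC].
have cgs : continuous (fun t : R => gs (t * rho)).
  by apply: (cts_comp ctr) => x; exact: deriv_cts (dgsin g x).
have cgc : continuous (fun t : R => gc (t * rho)).
  by apply: (cts_comp ctr) => x; exact: deriv_cts (dgcos g x).
exists c; split.
- split; first by move=> t; have [] := dc t.
  rewrite c'E; apply: ctsZ; first exact: ctsC.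
  apply: ctsD; apply: ctsZ => //; try exact: ctsC.
  by apply: ctsN; apply: ctsM => //; exact: ctsC.
- by rewrite /c mul0r gcos0 gsin0 scale1r scale0r addr0.
- by rewrite /c mul1r.
- move=> t /andP[t0 t1]; split.
    rewrite /sqnorm /c formDD !formZl !formZr pw (formC g w) pw form_pole pole00.
    have := gcos2gsin2 g (t * rho); have := gsw t; move=> h1 h2.
    rewrite (_ : _ + _ = kap * gc (t * rho) ^+ 2 + gs (t * rho) * gs (t * rho) * form g w w); last by ring.
    by rewrite h1 -[RHS]mulr1 -h2; ring: k2.
  have w0 : w 0 0 = 0.
    move: pw => /eqP; rewrite form_pole mulf_eq0 => /orP[/eqP k0|/eqP //].
    by move: k2; rewrite k0 expr0n => /eqP; rewrite eq_sym oner_eq0.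
  rewrite /c mxE [X in X + _]mxE [X in _ + X]mxE w0 mulr0 addr0 pole00 mulr1.
  have [r00|r00] := eqVneq rho 0; first by rewrite r00 mulr0 gcos0.
  have rA : admissible g rho by split => //; rewrite lt0r r00.
  by apply: (gcos_gt0 rA); nra.
- rewrite (@eq_seg_int _ _ (fun=> rho)); last first.
    move=> t _; rewrite c'E /sqnorm /c' formZl formZr formDD !formZl !formZr.
    rewrite pw (formC g w) pw form_pole pole00.
    have h2 := gcos2gsin2 g (t * rho).
    have -> : forall a : R, rho * (rho * a) = rho ^+ 2 * a by move=> a; ring.
    have -> : rho ^+ 2 * (- (kap * gs (t * rho)) * (- (kap * gs (t * rho)) * (kap * 1)) +
       - (kap * gs (t * rho)) * (gc (t * rho) * 0) + (gc (t * rho) * (- (kap * gs (t * rho)) * 0) +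
       gc (t * rho) * (gc (t * rho) * form g w w))) = rho ^+ 2.
      case: wc => [->|[-> _]]; last by rewrite expr0n !mul0r.
      by rewrite !mulr1 -[RHS]mulr1 -h2; ring: k2.
    by rewrite sqrtr_sqr ger0_norm.
  by rewrite seg_int_cst ?ler01 // subr0 mulr1.
Qed.

Lemma dist_pole x : ambient g x -> exists rho,
  [/\ 0 <= rho, (g = Spherical -> rho < pi / 2), x 0 0 = gc rho & dist g pole x = rho].
Proof.
move=> xA; have [rho [w [rho0 rhop xE pw wc]]] := ambient_polar xA.
exists rho; split => //.
  have w0 : w 0 0 = 0.
    move: pw => /eqP; rewrite form_pole mulf_eq0 => /orP[/eqP k0|/eqP //].
    by have := @kappa_sqr R g; rewrite k0 expr0n => /eqP; rewrite eq_sym oner_eq0.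
  by rewrite xE mxE [X in X + _]mxE [X in _ + X]mxE w0 mulr0 addr0 pole00 mulr1.
have lb L : (exists c : R -> V, [/\ C1_curve c, c 0 = pole, c 1 = x,
    (forall t, 0 <= t <= 1 -> ambient g (c t)) &
    L = seg_int 0 1 (fun t => Num.sqrt (sqnorm g (derive1 c t)))]) -> rho <= L.
  move=> [c [cC c0 c1 cA ->]]; case: wc => [[w1 <-]|[-> _]].
    exact: length_ge.
  by apply: seg_int_ge0 => t _; exact: sqrtr_ge0.
have [|c [cC c0 c1 cA cL]] := geodesic_length rho0 rhop pw.
  by case: wc => [[]|]; [left|right].
apply/eqP; rewrite eq_le; apply/andP; split.
  apply: ge_inf; first by exists rho => L; exact: lb.
  by exists c; split => //; rewrite xE.
apply: lb_le_inf; last by move=> L; exact: lb.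
by exists rho; exists c; split => //; rewrite xE.
Qed.

(** Replaces the infimum over curves by a linear inequality on the height, from which tangent cones
    can be read off. *)
Lemma geodesic_ballE (r : R) x : admissible g r ->
  geodesic_ball g r x <-> ambient g x /\ kap * gc r <= kap * x 0 0.
Proof.
move=> rA; split=> -[xA]; have [rho [rho0 rhop xE dE]] := dist_pole xA.
  by rewrite dE => rr; split=> //; rewrite xE kgcos_le.
by rewrite xE kgcos_le // => rr; split=> //; rewrite dE.
Qed.

End DistancePole.

(** * Tangent and normal spaces of the geodesic ball *)

Section CurvesAndSubspaces.
Context {R : realType} {n : nat}.
Local Notation V := 'rV[R]_n.+1.

(** A subspace as the zero set of a matrix: in this form membership passes to limits and to
    integrals. *)
Lemma vspace_kernel (U : {vspace V}) : exists A : 'M[R]_n.+1,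
  forall v, (v \in U) = (v *m A == 0).
Proof.
exists (lin1_mx (\1 - projv U)%VF) => v.
rewrite mul_rV_lin1 /= !lfunE /= opp_lfunE id_lfunE subr_eq0.
by apply/idP/eqP => [/projv_id -> //|->]; exact: memv_proj.
Qed.

Lemma kernel_vspace d (A : 'M[R]_(n.+1, d)) : exists U : {vspace V},
  forall v, (v \in U) = (v *m A == 0).
Proof. by exists (lker (linfun (mulmxr A))) => v; rewrite memv_ker lfunE. Qed.

Lemma mulmx_cts (A : 'M[R]_n.+1) : continuous (fun v : V => v *m A).
Proof.
apply: cts_mx => i j; under eq_fun do rewrite mxE; apply: cts_sum => l.
by apply: ctsM; [exact: cts_coord|exact: ctsC].
Qed.

Lemma vspace_closed (U : {vspace V}) (T : Type) (F : set_system T) (f : T -> V) v :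
  ProperFilter F -> (\forall t \near F, f t \in U) -> f @ F --> v -> v \in U.
Proof.
move=> FF fU fv; have [A UA] := vspace_kernel U; rewrite UA; apply/eqP.
have h1 : (fun t => f t *m A) @ F --> v *m A.
  by apply: (@cvg_comp _ _ _ f (fun v => v *m A) _ _ _ fv); exact: mulmx_cts.
have h2 : (fun t => f t *m A) @ F --> (0 : V).
  apply: cvg_near_cst; near=> t.
  by apply/eqP; rewrite -UA; near: t.
exact: (cvg_unique _ h1 h2).
Unshelve. all: by end_near. Qed.

Lemma deriv_right_quotient (c : R -> V) v : is_derive (0 : R) 1 c v ->
  (fun t => t^-1 *: (c t - c 0)) @ 0^'+ --> v.
Proof.
move=> [/cvg_ex[l cl] <-]; have -> : 'D_1 c 0 = l by exact: cvg_lim cl.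
have := cvg_dnbhs_at_right cl.
rewrite (_ : (fun h => _) = (fun t => t^-1 *: (c t - c 0))) //.
by apply/funext => t; rewrite /= addr0 [t%:A]mulr1.
Qed.

Lemma diff_curve (W : normedModType R) (F : V -> W) (c : R -> V) (t : R) v :
  differentiable F (c t) -> is_derive t 1 c v ->
  is_derive t 1 (fun s => F (c s)) ('D_v F (c t)).
Proof.
move=> dF [dc cv].
have dc' : differentiable c t by apply/derivable1_diffP.
have dFc : differentiable (F \o c) t by exact: differentiable_comp.
have : derivable (F \o c) t 1 by exact/derivable1_diffP.
move=> h; apply: (is_derive_eq (derivableP h)).
by rewrite (deriveE _ dFc) diff_comp //= -cv (deriveE _ dc') (deriveE _ dF).
Qed.

End CurvesAndSubspaces.

(** * Tangent spaces of the space form *)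

Section TangentSpaces.
Context {R : realType} (g : space_form) {n : nat}.
Local Notation V := 'rV[R]_n.+1.
Local Notation kap := (kappa g : R).
Local Notation gc := (@gcos R g).
Implicit Types p v w z : V.

(** The straight line [p + t *: v] scaled back to the quadric, for [v] tangent at [p]. It has
    velocity [v] at 0 and stays in every linear subspace containing [p] and [v]. *)
Definition normalized_line p v (t : R) : V :=
  (Num.sqrt (1 + kap * form g v v * t ^+ 2))^-1 *: (p + t *: v).

Lemma normalized_line0 p v : normalized_line p v 0 = p.
Proof. by rewrite /normalized_line expr0n mulr0 addr0 sqrtr1 invr1 scale1r scale0r addr0. Qed.

Lemma normalized_line_deriv p v : is_derive (0 : R) 1 (normalized_line p v) v.
Proof.
pose q t : R := 1 + kap * form g v v * t ^+ 2.
have q0 : q 0 = 1 by rewrite /q expr0n mulr0 addr0.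
have dq : is_derive (0 : R) 1 q 0.
  apply: (is_derive_eq (der1D (der1C (1 : R) 0) (der1Z (kap * form g v v) (der1X 2 (der1I 0))))).
  by rewrite /= expr1; ring.
have q1 : 0 < q 0 by rewrite q0.
have ds := @der1_comp _ Num.sqrt q 0 _ _ (is_derive1_sqrt q1) dq.
have s0 : Num.sqrt (q 0) != 0 by rewrite q0 sqrtr1 oner_eq0.
have di := der1V ds s0.
apply: (is_derive_eq (deriv_scale_vec di (line_deriv p v))).
by rewrite mulr0 oppr0 mul0r scale0r add0r q0 sqrtr1 invr1 scale1r.
Qed.

Lemma near0_at_right (P : set R) : (\forall t \near (0 : R), P t) -> \forall t \near 0^'+, P t.
Proof. by move=> H; exact: (@cvg_within _ (nbhs (0 : R)) _ _ P H). Qed.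

Lemma normalized_line_ambient p v : ambient g p -> form g p v = 0 ->
  \forall t \near (0 : R), ambient g (normalized_line p v t).
Proof.
move=> [pk p0] pv.
have h1 : \forall t \near (0 : R), 0 < 1 + kap * form g v v * t ^+ 2.
  have cq : continuous (fun t : R => 1 + kap * form g v v * t ^+ 2).
    apply: ctsD; first exact: ctsC.
    by apply: ctsM; [exact: ctsC|apply: ctsX; exact: ctsI].
  apply: (cvgr_gt _ (cq 0)); by rewrite expr0n mulr0 addr0.
have h2 : \forall t \near (0 : R), 0 < p 0 0 + t * v 0 0.
  have cq : continuous (fun t : R => p 0 0 + t * v 0 0).
    by apply: ctsD; [exact: ctsC|apply: ctsM; [exact: ctsI|exact: ctsC]].
  by apply: (cvgr_gt _ (cq 0)); rewrite mul0r addr0.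
near=> t.
have q0 : 0 < 1 + kap * form g v v * t ^+ 2 by near: t.
have x0 : 0 < p 0 0 + t * v 0 0 by near: t.
split; last by rewrite !mxE mulr_gt0 // invr_gt0 sqrtr_gt0.
rewrite /sqnorm /normalized_line formZl formZr formDD !formZl !formZr (formC g v p) pv.
have s2 := sqr_sqrtr (ltW q0); set s := Num.sqrt _ in s2 *.
have s0 : s != 0 by rewrite lt0r_neq0 // sqrtr_gt0.
move: pk; rewrite /sqnorm => ->; apply: (mulfI (expf_neq0 2 s0)).
transitivity (form g v v * t ^+ 2 + kap); first by field.
by rewrite s2; ring: (@kappa_sqr R g).
Unshelve. all: by end_near. Qed.

Lemma cone_of_curve (T : set V) (c : R -> V) p v : is_derive (0 : R) 1 c v -> c 0 = p ->
  (\forall t \near 0^'+, T (c t)) -> tangent_cone T p v.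
Proof. by move=> dc <- cT; exists c; split => //; exact: deriv_right_quotient. Qed.

Lemma perp_vspace p : exists U : {vspace V}, forall v, (v \in U) = (form g p v == 0).
Proof.
pose A : 'M[R]_(n.+1, 1) := \matrix_(i, j) form g p (delta_mx 0 i).
have AE w : w *m A = (form g p w)%:M.
  apply/matrixP => i j; rewrite !ord1 !mxE eqxx mulr1n {2}[w]row_sum_delta form_sumr.
  by apply: eq_bigr => l _; rewrite mxE formZr.
have [U UE] := kernel_vspace A.
exists U => w; rewrite UE AE.
apply/eqP/eqP => [/matrixP/(_ 0 0)|->]; first by rewrite !mxE eqxx mulr1n.
  by apply/matrixP => i j; rewrite !mxE mul0rn.
Qed.

Lemma tangent_ambient p v : ambient g p -> tangent_space (ambient g) p v <-> form g p v = 0.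
Proof.
move=> pA; split; last first.
  move=> pv U; apply; apply: (cone_of_curve (normalized_line_deriv p v) (normalized_line0 p v)).
  by apply: near0_at_right; exact: normalized_line_ambient.
have [U UE'] := perp_vspace p.
move=> /(_ U) H; apply/eqP; rewrite -UE'; apply: H => w [c [cA cw]]; rewrite UE'; apply/eqP.
pose q t := t^-1 *: (c t - p).
have cf : continuous (fun z => form g p z) by apply: form_cts; [exact: ctsC|exact: ctsI].
have cff : continuous (fun z : V => form g z z) by apply: form_cts; exact: ctsI.
have h1 : (fun t => form g p (q t)) @ 0^'+ --> form g p w.
  exact: (@cvg_comp _ _ _ q (fun z => form g p z) _ _ _ cw (cf w)).
have h2 : (fun t => form g (q t) (q t)) @ 0^'+ --> form g w w.
  exact: (@cvg_comp _ _ _ q (fun z => form g z z) _ _ _ cw (cff w)).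
have h3 : (fun t : R => t / 2) @ 0^'+ --> (0 : R).
  apply: cvg_at_right_filter; rewrite -[X in _ --> X](mul0r (2^-1 : R)).
  by apply: cvgM; [exact: cvg_id|exact: cvg_cst].
(* Expanding [sqnorm (c t) = sqnorm p] with [c t = p + t *: q t] makes this expression zero for
   small [t > 0]; a one-sided difference quotient is all that [c] offers. *)
have h4 : (fun t => form g p (q t) + t / 2 * form g (q t) (q t)) @ 0^'+ --> form g p w + 0 * form g w w.
  by apply: cvgD => //; exact: cvgM.
have h5 : (fun t => form g p (q t) + t / 2 * form g (q t) (q t)) @ 0^'+ --> (0 : R).
  apply: cvg_near_cst; near=> t.
  have t0 : t != 0 by rewrite lt0r_neq0 //; near: t; exact: nbhs_right_gt.
  have [ck _] : ambient g (c t) by near: t.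
  have [pk _] := pA; move: ck pk; rewrite /sqnorm => ck pk.
  rewrite /q !formZl !formZr !formBl !formBr ck pk (formC g (c t) p).
  by field.
have := cvg_unique _ h4 h5; rewrite mul0r addr0; apply.
Unshelve. all: by end_near. Qed.

End TangentSpaces.

(** * Tangent and normal spaces of the subball *)

Section SubballTangent.
Context {R : realType} (g : space_form) {n : nat} (r : R) (Pi : {vspace 'rV[R]_n.+1}).
Local Notation V := 'rV[R]_n.+1.
Local Notation kap := (kappa g : R).
Local Notation gc := (@gcos R g).
Hypothesis rA : admissible g r.
Hypothesis pPi : pole \in Pi.
Local Notation S := (geodesic_subball g r Pi).
Implicit Types p v w z : V.

Lemma subballE p : S p <-> [/\ ambient g p, kap * gc r <= kap * p 0 0 & p \in Pi].
Proof.
by split=> [[/(geodesic_ballE _ rA) [pA pr] pP]|[pA pr pP]]; split => //; apply/(geodesic_ballE _ rA).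
Qed.

Lemma pole_subball : S pole /\ kap * gc r < kap * (pole : V) 0 0.
Proof.
have lt : kap * gc r < kap * (pole : V) 0 0.
  by rewrite pole00 -(gcos0 g); apply: kgcos_decr => //; case: rA.
split=> //; apply/subballE; split => //; last exact: ltW.
by split; rewrite ?/sqnorm ?form_pole pole00 // mulr1.
Qed.

(** At a boundary point the vector must strictly raise [kap] times the height, so that a first order
    argument shows the curve entering the ball. Vectors tangent to the boundary are recovered as
    differences. *)
Definition inward p v := [/\ v \in Pi, form g p v = 0 &
  kap * gc r < kap * p 0 0 \/ 0 < kap * v 0 0].

Lemma inward_curve p v : S p -> inward p v ->
  \forall t \near 0^'+, S (normalized_line g p v t).
Proof.
move=> /subballE [pA pr pP] [vP pv inn].
have cA := near0_at_right (normalized_line_ambient pA pv).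
have dl := normalized_line_deriv g p v.
have hr : \forall t \near 0^'+, kap * gc r <= kap * normalized_line g p v t 0 0.
  case: inn => [lt|v0].
    have cc : {for 0, continuous (fun t => kap * normalized_line g p v t 0 0)}.
      by apply: (deriv_cts (der1Z kap (deriv_coord 0 0 dl))).
    apply: near0_at_right; near=> t; apply: ltW; near: t.
    by apply: (cvgr_gt _ cc); rewrite normalized_line0.
  have := deriv_right_quotient dl; rewrite normalized_line0 => qv.
  have cc : continuous (fun z : V => kap * z 0 0) by apply: ctsM; [exact: ctsC|exact: cts_coord].
  have := @cvg_comp _ _ _ _ (fun z : V => kap * z 0 0) _ _ _ qv (cc v).
  move=> /cvgr_gt /(_ _ v0) qpos; near=> t.
  have t0 : 0 < t by near: t; exact: nbhs_right_gt.
  have : 0 < kap * (t^-1 *: (normalized_line g p v t - p)) 0 0 by near: t.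
  rewrite 2!mxE [X in _ + X]mxE mulrCA pmulr_rgt0 ?invr_gt0 // mulrBr subr_gt0 => /ltW.
  exact: le_trans.
near=> t; apply/subballE; split; first by near: t.
  by near: t.
by rewrite memvZ // memvD // memvZ.
Unshelve. all: by end_near. Qed.

Lemma inward_cone p v : S p -> inward p v -> tangent_cone S p v.
Proof.
move=> pS vi; apply: (cone_of_curve (normalized_line_deriv g p v) (normalized_line0 g p v)).
exact: inward_curve.
Qed.

(** Extends to all of the tangent space what is linear and known for inward vectors: membership in
    the span of the cone, and directional derivatives. *)
Lemma inward_split p v : S p -> v \in Pi -> form g p v = 0 ->
  exists v1 v2, [/\ v = v1 - v2, inward p v1 & inward p v2].
Proof.
move=> /subballE [pA pr pP] vP pv; have [pk p0] := pA.
have k2 := @kappa_sqr R g.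
have [lt|ge] := ltP (kap * gc r) (kap * p 0 0).
  exists v, 0; split; rewrite ?subr0 //; split => //; try by left.
    exact: mem0v.
  exact: form0r.
(* The tangential part of the pole at [p], which points to the centre: [kap * e 0 0] is the squared
   horizontal part of [p], nonzero because a boundary point is not the pole. *)
pose e := pole - p 0 0 *: p.
have pe : form g p e = 0.
  by rewrite formBr formZr formC form_pole -/(sqnorm g p) pk; ring.
have e0 : 0 < kap * e 0 0.
  have -> : kap * e 0 0 = dot (rgrad p) (rgrad p).
    rewrite /e mxE pole00 mxE mxE; move: pk; rewrite /sqnorm formE; lra.
  rewrite lt0r dot_ge0 andbT; apply/eqP => y0.
  have [_ lt] := pole_subball; move: pk; rewrite /sqnorm formE y0 addr0 => pk.
  have : kap * (p 0 0 ^+ 2 - 1) = 0 by lra.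
  move=> /eqP; rewrite mulf_eq0 => /orP[/eqP kk|]; first by move: k2; rewrite kk expr0n => /eqP; rewrite eq_sym oner_eq0.
  rewrite subr_eq0 sqrf_eq1 => /orP[/eqP p1|/eqP p1]; last by move: p0; rewrite p1; lra.
  by move: ge; rewrite p1; move: lt; rewrite pole00; lra.
have eP : e \in Pi by rewrite memvB // memvZ.
(* Large enough for [e] to outweigh [v]; the [+ 1] makes the result strictly inward. *)
pose l := (`|kap * v 0 0| + 1) / (kap * e 0 0).
have l0 : 0 < l by rewrite divr_gt0 // ltr_wpDl.
exists (v + l *: e), (l *: e); split; first by rewrite addrK.
  split; first by rewrite memvD // memvZ.
    by rewrite formDr formZr pv pe mulr0 addr0.
  right; rewrite mxE [X in _ + X]mxE mulrDr mulrCA mulfVK ?lt0r_neq0 //.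
  by have := ler_norm (- (kap * v 0 0)); rewrite normrN; lra.
split; first by rewrite memvZ.
  by rewrite formZr pe mulr0.
by right; rewrite mxE mulrCA mulr_gt0.
Qed.

Lemma tangent_subball p v : S p -> tangent_space S p v <-> v \in Pi /\ form g p v = 0.
Proof.
move=> pS; have /subballE [pA pr pP] := pS; split; last first.
  move=> [vP pv] U HU; have [v1 [v2 [-> i1 i2]]] := inward_split pS vP pv.
  by apply: memvB; apply: HU; exact: inward_cone.
move=> vT; split; last first.
  apply/(tangent_ambient _ pA) => U HU; apply: vT => w [c [cS cw]]; apply: HU; exists c; split => //.
  by near=> t; have /subballE [] : S (c t) by near: t.
apply: vT => w [c [cS cw]]; apply: (vspace_closed _ _ cw); near=> t.
by apply: memvZ; apply: memvB => //; have /subballE [] : S (c t) by near: t.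
Unshelve. all: by end_near. Qed.

(** [Pi] is spanned by [p] and the tangent space of the subball, and a vector tangent to the space
    form is orthogonal to [p]. Hence the normal space is the same at all points. *)
Lemma normal_subball p v : S p -> Defs.normal_space g S p v <-> (forall z, z \in Pi -> form g v z = 0).
Proof.
move=> pS; have /subballE [pA pr pP] := pS; have [pk _] := pA; split.
  move=> [/(tangent_ambient _ pA) pv vT] z zP.
  have zT : tangent_space S p (z - (kap * form g p z) *: p).
    apply/(tangent_subball _ pS); split; first by rewrite memvB // memvZ.
    by rewrite formBr formZr -/(sqnorm g p) pk; ring: (@kappa_sqr R g).
  by have := vT _ zT; rewrite formBr formZr (formC g v p) pv mulr0 subr0.
move=> vP; split; first by apply/(tangent_ambient _ pA); rewrite formC vP.
by move=> w /(tangent_subball _ pS) [wP _]; exact: vP.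
Qed.

(** [F] is controlled on the subball only, so its derivative is first taken along curves that stay
    inside, for inward vectors, and then extended by linearity. It serves for normal fields, and for
    tangent fields with [U] equal to [Pi]. *)
Lemma derive_subball (F : V -> V) (U : {vspace V}) p v : S p -> differentiable F p ->
  (forall q, S q -> F q \in U) -> v \in Pi -> form g p v = 0 -> 'D_v F p \in U.
Proof.
move=> pS dF FU vP pv; have [v1 [v2 [-> i1 i2]]] := inward_split pS vP pv.
have K w : inward p w -> 'D_w F p \in U.
  move=> iw; have dl := normalized_line_deriv g p w.
  have l0 := normalized_line0 g p w.
  have dF' : differentiable F (normalized_line g p w 0) by rewrite l0.
  have := deriv_right_quotient (diff_curve dF' dl); rewrite l0.
  apply: vspace_closed; have := inward_curve pS iw; apply: filterS => t tS.
  by apply: memvZ; apply: memvB; exact: FU.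
have -> : 'D_(v1 - v2) F p = 'D_v1 F p - 'D_v2 F p by rewrite !deriveE // linearB.
by apply: memvB; exact: K.
Qed.

End SubballTangent.

(** * Orthonormal frames *)

Section OrthonormalFrames.
Context {R : realType} (g : space_form) {n : nat}.
Local Notation V := 'rV[R]_n.+1.
Local Notation kap := (kappa g : R).
Implicit Types (U W : {vspace V}) (p v w z : V).

(** A vector with nonzero square splits off as a line, whatever the signature; this covers a
    timelike [p] as well as the unit vectors of the Gram-Schmidt process. *)
Lemma perp_dim U W p : p \in U -> form g p p != 0 ->
  (forall v, v \in W <-> v \in U /\ form g p v = 0) -> \dim U = (\dim W).+1.
Proof.
move=> pU pp WE.
have p0 : p != 0 by apply: contraNneq pp => ->; rewrite form0r.
have UE : U = (<[p]> + W)%VS.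
  apply/eqP; rewrite eqEsubv; apply/andP; split.
    apply/subvP => v vU; apply/memv_addP.
    pose a := form g p v / form g p p.
    exists (a *: p); first by rewrite memvZ // memv_line.
    exists (v - a *: p); last by rewrite addrC subrK.
    apply/WE; split; first by rewrite memvB // memvZ.
    by rewrite formBr formZr mulfVK // subrr.
  rewrite subv_add -memvE pU /=.
  by apply/subvP => v /WE [].
rewrite UE dimv_disjoint_sum ?dim_vline ?p0 //.
apply/eqP; rewrite -subv0; apply/subvP => v; rewrite memv_cap memv0.
move=> /andP[/vlineP[a ->] /WE [_]]; rewrite formZr => /eqP.
by rewrite mulf_eq0 (negbTE pp) orbF => /eqP ->; rewrite scale0r.
Qed.

Lemma gram_schmidt d U : \dim U = d -> (forall v, v \in U -> v != 0 -> 0 < form g v v) ->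
  exists E : 'M[R]_(d, n.+1), (forall i j, form g (row i E) (row j E) = (i == j)%:R) /\
    (forall v, v \in U <-> exists a : 'rV[R]_d, v = a *m E).
Proof.
elim: d U => [|d IH] U dU pos.
  exists 0; split=> [[]//|v]; move/eqP: dU; rewrite dimv_eq0 => /eqP ->.
  rewrite memv0; split=> [/eqP ->|[a ->]]; last by rewrite mulmx0.
  by exists 0; rewrite mulmx0.
pose u := vpick U.
have u0 : u != 0 by rewrite vpick0 -dimv_eq0 dU.
have uU : u \in U by exact: memv_pick.
have uu := pos u uU u0.
pose e := (Num.sqrt (form g u u))^-1 *: u.
have eU : e \in U by rewrite memvZ.
have ee : form g e e = 1.
  rewrite formZl formZr mulrA -expr2 exprVn sqr_sqrtr ?(ltW uu) // mulVf //.
  exact: lt0r_neq0.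
have [W0 W0E] := perp_vspace g e.
pose W := (U :&: W0)%VS.
have WE v : v \in W <-> v \in U /\ form g e v = 0.
  by rewrite memv_cap W0E; split=> [/andP[-> /eqP]|[-> ->]] //; rewrite eqxx.
have e1 : form g e e != 0 by rewrite ee oner_eq0.
have := perp_dim eU e1 WE; rewrite dU => -[dW].
have [|E [oE EW]] := IH W (esym dW); first by move=> v /WE [vU _]; exact: pos.
have eE j : form g e (row j E) = 0.
  suff /WE [] : row j E \in W by [].
  by apply/EW; exists (delta_mx 0 j); rewrite rowE.
have r0 (l : 'I_1) : row (lshift d l) (col_mx e E : 'M[R]_(1 + d, n.+1)) = e.
  by apply/rowP => i; rewrite mxE col_mxEu !ord1.
have r1 (l : 'I_d) : row (rshift 1 l) (col_mx e E : 'M[R]_(1 + d, n.+1)) = row l E.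
  by apply/rowP => i; rewrite mxE col_mxEd mxE.
exists (col_mx e E : 'M[R]_(1 + d, n.+1)); split.
  move=> i j; case: (split_ordP (i : 'I_(1 + d))) => i' ->;
    case: (split_ordP (j : 'I_(1 + d))) => j' ->.
  - by rewrite r0 r0 ee !ord1 eqxx.
  - by rewrite r0 r1 eE -val_eqE /= ord1.
  - by rewrite r0 r1 formC eE -val_eqE /= ord1.
  - by rewrite r1 r1 oE -!val_eqE /= eqn_add2l.
move=> v; split=> [vU|[a ->]].
  have : v - form g e v *: e \in W.
    apply/WE; split; first by rewrite memvB // memvZ.
    by rewrite formBr formZr ee mulr1 subrr.
  move=> /EW [b vb]; exists (row_mx (form g e v)%:M b : 'rV[R]_(1 + d)).
  apply: (etrans _ (esym (mul_row_col (form g e v)%:M b e E))).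
  by rewrite mul_scalar_mx -vb addrC subrK.
rewrite mulmx_sum_row; apply: memv_suml => i _; apply: memvZ.
case: (split_ordP (i : 'I_(1 + d))) => i' ->; first by rewrite r0.
rewrite r1; suff /WE [] : row i' E \in W by [].
by apply/EW; exists (delta_mx 0 i'); rewrite rowE.
Qed.

Lemma sum_sqr_orthogonal d (M : 'M[R]_d) (l : 'cV[R]_d) : M *m M^T = 1%:M ->
  \sum_i (M *m l) i 0 ^+ 2 = \sum_i l i 0 ^+ 2.
Proof.
move=> /mulmx1C MM.
have S (x : 'cV[R]_d) : \sum_i x i 0 ^+ 2 = (x^T *m x) 0 0.
  by rewrite mxE; apply: eq_bigr => i _; rewrite mxE expr2.
by rewrite !S trmx_mul -mulmxA (mulmxA M^T) MM mul1mx.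
Qed.

(** The change of frame is an orthogonal matrix. The frame in the second variation is an arbitrary
    choice, so sums over it must be moved to a computable frame. *)
Lemma frame_sum_indep d (A B : 'M[R]_(d, n.+1)) (L : V -> R) :
  (forall i j, form g (row i A) (row j A) = (i == j)%:R) ->
  (forall i j, form g (row i B) (row j B) = (i == j)%:R) ->
  (forall i, exists a : 'rV[R]_d, row i B = a *m A) ->
  (forall a : 'rV[R]_d, L (a *m A) = \sum_j a 0 j * L (row j A)) ->
  \sum_i L (row i B) ^+ 2 = \sum_i L (row i A) ^+ 2.
Proof.
move=> oA oB BA LA.
pose M : 'M[R]_d := \matrix_i sval (cid (BA i)).
have ME i : row i B = row i M *m A by rewrite rowK; exact: svalP (cid (BA i)).
pose l : 'cV[R]_d := \col_j L (row j A).
have -> : \sum_i L (row i A) ^+ 2 = \sum_i l i 0 ^+ 2.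
  by apply: eq_bigr => i _; rewrite mxE.
rewrite -(@sum_sqr_orthogonal _ M).
  apply: eq_bigr => i _; congr (_ ^+ 2); rewrite ME LA mxE.
  by apply: eq_bigr => j _; rewrite !mxE.
apply/matrixP => i j; rewrite !mxE -oB !ME form_frame //.
by apply: eq_bigr => k _; rewrite !mxE.
Qed.

End OrthonormalFrames.

(** * The normal bundle and the second fundamental form *)

Section NormalBundle.
Context {R : realType} (g : space_form) {n m : nat} (r : R) (Pi : {vspace 'rV[R]_n.+1}).
Local Notation V := 'rV[R]_n.+1.
Local Notation kap := (kappa g : R).
Hypothesis rA : admissible g r.
Hypothesis pPi : pole \in Pi.
Hypothesis dPi : \dim Pi = m.+2.
Local Notation S := (geodesic_subball g r Pi).
Implicit Types p v w z : V.

Lemma kappa_neq0 : kap != 0.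
Proof. by rewrite -sqrf_eq0 kappa_sqr oner_eq0. Qed.

Lemma form_pole_eq0 v : form g pole v = 0 -> form g v v = 0 -> v = 0.
Proof.
rewrite form_pole => /eqP; rewrite mulf_eq0 (negbTE kappa_neq0) /= => /eqP v0.
rewrite formE v0 !mulr0 add0r => /dot_eq0 v1.
rewrite [v]row_mx_rgrad v0 v1; apply/rowP => i; rewrite !mxE.
by case: splitP => j _; rewrite !mxE ?mul0rn.
Qed.

(** By Cauchy-Schwarz a null tangent vector is orthogonal to the tangential part of the pole, hence
    to the pole itself, and on the complement of the pole the form is Euclidean. *)
Lemma ambient_perp_gt0 p v : ambient g p -> form g p v = 0 -> v != 0 -> 0 < form g v v.
Proof.
move=> pA pv v0; rewrite lt0r (ambient_perp_ge0 pA pv) andbT.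
apply: contra v0 => /eqP vv; have [pk _] := pA.
pose w := pole - p 0 0 *: p.
have pw : form g p w = 0.
  by rewrite formBr formZr formC form_pole -/(sqnorm g p) pk; ring.
have := ambient_perp_CS pA pv pw; rewrite vv mul0r => vw.
have {}vw : form g v w = 0.
  by apply/eqP; rewrite -sqrf_eq0 eq_le vw sqr_ge0.
apply/eqP; apply: form_pole_eq0 => //.
rewrite formC; move: vw; rewrite formBr formZr (formC g v p) pv mulr0 subr0.
by [].
Qed.

Lemma frame_orthonormal p : S p -> orthonormal_basis g (tangent_space S p)
  (frame g m.+1 (tangent_space S p)).
Proof.
move=> pS; have /(subballE Pi rA) [pA pr pP] := pS; have [pk _] := pA.
apply: (@xgetPex _ 0 [set E : 'M[R]_(m.+1, n.+1) | orthonormal_basis g (tangent_space S p) E]).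
have [W0 W0E] := perp_vspace g p.
pose W := (Pi :&: W0)%VS.
have WE v : v \in W <-> v \in Pi /\ form g p v = 0.
  by rewrite memv_cap W0E; split=> [/andP[-> /eqP]|[-> ->]] //; rewrite eqxx.
have pp : form g p p != 0 by rewrite -/(sqnorm g p) pk kappa_neq0.
have := perp_dim pP pp WE; rewrite dPi => -[dW].
have [|E [oE EW]] := gram_schmidt (g := g) (esym dW).
  by move=> v /WE [_ pv] v0; exact: ambient_perp_gt0 pv v0.
exists E; split => //; apply/seteqP; split=> v /=.
  by move=> /(tangent_subball rA pPi _ pS) /WE /EW.
by move=> /EW /WE vW; apply/(tangent_subball rA pPi _ pS).
Qed.

Lemma frame_tangent p i : S p ->
  row i (frame g m.+1 (tangent_space S p)) \in Pi /\
  form g p (row i (frame g m.+1 (tangent_space S p))) = 0.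
Proof.
move=> pS; have [_ TE] := frame_orthonormal pS.
apply/(tangent_subball rA pPi _ pS); rewrite {1}TE /=.
by exists (delta_mx 0 i); rewrite rowE.
Qed.

Lemma normal_vspace : exists N : {vspace V},
  (forall v, v \in N <-> forall z, z \in Pi -> form g v z = 0) /\ (\dim N = n - m.+1)%N.
Proof.
pose b := vbasis Pi.
pose A : 'M[R]_(n.+1, \dim Pi) := \matrix_(i, j) form g (delta_mx 0 i) b`_j.
have AE v j : (v *m A) 0 j = form g v b`_j.
  rewrite mxE {2}[v]row_sum_delta formC form_sumr.
  by apply: eq_bigr => i _; rewrite mxE formZr formC.
have [N NE] := kernel_vspace A.
have NE' v : v \in N <-> forall z, z \in Pi -> form g v z = 0.
  rewrite NE; split=> [/eqP vA z zP|vP].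
    rewrite (coord_vbasis zP) form_sumr big1 // => j _.
    by rewrite formZr -AE vA mxE mulr0.
  apply/eqP/rowP => j; rewrite AE mxE vP // vbasis_mem // mem_nth //.
  by rewrite size_tuple.
exists N; split=> //.
have [pS _] := pole_subball rA pPi.
have [oE TE] := frame_orthonormal pS; set E := frame _ _ _ in oE TE.
have EP j := frame_tangent j pS; rewrite -/E in EP.
have PN : (Pi :&: N = 0)%VS.
  apply/eqP; rewrite -subv0; apply/subvP => v; rewrite memv_cap memv0 => /andP[vP /NE' vN].
  by apply/eqP; apply: form_pole_eq0; [rewrite formC|]; exact: vN.
have := dimv_disjoint_sum PN; rewrite dPi.
suff -> : (Pi + N = fullv)%VS.
  rewrite dimvf dim_matrix -[X in X = _]/(1 * n.+1)%N mul1n addSn => -[nE].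
  by rewrite [in RHS]nE addKn.
apply/eqP; rewrite eqEsubv subvf /=; apply/subvP => v _; apply/memv_addP.
(* The orthogonal projection to [Pi] in the basis of the pole and its frame; the factor [kap] is the
   inverse of [form pole pole]. *)
pose q : V := (kap * form g pole v) *: pole + (\row_j form g (row j E) v) *m E.
have qP : q \in Pi.
  rewrite memvD ?memvZ // mulmx_sum_row; apply: memv_suml => j _; apply: memvZ.
  by have [] := EP j.
exists q => //; exists (v - q); last by rewrite addrC subrK.
apply/NE' => z zP.
have zE : z = (kap * form g pole z) *: pole + (z - (kap * form g pole z) *: pole).
  by rewrite addrC subrK.
have pE (a : 'rV[R]_m.+1) : form g pole (a *m E) = 0.
  by rewrite form_comb big1 // => j _; have [_ ->] := EP j; rewrite mulr0.
have ppE : form g (pole : V) pole = kap by rewrite form_pole pole00 mulr1.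
have : tangent_space S pole (z - (kap * form g pole z) *: pole).
  apply/(tangent_subball rA pPi _ pS); split; first by rewrite memvB ?memvZ.
  by rewrite formBr formZr ppE; ring: (@kappa_sqr R g).
rewrite TE => -[a aE]; rewrite zE aE formDr formZr formBl [form g q _]formC formDr formZr pE ppE.
rewrite formBl [form g q (a *m E)]formDl formZl pE mulr0 add0r form_frame //.
rewrite (formC g v pole).
have -> : form g v (a *m E) = dot (\row_j form g (row j E) v) a.
  by rewrite form_comb; apply: eq_bigr => j _; rewrite mxE mulrC formC.
by ring: (@kappa_sqr R g).
Qed.

Lemma normal_definite v : (forall z, z \in Pi -> form g v z = 0) -> form g v v = 0 -> v = 0.
Proof. by move=> vN; apply: form_pole_eq0; rewrite formC vN. Qed.

(** Definiteness of the form on the normal space leaves a single candidate for the chosen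
    projection. *)
Lemma proj_normal p u w : S p -> (forall z, z \in Pi -> form g w z = 0) ->
  (forall z, (forall y, y \in Pi -> form g z y = 0) -> form g (u - w) z = 0) ->
  Defs.proj g (Defs.normal_space g S p) u = w.
Proof.
move=> pS wN uw; apply: xget_unique => [|w' [/(normal_subball rA pPi _ pS) w'N H]].
  by split; [exact/(normal_subball rA pPi _ pS)|move=> z /(normal_subball rA pPi _ pS); exact: uw].
have dN z : z \in Pi -> form g (w' - w) z = 0.
  by move=> zP; rewrite formBl w'N // wN // subrr.
have d0 : form g (w' - w) (w' - w) = 0.
  have h1 := uw _ dN; have h2 := H (w' - w) _.
  have {}h2 : form g (u - w') (w' - w) = 0 by apply: h2; exact/(normal_subball rA pPi _ pS).
  by move: h1 h2; rewrite !(formBl _ (w' - w)); lra.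
by apply/eqP; rewrite -subr_eq0; apply/eqP; exact: normal_definite.
Qed.

(** A tangent field takes its values in [Pi] along the subball, hence so does its derivative, which
    projects to 0. If no extension existed, the default value of [xget] would be 0 as well. *)
Lemma second_fundamental_form0 p v w : S p -> v \in Pi -> form g p v = 0 ->
  second_fundamental_form g S p v w = 0.
Proof.
move=> pS vP pv; rewrite /second_fundamental_form; case: xgetP => // b _ [Y [[sY tY] _ ->]].
apply: proj_normal => //; first by move=> z _; rewrite form0l.
move=> z zN; rewrite subr0 formC; apply: zN.
apply: (derive_subball rA pPi pS (sY [::] p)) => // q qS.
by have /(tangent_subball rA pPi _ qS) [] := tY q qS.
Qed.

End NormalBundle.

(** * Gradients in moving frames and in polar coordinates *)

Section GradientEnergy.
Context {R : realType} (g : space_form) {n m : nat} (r : R) (Pi : {vspace 'rV[R]_n.+1}).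
Local Notation V := 'rV[R]_n.+1.
Local Notation kap := (kappa g : R).
Local Notation gc := (@gcos R g).
Local Notation gs := (@gsin R g).
Hypothesis rA : admissible g r.
Hypothesis pPi : pole \in Pi.
Hypothesis dPi : \dim Pi = m.+2.
Local Notation S := (geodesic_subball g r Pi).
Local Notation E := (frame g m.+1 (tangent_space S pole)).
Implicit Types (p v z : V) (w : 'rV[R]_m.+1).

Lemma pole_frame_orth i j : form g (row i E) (row j E) = (i == j)%:R.
Proof. by have [pS _] := pole_subball rA pPi; have [] := frame_orthonormal rA pPi dPi pS. Qed.

Lemma pole_frame_perp i : form g pole (row i E) = 0.
Proof. by have [pS _] := pole_subball rA pPi; have [] := frame_tangent rA pPi dPi i pS. Qed.

Lemma pole_frame_mem (a : 'rV[R]_m.+1) : a *m E \in Pi.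
Proof.
have [pS _] := pole_subball rA pPi; rewrite mulmx_sum_row.
by apply: memv_suml => j _; apply: memvZ; have [] := frame_tangent rA pPi dPi j pS.
Qed.

Lemma polar_map00 (a b : R) w : polar_map E a b w 0 0 = a.
Proof.
have := form_pole g (w *m E); rewrite form_comb big1 => [/esym /eqP|j _]; last first.
  by rewrite pole_frame_perp mulr0.
rewrite mulf_eq0 (negbTE (kappa_neq0 _)) /= => /eqP w0.
by rewrite /polar_map mxE [X in X + _]mxE [X in _ + X]mxE w0 pole00; ring.
Qed.

Lemma polar_map_subball t w : - r <= t <= r -> dot w w = 1 -> S (polar_map E (gc t) (gs t) w).
Proof.
move=> /andP[rt tr] w1; apply/(subballE Pi rA); split.
- split; last by rewrite polar_map00 (gcos_gt0 rA).
  rewrite /sqnorm form_polar_map //; [|exact: pole_frame_orth|exact: pole_frame_perp].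
  have h := gcos2gsin2 g t.
  by rewrite w1 mulr1 -[RHS]mulr1 -h; ring: (@kappa_sqr R g).
- rewrite polar_map00; have [t0|t0] := leP 0 t.
    rewrite kgcos_le //; case: rA => r0 rp gS; exact: le_lt_trans (rp gS).
  rewrite -(gcosN g t) kgcos_le //; [lra|lra|].
  by case: rA => r0 rp gS; have := rp gS; lra.
- by rewrite /polar_map memvD // memvZ // pole_frame_mem.
Qed.

(** Linear coordinates on [Pi], in which the scalar forms are stated; polar points go to polar
    coordinates of the subball. *)
Definition plane_point (y : 'rV[R]_m.+2) : V := y 0 0 *: pole + rgrad y *m E.

Lemma plane_point_polar (c s : R) (w : 'rV[R]_m.+1) :
  plane_point (polar_point c s w) = polar_map E c s w.
Proof.
by rewrite /plane_point polar_point0 /rgrad /polar_point row_mxKr /polar_map scalemxAl.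
Qed.

Definition plane_grad (f : V -> R) (y : 'rV[R]_m.+2) : 'rV[R]_m.+2 :=
  row_mx ('D_pole f (plane_point y))%:M (\row_j 'D_(row j E) f (plane_point y)) : 'rV[R]_(1 + m.+1).

Lemma plane_point_deriv (c : R -> 'rV[R]_m.+2) (t : R) (v : 'rV[R]_m.+2) : is_derive t 1 c v ->
  is_derive t 1 (fun s => plane_point (c s)) (plane_point v).
Proof.
move=> dc; apply: deriv_mx => i j.
have dr : is_derive t 1 (fun s => rgrad (c s)) (rgrad v).
  apply: deriv_mx => a b; rewrite mxE; under eq_fun do rewrite mxE.
  exact: deriv_coord.
rewrite (_ : (fun s => plane_point (c s) i j) =
  (fun s => c s 0 0 * (pole : V) i j + (\sum_l (fun s => rgrad (c s) i l * E l j)) s)); last first.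
  by apply/funext => s; rewrite fct_sumE !mxE.
have h2 : is_derive t 1 (\sum_l (fun s => rgrad (c s) i l * E l j)) (\sum_l rgrad v i l * E l j).
  apply: is_derive_sum => l; apply: (is_derive_eq (der1M (deriv_coord i l dr) (der1C (E l j) t))).
  by rewrite mulr0 addr0.
have h1 := der1M (deriv_coord 0 0 dc) (der1C ((pole : V) i j) t).
apply: (is_derive_eq (der1D h1 h2)).
by rewrite mulr0 addr0 !mxE.
Qed.

Lemma plane_point_cts : continuous plane_point.
Proof.
apply: cts_mx => i j; under eq_fun do rewrite !mxE; apply: ctsD.
  by apply: ctsM; [exact: cts_coord|exact: ctsC].
apply: cts_sum => l; apply: ctsM; last exact: ctsC.
exact: (cts_comp (@rgrad_cts R m.+1) (@cts_coord _ _ _ i l)).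
Qed.

Lemma derive_comb d (f : V -> R) p (a : 'rV[R]_d) (A : 'M[R]_(d, n.+1)) : differentiable f p ->
  'D_(a *m A) f p = \sum_j a 0 j * 'D_(row j A) f p.
Proof.
move=> df; rewrite mulmx_sum_row deriveE // linear_sum.
by apply: eq_bigr => j _; rewrite linearZ /= deriveE.
Qed.

Lemma plane_grad_dot (f : V -> R) (y v : 'rV[R]_m.+2) : differentiable f (plane_point y) ->
  'D_(plane_point v) f (plane_point y) = dot (plane_grad f y) v.
Proof.
move=> df; rewrite deriveE // [plane_point v]/plane_point linearD linearZ -!deriveE // derive_comb //=.
rewrite [v in RHS]row_mx_rgrad dot_row_mx mulrC; congr (_ + _).
by apply: eq_bigr => j _; rewrite mulrC; congr (_ * _); rewrite mxE.
Qed.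

Lemma plane_has_grad (f : V -> R) : (forall p, differentiable f p) ->
  (forall v, continuous (fun p => 'D_v f p)) ->
  has_grad (fun y => f (plane_point y)) (plane_grad f).
Proof.
move=> df cf; split.
- have cf0 : continuous f by move=> p; exact: differentiable_continuous.
  exact: (cts_comp plane_point_cts cf0).
- apply: row_mx_cts; first exact: (cts_comp plane_point_cts (cf pole)).
  apply: cts_mx => i j; under eq_fun do rewrite mxE.
  exact: (cts_comp plane_point_cts (cf (row j E))).
- move=> c t v dc; have := diff_curve (df _) (plane_point_deriv dc).
  by rewrite plane_grad_dot.
Qed.

(* The sum does not depend on the frame at [p]; it is computed in the frame [B],
   the image of the frame at the pole under the isometry that maps [pole] to [p]
   along their geodesic. *)
Lemma gradient_energy (f : V -> R) t w : - r <= t <= r -> dot w w = 1 ->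
  let p := polar_map E (gc t) (gs t) w in differentiable f p ->
  \sum_i 'D_(row i (frame g m.+1 (tangent_space S p))) f p ^+ 2 =
  pol_rad kap gc gs (plane_grad f) t w ^+ 2 + pol_tan gc gs (plane_grad f) t w.
Proof.
move=> tr w1 p df; have pS : S p by exact: polar_map_subball.
have /(subballE Pi rA) [pA _ pP] := pS; have [pk p0] := pA.
have [oF TF] := frame_orthonormal rA pPi dPi pS.
set F := frame _ _ (tangent_space S p) in oF TF *.
have p00 : p 0 0 = gc t by exact: polar_map00.
have c1 : 1 + gc t != 0 by rewrite lt0r_neq0 // -p00 addr_gt0.
have k2 := @kappa_sqr R g; have h2 := gcos2gsin2 g t.
have eE j : row j E = polar_map E 0 1 (delta_mx 0 j) by rewrite /polar_map scale0r add0r scale1r -rowE.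
have oE := pole_frame_orth; have pE := pole_frame_perp.
have dotd j : dot w (delta_mx 0 j) = w 0 j.
  rewrite /dot (bigD1 j) //= big1 ?addr0 ?mxE ?eqxx ?mulr1 // => i ij.
  by rewrite mxE (negbTE ij) andbF mulr0.
have fpE j : form g p (row j E) = gs t * w 0 j.
  by rewrite eE form_polar_map // dotd; ring.
pose u : V := pole + p.
have uu : form g u u = 2 * kap * (1 + gc t).
  rewrite formDD -/(sqnorm g p) pk (formC g p) !form_pole p00 pole00; ring.
have uE j : form g u (row j E) = gs t * w 0 j by rewrite formDl pE fpE add0r.
(* The isometry taking the pole to [p] sends [x] orthogonal to the pole to [x - a *: (pole + p)],
   where [a] is [form p x] divided by [form pole pole + form pole p = kap * (1 + gc t)]. *)
pose B : 'M[R]_(m.+1, n.+1) := \matrix_j (row j E - (kap * (gs t * w 0 j) / (1 + gc t)) *: u).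
have BE j : row j B = row j E - (kap * (gs t * w 0 j) / (1 + gc t)) *: u by rewrite rowK.
have oB i j : form g (row i B) (row j B) = (i == j)%:R.
  rewrite !BE formBl !formBr !formZl !formZr oE uE (formC g (row i E)) uE uu.
  by field: k2.
have BT i : tangent_space S p (row i B).
  apply/(tangent_subball rA pPi _ pS); rewrite BE; split.
    by apply: memvB; [rewrite rowE pole_frame_mem|rewrite memvZ // memvD].
  rewrite formBr formZr formDr fpE -/(sqnorm g p) pk (formC g p) form_pole p00.
  by field: k2.
have LF (a : 'rV[R]_m.+1) := derive_comb a F df.
rewrite -(frame_sum_indep (L := fun v => 'D_v f p) oF oB _ LF); last first.
  by move=> i; have := BT i; rewrite TF.
set G := plane_grad f; set y := polar_point (gc t) (gs t) w.
have yp : plane_point y = p by exact: plane_point_polar.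
pose G0 : R := 'D_pole f p; pose G1 : 'rV[R]_m.+1 := \row_j 'D_(row j E) f p.
have GE : G y = row_mx G0%:M G1 :> 'rV_(1 + m.+1) by rewrite /G /plane_grad yp.
pose P := dot w G1.
have pr : pol_rad kap gc gs G t w = - (kap * gs t) * G0 + gc t * P.
  rewrite /pol_rad -/y GE; rewrite dot_row_mx dotZr (dotC G1) -/P; ring.
have pt : pol_tan gc gs G t w = dot G1 G1 - P ^+ 2.
  by rewrite /pol_tan -/y GE /rgrad row_mxKr.
(* In the frame [B] the gradient differs from [G1] by a multiple of [w] only; [q] is that multiple,
   with the derivative along [pole + p] written out. *)
pose q := kap * gs t * (G0 + (gc t * G0 + gs t * P)) / (1 + gc t).
have DB j : 'D_(row j B) f p = (G1 - q *: w) 0 j.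
  have Dp : 'd f p p = gc t * G0 + gs t * P.
    have := @plane_grad_dot f y y; rewrite yp => /(_ df); rewrite deriveE // => ->.
    by rewrite -/G GE dot_row_mx dotZr (dotC G1) -/P; ring.
  rewrite BE deriveE // linearB linearZ /= linearD /= Dp !mxE /q /G0 !deriveE //.
  by congr (_ - _); rewrite -[LHS]/(_ * (_ : R)); field.
transitivity (dot (G1 - q *: w) (G1 - q *: w)).
  by apply: eq_bigr => j _; rewrite DB expr2.
rewrite -scaleNr dotDr !(dotC (_ + _)) !dotDr !dotZr !dotZl w1 (dotC G1) -/P pr pt.
have s2 : gs t ^+ 2 = kap * (1 - gc t ^+ 2) by rewrite -h2; ring: k2.
rewrite /q.
by field: s2 k2.
Qed.

End GradientEnergy.

(** * The second variation and the index *)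

Section C1Field.
Context {R : realType} {n : nat}.
Local Notation V := 'rV[R]_n.+1.
Implicit Types (X Y : V -> V) (p v : V).

(** The second variation involves first derivatives only, and this class is stable under linear
    combinations by a direct argument. *)
Definition C1_field X := (forall p, differentiable X p) /\
  (forall v, continuous (fun p => 'D_v X p)).

Lemma smooth_C1 X : smooth X -> C1_field X.
Proof.
move=> sX; split=> [|v p]; first exact: (sX [::]).
exact: (differentiable_continuous (sX [:: v] p)).
Qed.

Lemma derive_field_coord X j p v : C1_field X ->
  'D_v (fun q => X q 0 j) p = 'D_v X p 0 j.
Proof. by move=> [dX _]; rewrite derive_mx ?mxE //; exact: diff_derivable. Qed.

Lemma field_coord_differentiable X j p : C1_field X -> differentiable (fun q => X q 0 j) p.
Proof.
move=> [dX _]; apply: (@differentiable_comp _ _ _ _ X (fun x : V => x 0 j)) => //.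
exact: differentiable_coord.
Qed.

Lemma field_coord_cts X j v : C1_field X -> continuous (fun p => 'D_v (fun q => X q 0 j) p).
Proof.
move=> cX; under eq_fun do rewrite derive_field_coord //.
by have [_ cD] := cX; exact: (cts_comp (cD v) (@cts_coord _ _ _ 0 j)).
Qed.

Lemma C1_comb d (a : 'rV[R]_d) (X : 'I_d -> V -> V) : (forall i, C1_field (X i)) ->
  C1_field (fun p => \sum_i a 0 i *: X i p).
Proof.
move=> cX; rewrite (_ : (fun p => _) = \sum_i (a 0 i \*: X i)); last first.
  by apply/funext => p; rewrite fct_sumE.
have dX i p : differentiable (a 0 i \*: X i) p.
  by apply: differentiableZ; have [] := cX i.
split=> [p|v]; first exact: differentiable_sum.
rewrite (_ : (fun p => _) = (fun p => \sum_i a 0 i *: 'D_v (X i) p)); last first.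
  apply/funext => p; rewrite derive_sum => [|i]; last exact: diff_derivable.
  apply: eq_bigr => i _; rewrite deriveZ //; have [dXi _] := cX i; exact: diff_derivable.
apply: cts_sum => i; apply: ctsZ; first exact: ctsC.
by have [_] := cX i; exact.
Qed.

End C1Field.

Section IntegralSums.
Context {R : realType}.

Lemma seg_int_sum (I : Type) (s : seq I) (F : I -> R -> R) (a b : R) :
  (forall i, continuous (F i)) ->
  seg_int a b (fun t => \sum_(i <- s) F i t) = \sum_(i <- s) seg_int a b (F i).
Proof.
move=> cF; elim: s => [|i s IH].
  rewrite big_nil (@eq_seg_int _ _ (fun t => 0 * (fun=> 0) t)) => [|t _].
    by rewrite seg_intZ ?mul0r //; exact: ctsC.
  by rewrite big_nil mul0r.
rewrite big_cons -IH -seg_intD //; last exact: cts_sum.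
by apply: eq_seg_int => t _; rewrite big_cons.
Qed.

Lemma sphere_int_sum m (I : Type) (s : seq I) (F : I -> 'rV[R]_m.+1 -> R) :
  (forall i, continuous (F i)) ->
  sphere_int (fun w => \sum_(i <- s) F i w) = \sum_(i <- s) sphere_int (F i).
Proof.
move=> cF; elim: s => [|i s IH].
  rewrite big_nil (@eq_sphere_int _ _ _ (fun=> 0)) => [|w _]; last by rewrite big_nil.
  by rewrite sphere_int_cst mul0r.
rewrite big_cons -IH -sphere_intD //; last exact: cts_sum.
by apply: eq_sphere_int => w _; rewrite big_cons.
Qed.

End IntegralSums.

(** * Antipodal symmetry of polar coordinates *)

Section Antipode.
Context {R : realType} (g : space_form) {m : nat} (u : 'rV[R]_m.+2 -> R) (G : 'rV[R]_m.+2 -> 'rV[R]_m.+2).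
Local Notation kap := (kappa g : R).
Local Notation gc := (@gcos R g).
Local Notation gs := (@gsin R g).

Lemma polar_point_antipode t (w : 'rV[R]_m.+1) :
  polar_point (gc (- t)) (gs (- t)) (- w) = polar_point (gc t) (gs t) w.
Proof. by rewrite /polar_point gcosN gsinN scaleNr scalerN opprK. Qed.

Lemma pol_val_antipode t (w : 'rV[R]_m.+1) : pol_val gc gs u (- t) (- w) = pol_val gc gs u t w.
Proof. by rewrite /pol_val polar_point_antipode. Qed.

Lemma pol_tan_antipode t (w : 'rV[R]_m.+1) : pol_tan gc gs G (- t) (- w) = pol_tan gc gs G t w.
Proof.
rewrite /pol_tan polar_point_antipode; set h := rgrad _.
by rewrite -[- w]scaleN1r dotZl exprMn sqrrN expr1n mul1r.
Qed.

Lemma pol_rad_antipode t (w : 'rV[R]_m.+1) : pol_rad kap gc gs G (- t) (- w) = - pol_rad kap gc gs G t w.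
Proof.
rewrite /pol_rad polar_point_antipode; set h := G _.
rewrite (_ : polar_point _ _ (- w) = - polar_point (- (kap * gs t)) (gc t) w).
  by rewrite -[- polar_point _ _ _]scaleN1r dotZr mulN1r.
by rewrite polar_pointN gcosN gsinN mulrN.
Qed.

End Antipode.

(** * Reduction of the second variation to scalar forms *)

Section SecondVariation.
Context {R : realType} (g : space_form) {n m : nat} (r : R) (Pi : {vspace 'rV[R]_n.+1}).
Local Notation V := 'rV[R]_n.+1.
Local Notation kap := (kappa g : R).
Local Notation gc := (@gcos R g).
Local Notation gs := (@gsin R g).
Hypothesis rA : admissible g r.
Hypothesis pPi : pole \in Pi.
Hypothesis dPi : \dim Pi = m.+2.
Local Notation S := (geodesic_subball g r Pi).
Local Notation E := (frame g m.+1 (tangent_space S pole)).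
Local Notation pt := (@plane_point R g n m r Pi).
Local Notation grad := (@plane_grad R g n m r Pi).
Implicit Types (p v z : V) (w : 'rV[R]_m.+1).

(** Normal vectors are orthogonal to the pole, so their zeroth coordinate vanishes and the remaining
    ones carry the field with a Euclidean norm. *)
Definition field_coord (X : V -> V) (l : 'I_n) p : R := X p 0 (lift ord0 l).

Context (X : V -> V).
Hypothesis cX : C1_field X.
Hypothesis nX : forall p, S p -> forall z, z \in Pi -> form g (X p) z = 0.

Lemma field_coord_has_grad l : has_grad (fun y => field_coord X l (pt y)) (grad (field_coord X l)).
Proof.
apply: plane_has_grad => [p|v]; first exact: field_coord_differentiable.
exact: field_coord_cts.
Qed.

Lemma sqnorm_normal v : (forall z, z \in Pi -> form g v z = 0) ->
  sqnorm g v = \sum_l v 0 (lift ord0 l) ^+ 2.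
Proof.
move=> vN; have := form_pole g v; rewrite formC vN // => /esym /eqP.
rewrite mulf_eq0 (negbTE (kappa_neq0 _)) /= => /eqP v0.
by rewrite /sqnorm /Defs.form v0 mulr0 add0r; apply: eq_bigr => l _; rewrite expr2.
Qed.

Lemma derive_normal p i : S p -> forall z, z \in Pi ->
  form g ('D_(row i (frame g m.+1 (tangent_space S p))) X p) z = 0.
Proof.
move=> pS; have [N [NE _]] := normal_vspace rA pPi dPi.
apply/NE; have [iP ip] := frame_tangent rA pPi dPi i pS.
by apply: (derive_subball rA pPi pS _ _ iP ip) => [|q qS]; [have [] := cX|apply/NE; exact: nX].
Qed.

(** The normal space is constant, so the derivative of a normal field is already normal and the
    normal connection is the flat derivative. Exchanging the sums over frame vectors and coordinates
    leaves one gradient energy per coordinate. *)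
Lemma second_variation_density t w : - r <= t <= r -> dot w w = 1 ->
  let p := polar_map E (gc t) (gs t) w in
  let e i := row i (frame g m.+1 (tangent_space S p)) in
  \sum_(i < m.+1) sqnorm g (normal_connection g S p (e i) X)
    - kap * m.+1%:R * sqnorm g (X p)
    - \sum_(i < m.+1) \sum_(j < m.+1) form g (second_fundamental_form g S p (e i) (e j)) (X p) ^+ 2
  = \sum_l (pol_rad kap gc gs (grad (field_coord X l)) t w ^+ 2
            + pol_tan gc gs (grad (field_coord X l)) t w
            - kap * m.+1%:R * pol_val gc gs (fun y => field_coord X l (pt y)) t w ^+ 2).
Proof.
move=> tr w1 p e.
have pS : S p by exact: polar_map_subball.
rewrite [X in _ - X]big1 ?subr0 => [|i _]; last first.
  rewrite big1 // => j _; have [iP ip] := frame_tangent rA pPi dPi i pS.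
  by rewrite second_fundamental_form0 // form0l expr0n.
rewrite sumrB -mulr_sumr; congr (_ - _ * _); last first.
  rewrite sqnorm_normal; last exact: nX.
  by apply: eq_bigr => l _; rewrite /pol_val plane_point_polar.
have nE i : normal_connection g S p (e i) X = 'D_(e i) X p.
  apply: (proj_normal rA pPi) => //; first exact: derive_normal.
  by move=> z _; rewrite subrr form0l.
transitivity (\sum_(i < m.+1) \sum_l ('D_(e i) X p) 0 (lift ord0 l) ^+ 2).
  by apply: eq_bigr => i _; rewrite nE sqnorm_normal //; exact: derive_normal.
rewrite exchange_big; apply: eq_bigr => l _ /=.
rewrite -(gradient_energy rA pPi dPi) //; last exact: field_coord_differentiable.
by apply: eq_bigr => i _; rewrite derive_field_coord.
Qed.

Lemma second_variation_sum : ball_second_variation g m.+1 r S X =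
  \sum_l ball_form g r (fun y => field_coord X l (pt y)) (grad (field_coord X l)).
Proof.
have r0 : 0 < r by case: rA.
have oE := @pole_frame_orth R g n m r Pi rA pPi dPi.
have pE := @pole_frame_perp R g n m r Pi rA pPi dPi.
pose U l := fun y => field_coord X l (pt y); pose G l := grad (field_coord X l).
have hG l : has_grad (U l) (G l) := field_coord_has_grad l.
pose phi l t w := pol_rad kap gc gs (G l) t w ^+ 2 + pol_tan gc gs (G l) t w
  - kap * m.+1%:R * pol_val gc gs (U l) t w ^+ 2.
have ccs : continuous gc by move=> t; exact: deriv_cts (dgcos g t).
have csn : continuous gs by move=> t; exact: deriv_cts (dgsin g t).
have cV (Y : topologicalType) (f : Y -> R) (w : Y -> 'rV[R]_m.+1) l : continuous f -> continuous w ->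
    continuous (fun x => pol_val gc gs (U l) (f x) (w x)).
  move=> cf cw; have [cU _ _] := hG l; apply: (cts_comp _ cU).
  by apply: polar_point_cts => //; [exact: (cts_comp cf ccs)|exact: (cts_comp cf csn)].
have cP (Y : topologicalType) (f : Y -> R) (w : Y -> 'rV[R]_m.+1) l : continuous f -> continuous w ->
    continuous (fun x => phi l (f x) (w x)).
  move=> cf cw; apply: ctsD; first exact: (pol_energy_cts (dgcos g) (dgsin g) (hG l)).
  by apply: ctsN; apply: ctsM; [exact: ctsC|apply: ctsX; exact: cV].
have phiN l t w : phi l (- t) (- w) = phi l t w.
  by rewrite /phi pol_val_antipode pol_tan_antipode pol_rad_antipode sqrrN.
rewrite /ball_second_variation /second_variation.
rewrite (@ball_integralE _ _ _ _ _ oE pE _ _ (fun t w => \sum_l phi l t w)) //; last 3 first.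
- by apply: cts_sum => l; apply: cP; [exact: cts_fst|exact: cts_snd].
- by move=> t w; apply: eq_bigr => l _; exact: phiN.
- by move=> t w tr w1; exact: second_variation_density.
rewrite (@sphere_integralE _ _ _ _ _ oE pE _ _ (fun w => \sum_l pol_val gc gs (U l) r w ^+ 2)) //; last 2 first.
- by apply: cts_sum => l; apply: ctsX; apply: cV; [exact: ctsC|exact: ctsI].
- move=> w w1; rewrite sqnorm_normal; last first.
    by apply: nX; apply: polar_map_subball => //; lra.
  by apply: eq_bigr => l _; rewrite /pol_val /U plane_point_polar.
rewrite /ball_form sumrB; congr (_ - _); last first.
  rewrite sphere_int_sum => [|l]; last by apply: ctsX; apply: cV; [exact: ctsC|exact: ctsI].
  by rewrite !mulr_sumr.
rewrite -seg_int_sum => [|l]; last first.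
  apply: ctsM; first exact: ctsX.
  by apply: sphere_int_cts; apply: cP; [exact: cts_fst|exact: cts_snd].
apply: eq_seg_int => t _; rewrite -mulr_sumr sphere_int_sum // => l.
by apply: (cP _ (fun=> t) id l); [exact: ctsC|exact: ctsI].
Qed.

End SecondVariation.

(** * The height fields *)

Section HeightFields.
Context {R : realType} {n : nat}.
Local Notation V := 'rV[R]_n.+1.

Lemma affine_height_differentiable (v c p : V) :
  differentiable (fun q : V => q 0 0 *: v + c) p.
Proof.
apply: differentiableD; last exact: differentiable_cst.
by apply: differentiableZl; exact: differentiable_coord.
Qed.

Lemma derive_affine_height (v c p w : V) :
  'D_w (fun q : V => q 0 0 *: v + c) p = w 0 0 *: v.
Proof.
have dl := line_deriv p w.
have [_] := diff_curve (affine_height_differentiable v c _) dl.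
rewrite scale0r addr0 => <-; rewrite (_ : (fun s : R => _) = (fun s : R => (p 0 0 *: v + c) + s *: (w 0 0 *: v))).
  by have [_ ->] := line_deriv (p 0 0 *: v + c) (w 0 0 *: v).
by apply/funext => s; rewrite !mxE scalerDl scalerA addrAC.
Qed.

Lemma height_smooth (v : V) : smooth (fun p : V => p 0 0 *: v).
Proof.
move=> s x.
(* Affine functions of the height are stable under directional derivatives, which makes the
   induction over the list of directions go through. *)
have [a [c ->]] : exists a c, foldr (fun w (Y : V -> V) => 'D_w Y) (fun p => p 0 0 *: v) s =
    (fun p : V => p 0 0 *: a + c).
  elim: s => [|w s [a [c /= ->]]]; first by exists v, 0; apply/funext => p; rewrite addr0.
  exists 0, (w 0 0 *: a); apply/funext => p.
  by rewrite derive_affine_height scaler0 add0r.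
exact: affine_height_differentiable.
Qed.

End HeightFields.

(** * The two bounds of the index *)

Section IndexBounds.
Context {R : realType} (g : space_form) {n m : nat} (r : R) (Pi N : {vspace 'rV[R]_n.+1}).
Local Notation V := 'rV[R]_n.+1.
Local Notation gc := (@gcos R g).
Local Notation gs := (@gsin R g).
Hypothesis rA : admissible g r.
Hypothesis pPi : pole \in Pi.
Hypothesis dPi : \dim Pi = m.+2.
Hypothesis NE : forall v, v \in N <-> forall z, z \in Pi -> form g v z = 0.
Local Notation S := (geodesic_subball g r Pi).
Local Notation E := (frame g m.+1 (tangent_space S pole)).
Local Notation pt := (@plane_point R g n m r Pi).
Local Notation grad := (@plane_grad R g n m r Pi).
Local Notation Q := (ball_second_variation g m.+1 r S).

Lemma plane_point00 y : pt y 0 0 = y 0 0.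
Proof.
have -> : pt y = polar_map E (y 0 0) 1 (rgrad y) by rewrite /polar_map scale1r.
exact: polar_map00.
Qed.

Lemma pole_frame00 j : row j E 0 0 = 0.
Proof.
have := pole_frame_perp rA pPi dPi j; rewrite form_pole => /eqP.
by rewrite mulf_eq0 (negbTE (kappa_neq0 _)) /= => /eqP.
Qed.

Lemma second_variation_height (v : V) : v \in N -> v != 0 -> Q (fun p : V => p 0 0 *: v) < 0.
Proof.
move=> vN v0; pose X (p : V) : V := p 0 0 *: v.
have cX : C1_field X by apply: smooth_C1; exact: height_smooth.
have vP := (NE v).1 vN.
rewrite (second_variation_sum rA pPi dPi cX) => [|p _ z zP]; last by rewrite formZl vP ?mulr0.
have dX w p : 'D_w X p = w 0 0 *: v.
  by rewrite (_ : X = fun q => q 0 0 *: v + 0) ?derive_affine_height //; apply/funext => q; rewrite addr0.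
pose c := sphere_area R m * (gc r * gs r ^+ m / gs r).
have r0 : 0 < r by case: rA.
have gr : 0 < gs r by exact: (gsin_gt0 rA).
have cr : 0 < gc r by apply: (gcos_gt0 rA) => //; lra.
have c0 : 0 < c.
  by rewrite /c mulr_gt0 ?sphere_area_gt0 // divr_gt0 // mulr_gt0 // exprn_gt0.
rewrite (eq_bigr (fun l => - (c * v 0 (lift ord0 l) ^+ 2))) => [|l _].
  rewrite sumrN oppr_lt0 -mulr_sumr mulr_gt0 // -(sqnorm_normal (g := g) (Pi := Pi)) //.
  by have [pS _] := pole_subball rA pPi; have [/(geodesic_ballE _ rA) [pA _] _] := pS;
     apply: (ambient_perp_gt0 pA) => //; rewrite formC vP.
have uE : (fun y => field_coord X l (pt y)) = (fun y => v 0 (lift ord0 l) * y 0 0).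
  by apply/funext => y; rewrite /field_coord /X mxE plane_point00 mulrC.
have gE : grad (field_coord X l) = (fun=> v 0 (lift ord0 l) *: delta_mx 0 0).
  apply/funext => y; rewrite /plane_grad.
  have dE w : 'D_w (field_coord X l) (pt y) = w 0 0 * v 0 (lift ord0 l).
    by rewrite derive_field_coord // dX mxE.
  rewrite dE pole00 mul1r [RHS]row_mx_rgrad; congr (row_mx _%:M _); first by rewrite !mxE mulr1.
  by apply/rowP => j; rewrite !mxE dE pole_frame00 mul0r mulr0.
by rewrite uE gE ball_form_height // /c; ring.
Qed.

Lemma index_ge : negative_subspace g S Q (\dim N).
Proof.
pose b := vbasis N; pose X (i : 'I_(\dim N)) (p : V) : V := p 0 0 *: b`_i.
have bN i : (i < \dim N)%N -> b`_i \in N.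
  by move=> iN; apply: vbasis_mem; rewrite mem_nth // size_tuple.
have XE (a : 'rV[R]_(\dim N)) p : \sum_i a 0 i *: X i p = p 0 0 *: \sum_i a 0 i *: b`_i.
  by rewrite scaler_sumr; apply: eq_bigr => i _; rewrite !scalerA mulrC.
have free0 (a : 'rV[R]_(\dim N)) : \sum_i a 0 i *: b`_i = 0 -> a = 0.
  move=> ab; have /freeP fb := basis_free (vbasisP N).
  by apply/rowP => i; rewrite mxE; apply: (fb (a 0)).
exists X; split=> [i|a aX|a a0].
- split; first exact: height_smooth.
  move=> p pS; apply/(normal_subball rA pPi _ pS) => z zP.
  by rewrite formZl (NE _).1 ?mulr0 // bN.
- apply: free0; have [pS _] := pole_subball rA pPi.
  by have := aX _ pS; rewrite XE pole00 scale1r.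
rewrite (_ : (fun p => _) = fun p : V => p 0 0 *: \sum_i a 0 i *: b`_i); last exact/funext.
apply: second_variation_height; last by apply: contra a0 => /eqP /free0 ->.
by apply: memv_suml => i _; rewrite memvZ // bN.
Qed.

Lemma sphere_int_mem (F : 'rV[R]_m.+1 -> V) (U : {vspace V}) : continuous F ->
  (forall w, dot w w = 1 -> F w \in U) -> \row_j sphere_int (fun w => F w 0 j) \in U.
Proof.
move=> cF FU; have [A UA] := vspace_kernel U; rewrite UA; apply/eqP/rowP => j.
have cFj i : continuous (fun w => F w 0 i) by exact: (cts_comp cF (@cts_coord _ _ _ 0 i)).
rewrite !mxE; transitivity (sphere_int (fun w => \sum_i A i j * F w 0 i)).
  rewrite sphere_int_sum => [|i]; last by apply: ctsM; [exact: ctsC|exact: cFj].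
  by apply: eq_bigr => i _; rewrite mxE mulrC sphere_intZ.
rewrite (@eq_sphere_int _ _ _ (fun=> 0)) ?sphere_int_cst ?mul0r // => w w1.
have := FU w w1; rewrite UA => /eqP /rowP /(_ j); rewrite !mxE => Fj.
by rewrite -[RHS]Fj; apply: eq_bigr => i _; rewrite mulrC.
Qed.

Lemma index_le d : negative_subspace g S Q d -> (d <= \dim N)%N.
Proof.
move=> [X [nX _ Xneg]]; have r0 : 0 < r by case: rA.
have cX i : C1_field (X i) by apply: smooth_C1; have [] := nX i.
have XN i p : S p -> X i p \in N.
  by move=> pS; apply/NE/(normal_subball rA pPi _ pS); have [_] := nX i; exact.
pose q := polar_map E (gc r) (gs r).
have qS w : dot w w = 1 -> S (q w) by move=> w1; apply: polar_map_subball => //; lra.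
have cq : continuous q.
  apply: cts_mx => i j; under eq_fun do rewrite !mxE.
  apply: ctsD; first exact: ctsC.
  apply: ctsM; first exact: ctsC.
  by apply: cts_sum => l; apply: ctsM; [exact: cts_coord|exact: ctsC].
have cXq i : continuous (fun w => X i (q w)).
  apply: (cts_comp cq) => p; apply: differentiable_continuous.
  by have [] := cX i.
pose L i : V := \row_j sphere_int (fun w => X i (q w) 0 j).
have LN i : L i \in N by apply: sphere_int_mem => // w w1; apply: XN; exact: qS.
pose s := [tuple L i | i < d].
have fs : free s.
  apply/freeP => a; rewrite (eq_bigr (fun i => a i *: L i)) => [aL i|i _]; last first.
    by rewrite -tnth_nth tnth_mktuple.
  pose b : 'rV[R]_d := \row_i a i.
  have bE j : b 0 j = a j by rewrite mxE.
  apply/eqP; rewrite -bE; apply/eqP; suff -> : b = 0 by rewrite mxE.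
  (* A nonzero [b] would make the form negative on the combination; yet every coordinate of that
     combination has mean zero over the boundary, so each scalar form is nonnegative. Hence the
     boundary means [L i] are free in [N]. *)
  apply/eqP; apply/negPn/negP => /Xneg; apply/negP; rewrite -leNgt.
  set Y := fun p => _.
  have cY : C1_field Y by exact: C1_comb.
  rewrite (second_variation_sum rA pPi dPi cY) => [|p pS]; last first.
    by apply/NE; apply: memv_suml => j _; rewrite memvZ // XN.
  apply: sumr_ge0 => l _; apply: ball_form_ge0 => //.
    exact: field_coord_has_grad.
  transitivity ((\sum_j a j *: L j) 0 (lift ord0 l)); last by rewrite aL mxE.
  have cXl j : continuous (fun w => X j (q w) 0 (lift ord0 l)).
    exact: (cts_comp (cXq j) (@cts_coord _ _ _ 0 (lift ord0 l))).
  rewrite (@eq_sphere_int _ _ _ (fun w => \sum_j a j * X j (q w) 0 (lift ord0 l))).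
    rewrite sphere_int_sum => [|j]; last by apply: ctsM; [exact: ctsC|exact: cXl].
    by rewrite summxE; apply: eq_bigr => j _; rewrite sphere_intZ // !mxE.
  move=> w _; rewrite /pol_val plane_point_polar /field_coord /Y summxE.
  by apply: eq_bigr => j _; rewrite mxE bE.
have <- : \dim (span s) = d by move: fs; rewrite /free size_tuple => /eqP.
apply: dimvS; apply/span_subvP => v /tnthP [i ->].
by rewrite tnth_mktuple.
Qed.

End IndexBounds.

Theorem theorem1p5 (R : realType) (g : space_form) (n k : nat) (r : R)
    (Pi : {vspace 'rV[R]_n.+1}) :
  (1 <= k)%N -> (k < n)%N -> 0 < r -> (g = Spherical -> r < pi / 2) ->
  \dim Pi = k.+1 -> pole \in Pi ->
  morse_index_is g (geodesic_subball g r Pi)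
    (ball_second_variation g k r (geodesic_subball g r Pi)) (n - k)%N.
Proof.
case: k => // m _ _ r0 rp dPi pPi; have rA : admissible g r by [].
have [N [NE <-]] := normal_vspace rA pPi dPi.
by split; [exact: index_ge|exact: index_le].
Qed.
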